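(* Let $M$ be a 3-dimensional oriented Riemannian manifold with Riemannian volume $\mu$, and let $\pi$ be a bivector field on $M$. Then the following assertions are equivalent: (1) $\pi$ is a Killing-Poisson tensor; (2) $\pi$ is a Poisson tensor and $\mathcal D\pi=0$, where $\mathcal D$ is the metric contravariant connection associated to $\pi$ and the Riemannian metric; (3) the 1-form $\alpha=i_\pi\mu$ satisfies $d\alpha=0$ and $d\langle\alpha,\alpha\rangle+\delta(\alpha)\alpha=0$, where $\delta(\alpha)=-\mathrm{div}(\#(\alpha))$.
   Context: All objects are smooth. $g$ is the Riemannian metric, $\langle\cdot,\cdot\rangle$ the induced metric on covectors, $\#:T^*M\to TM$ the isomorphism induced by $g$, $\mathrm{div}$ of a vector field its Riemannian divergence, $i_\pi\mu$ the contraction of the 3-form $\mu$ with the bivector $\pi$. A Poisson tensor on $M$ is a bivector field $\pi\in\Gamma(\wedge^2TM)$ with $[\pi,\pi]=0$ (Schouten-Nijenhuis bracket). Its anchor $\pi_\#:T^*M\to TM$ is defined by $\beta(\pi_\#(\alpha))=\pi(\alpha,\beta)$, and its Koszul bracket by $[\alpha,\beta]_\pi=L_{\pi_\#(\alpha)}\beta-L_{\pi_\#(\beta)}\alpha-d(\pi(\alpha,\beta))$. A function $f$ on an open set is a Casimir function if $\pi_\#(df)=0$. The metric contravariant connection $\mathcal D:\Omega^1(M)\times\Omega^1(M)\to\Omega^1(M)$ associated to $(\pi,g)$ is the unique map, $C^\infty(M)$-linear in the first argument, $\mathbb R$-linear in the second, satisfying $\mathcal D_\alpha(f\beta)=f\mathcal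 D_\alpha\beta+\pi_\#(\alpha)(f)\beta$, $\pi_\#(\alpha).\langle\beta,\gamma\rangle=\langle\mathcal D_\alpha\beta,\gamma\rangle+\langle\beta,\mathcal D_\alpha\gamma\rangle$, and $\mathcal D_\alpha\beta-\mathcal D_\beta\alpha=[\alpha,\beta]_\pi$. The condition $\mathcal D\pi=0$ means $\pi_\#(\alpha).\pi(\beta,\gamma)=\pi(\mathcal D_\alpha\beta,\gamma)+\pi(\beta,\mathcal D_\alpha\gamma)$ for all $\alpha,\beta,\gamma\in\Omega^1(M)$. A Poisson tensor $\pi$ on $(M,g)$ is a Killing-Poisson tensor if (i) the divergence of $\pi$ with respect to the Levi-Civita connection $\nabla$ (the vector field obtained by contracting $\nabla\pi$) vanishes, and (ii) for any open set $U\subset M$ and any Casimir function $f\in C^\infty(U)$, $L_{\nabla f}\pi=0$, where $\nabla f$ is the gradient of $f$. *)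

(* Defs.v *)
From mathcomp Require Import all_boot all_order all_algebra.
From mathcomp Require Import all_classical all_reals all_analysis.

Set Implicit Arguments.
Unset Strict Implicit.
Unset Printing Implicit Defensive.

Import Order.TTheory GRing.Theory Num.Theory.
Import numFieldNormedType.Exports.

Local Open Scope classical_set_scope.
Local Open Scope ring_scope.

Definition partial (R : realType) (n : nat) (i : 'I_n) (f : 'rV[R]_n -> R)
  : 'rV[R]_n -> R := fun x => 'D_('e_i) f x.

(* Meant for open V: C^oo on V means that all iterated partial derivatives
   exist and are differentiable on V. *)
Definition smooth_on (R : realType) (n : nat) (V : set 'rV[R]_n)
    (f : 'rV[R]_n -> R) : Prop :=
  forall (s : seq 'I_n) (x : 'rV[R]_n), V x ->
    differentiable (foldr (@partial R n) f s) x.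

(* [point] is only relevant on [coord @` dom]. *)
Record chart (R : realType) (n : nat) (T : topologicalType) := Chart {
  dom : set T;
  coord : T -> 'rV[R]_n;
  point : 'rV[R]_n -> T;
  dom_open : open dom;
  coord_open : open (coord @` dom);
  coordK : forall p, dom p -> point (coord p) = p;
  coord_cont : forall p, dom p -> {for p, continuous coord};
  point_cont : forall p, dom p -> {for coord p, continuous point}
}.

Definition transition (R : realType) (n : nat) (T : topologicalType)
  (c d : chart R n T) : 'rV[R]_n -> 'rV[R]_n := coord d \o point c.

(* The atlas need not be maximal.  [chart_at] is auxiliary: it only serves to
   identify the tangent space at p with R^n, see below. *)
Record smooth_manifold (R : realType) (n : nat) := SmoothManifold {
  carrier :> topologicalType;
  carrier_hausdorff : hausdorff_space carrier;
  carrier_second_countable : @second_countable carrier;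
  atlas : set (chart R n carrier);
  atlas_smooth : forall c d, atlas c -> atlas d -> forall j,
    smooth_on (coord c @` (dom c `&` dom d))
              (fun x => transition c d x ord0 j);
  chart_at : carrier -> chart R n carrier;
  chart_at_atlas : forall p, atlas (chart_at p);
  chart_at_dom : forall p, dom (chart_at p) p
}.

(* An orientation is given by restricting to an atlas of positively oriented
   charts. *)
Definition oriented (R : realType) (n : nat) (M : smooth_manifold R n) : Prop :=
  forall c d, @atlas R n M c -> @atlas R n M d ->
    forall p, dom c p -> dom d p ->
      0 < \det (jacobian (transition c d) (coord c p)).

Definition smooth_fun_on (R : realType) (n : nat) (M : smooth_manifold R n)
    (U : set M) (f : M -> R) : Prop :=
  forall c, @atlas R n M c ->
    smooth_on (coord c @` (U `&` dom c)) (f \o point c).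

(* The tangent space at p and its dual are both identified with R^n (row
   vectors) by means of the coordinate basis of [chart_at p] and its dual
   basis.  Thus a vector field or a 1-form is a function M -> 'rV_n, a bivector
   field or a metric is a function M -> 'M_n.  Nothing depends on the choice of
   [chart_at]: smoothness and all differential operators are expressed through
   the components in arbitrary charts of the atlas, which are given by the
   usual transformation laws.  Recall that the matrix ['J f x] of [jacobian]
   acts on row vectors from the right, i.e. its (i, j) entry is the derivative
   along 'e_i of the j-th component of f. *)

(* For p in [dom c]: d(x_c)/d(x_{chart_at p}) and its inverse. *)
Definition jac_to (R : realType) (n : nat) (M : smooth_manifold R n)
    (c : chart R n M) (p : M) : 'M[R]_n :=
  jacobian (transition (chart_at p) c) (coord (chart_at p) p).

Definition jac_from (R : realType) (n : nat) (M : smooth_manifold R n)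
    (c : chart R n M) (p : M) : 'M[R]_n :=
  jacobian (transition c (chart_at p)) (coord c p).

(* Meaningful on [coord c @` dom c] only. *)
Definition vec_in (R : realType) (n : nat) (M : smooth_manifold R n)
    (c : chart R n M) (X : M -> 'rV[R]_n) : 'rV[R]_n -> 'rV[R]_n :=
  fun x => X (point c x) *m jac_to c (point c x).

Definition form_in (R : realType) (n : nat) (M : smooth_manifold R n)
    (c : chart R n M) (a : M -> 'rV[R]_n) : 'rV[R]_n -> 'rV[R]_n :=
  fun x => a (point c x) *m (jac_from c (point c x))^T.

Definition bivec_in (R : realType) (n : nat) (M : smooth_manifold R n)
    (c : chart R n M) (P : M -> 'M[R]_n) : 'rV[R]_n -> 'M[R]_n :=
  fun x => (jac_to c (point c x))^T *m P (point c x) *m jac_to c (point c x).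

Definition metric_in (R : realType) (n : nat) (M : smooth_manifold R n)
    (c : chart R n M) (g : M -> 'M[R]_n) : 'rV[R]_n -> 'M[R]_n :=
  fun x =>
    jac_from c (point c x) *m g (point c x) *m (jac_from c (point c x))^T.

Definition smooth_form (R : realType) (n : nat) (M : smooth_manifold R n)
    (a : M -> 'rV[R]_n) : Prop :=
  forall c, @atlas R n M c -> forall i,
    smooth_on (coord c @` dom c) (fun x => form_in c a x ord0 i).

Definition bivector_field (R : realType) (n : nat) (M : smooth_manifold R n)
    (P : M -> 'M[R]_n) : Prop :=
  (forall p, (P p)^T = - P p) /\
  (forall c, @atlas R n M c -> forall i j,
     smooth_on (coord c @` dom c) (fun x => bivec_in c P x i j)).

Definition riemannian_metric (R : realType) (n : nat) (M : smooth_manifold R n)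
    (g : M -> 'M[R]_n) : Prop :=
  [/\ forall p, (g p)^T = g p,
      forall p (v : 'rV[R]_n), v != 0 -> 0 < (v *m g p *m v^T) ord0 ord0
    & forall c, @atlas R n M c -> forall i j,
        smooth_on (coord c @` dom c) (fun x => metric_in c g x i j)].

(* An identity Q between components holds in every chart, at every point
   of U. *)
Definition in_charts (R : realType) (n : nat) (M : smooth_manifold R n)
    (U : set M) (Q : chart R n M -> 'rV[R]_n -> Prop) : Prop :=
  forall c, @atlas R n M c -> forall p, U p -> dom c p -> Q c (coord c p).

Definition differential (R : realType) (n : nat) (M : smooth_manifold R n)
    (f : M -> R) : M -> 'rV[R]_n :=
  fun p => \row_i partial i (f \o point (chart_at p)) (coord (chart_at p) p).

Definition act (R : realType) (n : nat) (M : smooth_manifold R n)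
    (X : M -> 'rV[R]_n) (f : M -> R) : M -> R :=
  fun p => (X p *m (differential f p)^T) ord0 ord0.

Definition bivec_eval (R : realType) (n : nat) (M : smooth_manifold R n)
    (P : M -> 'M[R]_n) (a b : M -> 'rV[R]_n) : M -> R :=
  fun p => (a p *m P p *m (b p)^T) ord0 ord0.

Definition anchor (R : realType) (n : nat) (M : smooth_manifold R n)
    (P : M -> 'M[R]_n) (a : M -> 'rV[R]_n) : M -> 'rV[R]_n :=
  fun p => a p *m P p.

Definition form_prod (R : realType) (n : nat) (M : smooth_manifold R n)
    (g : M -> 'M[R]_n) (a b : M -> 'rV[R]_n) : M -> R :=
  fun p => (a p *m invmx (g p) *m (b p)^T) ord0 ord0.

Definition sharp (R : realType) (n : nat) (M : smooth_manifold R n)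
    (g : M -> 'M[R]_n) (a : M -> 'rV[R]_n) : M -> 'rV[R]_n :=
  fun p => a p *m invmx (g p).

Definition gradient (R : realType) (n : nat) (M : smooth_manifold R n)
    (g : M -> 'M[R]_n) (f : M -> R) : M -> 'rV[R]_n :=
  sharp g (differential f).

(* Riemannian volume; correct on an oriented manifold, since [chart_at p] is
   then a positive chart. *)
Definition volume (R : realType) (M : smooth_manifold R 3) (g : M -> 'M[R]_3)
    (p : M) (u v w : 'rV[R]_3) : R :=
  Num.sqrt (\det (g p)) * \det (\matrix_(a < 3) [:: u; v; w]`_a).

(* i_P mu, with the convention i_{X /\ Y} mu = mu(X, Y, -). *)
Definition contract_volume (R : realType) (M : smooth_manifold R 3)
    (g : M -> 'M[R]_3) (P : M -> 'M[R]_3) : M -> 'rV[R]_3 :=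
  fun p => \row_k \sum_(i < 3) \sum_(j < 3 | (i < j)%N)
    P p i j * volume g p 'e_i 'e_j 'e_k.

Definition ext_d (R : realType) (n : nat) (M : smooth_manifold R n)
    (c : chart R n M) (a : M -> 'rV[R]_n) (x : 'rV[R]_n) : 'M[R]_n :=
  \matrix_(i, j) (partial i (fun y => form_in c a y ord0 j) x
                  - partial j (fun y => form_in c a y ord0 i) x).

Definition lie_form (R : realType) (n : nat) (M : smooth_manifold R n)
    (c : chart R n M) (X b : M -> 'rV[R]_n) (x : 'rV[R]_n) : 'rV[R]_n :=
  \row_j \sum_k
    (vec_in c X x ord0 k * partial k (fun y => form_in c b y ord0 j) x
     + form_in c b x ord0 k * partial j (fun y => vec_in c X y ord0 k) x).

Definition lie_bivec (R : realType) (n : nat) (M : smooth_manifold R n)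
    (c : chart R n M) (X : M -> 'rV[R]_n) (P : M -> 'M[R]_n) (x : 'rV[R]_n)
  : 'M[R]_n :=
  \matrix_(i, j) \sum_k
    (vec_in c X x ord0 k * partial k (fun y => bivec_in c P y i j) x
     - bivec_in c P x k j * partial k (fun y => vec_in c X y ord0 i) x
     - bivec_in c P x i k * partial k (fun y => vec_in c X y ord0 j) x).

Definition koszul (R : realType) (n : nat) (M : smooth_manifold R n)
    (c : chart R n M) (P : M -> 'M[R]_n) (a b : M -> 'rV[R]_n) (x : 'rV[R]_n)
  : 'rV[R]_n :=
  lie_form c (anchor P a) b x - lie_form c (anchor P b) a x
  - form_in c (differential (bivec_eval P a b)) x.

(* Component (i, j, k) of the Schouten-Nijenhuis bracket [P, Q] (up to the
   overall sign, on which conventions differ). *)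
Definition schouten (R : realType) (n : nat) (M : smooth_manifold R n)
    (c : chart R n M) (P Q : M -> 'M[R]_n) (x : 'rV[R]_n) (i j k : 'I_n) : R :=
  let term (A B : M -> 'M[R]_n) (i j k : 'I_n) :=
    \sum_l bivec_in c A x i l * partial l (fun y => bivec_in c B y j k) x in
  term P Q i j k + term P Q j k i + term P Q k i j
  + (term Q P i j k + term Q P j k i + term Q P k i j).

(* Gamma^i_{kl} of the Levi-Civita connection *)
Definition christoffel (R : realType) (n : nat) (M : smooth_manifold R n)
    (c : chart R n M) (g : M -> 'M[R]_n) (x : 'rV[R]_n) (i k l : 'I_n) : R :=
  2^-1 * \sum_m invmx (metric_in c g x) i m *
    (partial k (fun y => metric_in c g y m l) x
     + partial l (fun y => metric_in c g y m k) x
     - partial m (fun y => metric_in c g y k l) x).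

(* nabla_k X^i *)
Definition nabla_vec (R : realType) (n : nat) (M : smooth_manifold R n)
    (c : chart R n M) (g : M -> 'M[R]_n) (X : M -> 'rV[R]_n) (x : 'rV[R]_n)
    (k i : 'I_n) : R :=
  partial k (fun y => vec_in c X y ord0 i) x
  + \sum_l christoffel c g x i k l * vec_in c X x ord0 l.

Definition divergence (R : realType) (n : nat) (M : smooth_manifold R n)
    (c : chart R n M) (g : M -> 'M[R]_n) (X : M -> 'rV[R]_n) (x : 'rV[R]_n)
  : R :=
  \sum_i nabla_vec c g X x i i.

(* nabla_k P^{ij} *)
Definition nabla_bivec (R : realType) (n : nat) (M : smooth_manifold R n)
    (c : chart R n M) (g P : M -> 'M[R]_n) (x : 'rV[R]_n) (k i j : 'I_n) : R :=
  partial k (fun y => bivec_in c P y i j) x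
  + \sum_l (christoffel c g x i k l * bivec_in c P x l j
            + christoffel c g x j k l * bivec_in c P x i l).

Definition div_bivec (R : realType) (n : nat) (M : smooth_manifold R n)
    (c : chart R n M) (g P : M -> 'M[R]_n) (x : 'rV[R]_n) : 'rV[R]_n :=
  \row_j \sum_i nabla_bivec c g P x i i j.

Definition codiff (R : realType) (n : nat) (M : smooth_manifold R n)
    (c : chart R n M) (g : M -> 'M[R]_n) (a : M -> 'rV[R]_n) (x : 'rV[R]_n)
  : R :=
  - divergence c g (sharp g a) x.

Definition poisson_tensor (R : realType) (n : nat) (M : smooth_manifold R n)
    (P : M -> 'M[R]_n) : Prop :=
  bivector_field P /\
  in_charts [set: M] (fun c x => forall i j k, schouten c P P x i j k = 0).

Definition casimir_on (R : realType) (n : nat) (M : smooth_manifold R n)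
    (P : M -> 'M[R]_n) (U : set M) (f : M -> R) : Prop :=
  smooth_fun_on U f /\ forall p, U p -> anchor P (differential f) p = 0.

Definition killing_poisson (R : realType) (n : nat) (M : smooth_manifold R n)
    (g P : M -> 'M[R]_n) : Prop :=
  [/\ poisson_tensor P,
      in_charts [set: M] (fun c x => div_bivec c g P x = 0)
    & forall (U : set M) (f : M -> R), open U -> casimir_on P U f ->
        in_charts U (fun c x => lie_bivec c (gradient g f) P x = 0)].

(* The conditions determine D uniquely on smooth 1-forms; its values elsewhere
   are irrelevant. *)
Definition metric_contravariant_connection (R : realType) (n : nat)
    (M : smooth_manifold R n) (g P : M -> 'M[R]_n)
    (D : (M -> 'rV[R]_n) -> (M -> 'rV[R]_n) -> (M -> 'rV[R]_n)) : Prop :=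
  (forall a b, smooth_form a -> smooth_form b -> smooth_form (D a b)) /\
  (forall (f : M -> R) a a' b, smooth_fun_on [set: M] f ->
     smooth_form a -> smooth_form a' -> smooth_form b ->
     forall p, D (fun q => f q *: a q + a' q) b p
               = f p *: D a b p + D a' b p) /\
  (forall (r : R) a b b', smooth_form a -> smooth_form b -> smooth_form b' ->
     forall p, D a (fun q => r *: b q + b' q) p = r *: D a b p + D a b' p) /\
  (forall (f : M -> R) a b, smooth_fun_on [set: M] f ->
     smooth_form a -> smooth_form b ->
     forall p, D a (fun q => f q *: b q) p
               = f p *: D a b p + act (anchor P a) f p *: b p) /\
  (forall a b b', smooth_form a -> smooth_form b -> smooth_form b' ->
     forall p, act (anchor P a) (form_prod g b b') p
               = form_prod g (D a b) b' p + form_prod g b (D a b') p) /\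
  (forall a b, smooth_form a -> smooth_form b ->
     in_charts [set: M] (fun c x =>
       form_in c (fun q => D a b q - D b a q) x = koszul c P a b x)).

Definition parallel (R : realType) (n : nat) (M : smooth_manifold R n)
    (P : M -> 'M[R]_n)
    (D : (M -> 'rV[R]_n) -> (M -> 'rV[R]_n) -> (M -> 'rV[R]_n)) : Prop :=
  forall a b b', smooth_form a -> smooth_form b -> smooth_form b' ->
    forall p, act (anchor P a) (bivec_eval P b b') p
              = bivec_eval P (D a b) b' p + bivec_eval P b (D a b') p.

(* Main.v *)
Require Import Defs.
From HB Require Import structures.
From mathcomp Require Import all_boot all_order all_algebra.
From mathcomp Require Import all_classical all_reals all_analysis.
From mathcomp Require Import ring lra.
Import Defs.
Set Implicit Arguments.
Unset Strict Implicit.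
Unset Printing Implicit Defensive.
Import Order.TTheory GRing.Theory Num.Theory.
Import numFieldNormedType.Exports.
Local Open Scope classical_set_scope.
Local Open Scope ring_scope.

(**
In a chart, let G be the matrix of the metric, H its inverse, s = sqrt (det G), P the
matrix of the bivector, a the row of components of the contracted volume, W = da, and
A = a H the metric dual of a. In dimension three a skew matrix is the matrix [hat] of a
cross product, and P = s^-1 hat a ([bivec_in_volume]; the orientation removes the sign).
All three assertions thus become statements on a.

The link with assertion (1) consists of two identities. Since the logarithmic derivative
of s is the trace of the Christoffel symbols, div P is s^-1 times the curl of a; hence
div P = 0 is da = 0 ([div_bivec_closed]), and then P is Poisson ([closed_schouten]). For
a vector field X, s L_X P = hat (L_X a - div X a) ([lie_bivec_volume]); if da = 0 then
L_A a = d<a, a>, so that the second equation of (3) is L_A P = 0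
([closed_lie_bivec_sharp]). If (1) holds, then da = 0 and by the Poincare lemma a = df
near each point; f is a Casimir function because a P = 0, and its gradient is A
([killing_lie_sharp]). Conversely, if a has no zero near a point, a Casimir function f
satisfies df = h a, because df is annihilated by hat a; as df and a are closed, dh is
proportional to a, and it follows that L_{grad f} P = h L_A P = 0 ([casimir_lie_at]).

For assertion (2), let row j of D_i be the covector D_{e_i} e_j, and let row i of U be
D_{e_i} a. By the metric condition, D_{e_i} P = s^-1 hat (U_i) ([bivec_deriv]), so D is
parallel if and only if K = U H vanishes. Torsion-freeness and the metric condition
determine both parts of K: its symmetric part is that of P W H ([frame_symmetric_part]),
and K - K^T = - L_A P ([frame_skew_part]). Hence (3) implies K = 0. Conversely K = 0 gives
L_A P = 0, and W = 0 wherever a is not zero, by a linear computation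
([sym_contraction_eq0]).

Two constructions connect this algebra with connections on the manifold. From (2) to (3),
the matrices D_i at a point come from the values of D on bump forms that agree with the
coordinate frame to first order at that point ([parallel_local]). From (3) to (2),
a connection has to be produced: it is defined by contravariant Christoffel symbols
([symbol]) in each chart, and [conn_in_invariant] rewrites it with exterior derivatives,
gradients and Lie brackets, which shows that it does not depend on the chart
([conn_in_change]).

At the zeros of a, closedness and the vanishing of L_{grad f} P follow by continuity from
the points where a is not zero, or from the fact that a vanishes in a neighbourhood
([vanish_by_density]).
*)

(** * Partial derivatives and smooth functions *)

Lemma differentiable_approx (R : realType) (V W : normedModType R)
    (f : V -> W) x (L : {linear V -> W}) : continuous L ->
  (forall e, 0 < e -> \forall h \near (0 : V),
     `|f (h + x) - f x - L h| <= e * `|h|) ->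
  differentiable f x.
Proof.
move=> Lc H.
have E : f \o shift x = cst (f x) + L +o_ 0 id.
  apply/eqaddoP => e e0.
  have := H _ e0; apply: filterS => h /=.
  by rewrite -!addrA -opprD.
by apply/diff_locallyP; rewrite (diff_unique Lc E).
Qed.

Section PartialCalculus.
Variables (R : realType) (n : nat).
Implicit Types (f g : 'rV[R]_n -> R) (x y : 'rV[R]_n) (V : set 'rV[R]_n).

Lemma differentiable_bigsum (I : Type) (r : seq I) (Q : pred I)
    (F : I -> 'rV[R]_n -> R) x :
  (forall j, Q j -> differentiable (F j) x) ->
  differentiable (fun y => \sum_(j <- r | Q j) F j y) x.
Proof.
move=> dF; elim: r => [|j r IH].
  rewrite (_ : (fun _ => _) = cst 0); first exact: differentiable_cst.
  by apply/funext => y; rewrite big_nil.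
rewrite (_ : (fun _ => _) = fun y => (if Q j then F j y else 0) +
    \sum_(j <- r | Q j) F j y).
  apply: differentiableD => //; case: (boolP (Q j)) => [|_]; first exact: dF.
  exact: differentiable_cst.
by apply/funext => y; rewrite big_cons; case: ifP; rewrite ?add0r.
Qed.

Lemma linear_rV_continuous (L : {linear 'rV[R]_n -> R}) : continuous L.
Proof.
have -> : (L : 'rV[R]_n -> R) =
    fun v => \sum_j v ord0 j * L (delta_mx ord0 j).
  apply/funext => v; rewrite {1}(row_sum_delta v) linear_sum.
  by apply: eq_bigr => j _; rewrite linearZ.
move=> v; apply: differentiable_continuous.
apply: differentiable_bigsum => j _; apply: differentiableM.
  exact: differentiable_coord.
exact: differentiable_cst.
Qed.

Lemma differentiable_near_eq f g x :
  (\near x, f x = g x) -> differentiable f x -> differentiable g x.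
Proof.
move=> fg df; apply: (@differentiable_approx R _ _ _ _ ('d f x)).
  exact: diff_continuous.
move=> e e0.
have /diff_locallyP[_ /eqaddoP/(_ _ e0) H] := df.
have fg0 := nbhs_singleton fg.
have: \forall h \near (0 : 'rV[R]_n), f (h + x) = g (h + x).
  move: fg; rewrite (near_shift 0 x); apply: filterS => h /=.
  by rewrite subr0.
move=> fg'; near=> h.
have <- : f (h + x) = g (h + x) by near: h.
rewrite -fg0 -addrA -opprD.
by near: h; exact: H.
Unshelve. all: by end_near. Qed.

Lemma partialE i f x : differentiable f x -> partial i f x = 'd f x 'e_i.
Proof. by move=> df; rewrite /partial deriveE. Qed.

Lemma partial_near_eq i f g x :
  (\near x, f x = g x) -> partial i f x = partial i g x.
Proof. exact: near_eq_derive. Qed.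

Lemma diff_partial f x v : differentiable f x ->
  'd f x v = \sum_i v ord0 i * partial i f x.
Proof.
move=> df; rewrite {1}(row_sum_delta v) linear_sum.
by apply: eq_bigr => j _; rewrite linearZ partialE.
Qed.

Lemma partial_cst i (k : R) x : partial i (fun=> k) x = 0.
Proof. exact: derive_cst. Qed.

Lemma partial_coord i j x : partial i (fun y : 'rV[R]_n => y ord0 j) x = 1%:M i j.
Proof.
have d : differentiable (fun y : 'rV[R]_n => y ord0 j) x by exact: differentiable_coord.
have lin : linear (fun y : 'rV[R]_n => y ord0 j) by move=> k u v; rewrite !mxE.
pose L : {linear 'rV[R]_n -> R} := HB.pack (fun y : 'rV[R]_n => y ord0 j)
  (GRing.isLinear.Build _ _ _ _ _ lin).
rewrite partialE // -[fun y => _]/(L : 'rV[R]_n -> R) diff_lin.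
  by rewrite /L /= !mxE eqxx eq_sym.
exact: linear_rV_continuous.
Qed.

Lemma partialD i f g x : differentiable f x -> differentiable g x ->
  partial i (fun y => f y + g y) x = partial i f x + partial i g x.
Proof. by move=> df dg; apply: deriveD; exact: diff_derivable. Qed.

Lemma partialN i f x : differentiable f x ->
  partial i (fun y => - f y) x = - partial i f x.
Proof. by move=> df; apply: deriveN; exact: diff_derivable. Qed.

Lemma partialM i f g x : differentiable f x -> differentiable g x ->
  partial i (fun y => f y * g y) x = partial i f x * g x + f x * partial i g x.
Proof.
move=> df dg; rewrite [LHS]deriveM; [|exact: diff_derivable..].
by rewrite addrC; congr (_ + _); rewrite /GRing.scale/= mulrC.
Qed.

Lemma partial_sum (I : Type) (r : seq I) (Q : pred I)
    (F : I -> 'rV[R]_n -> R) i x :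
  (forall j, Q j -> differentiable (F j) x) ->
  partial i (fun y => \sum_(j <- r | Q j) F j y) x =
  \sum_(j <- r | Q j) partial i (F j) x.
Proof.
move=> dF; elim: r => [|j r IH].
  rewrite big_nil -[RHS](partial_cst i 0 x); congr (partial _ _ _).
  by apply/funext => y; rewrite big_nil.
rewrite big_cons -IH.
case: ifPn => Qj.
  rewrite -partialD; [|exact: dF|exact: differentiable_bigsum].
  by congr (partial _ _ _); apply/funext => y; rewrite big_cons Qj.
by congr (partial _ _ _); apply/funext => y; rewrite big_cons (negbTE Qj).
Qed.

Lemma partial_comp1 i (h : R -> R) (dh : R) f x :
  differentiable f x -> is_derive (f x) 1 h dh ->
  differentiable (h \o f) x /\ partial i (h \o f) x = dh * partial i f x.
Proof.
move=> df [/derivable1_diffP dh1 dhE]; split.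
  exact: differentiable_comp.
rewrite partialE; last exact: differentiable_comp.
rewrite diff_comp //= -partialE // -dhE deriveE //.
by rewrite -[in LHS](mulr1 (partial i f x)) [LHS]linearZ mulrC.
Qed.
End PartialCalculus.

Section ChainRule.
Variables (R : realType) (m n : nat).
Implicit Types (f : 'rV[R]_n -> R) (tau : 'rV[R]_m -> 'rV[R]_n).

Lemma differentiable_rV tau x :
  (forall j, differentiable (fun y => tau y ord0 j) x) -> differentiable tau x.
Proof.
move=> dtau.
have -> : tau = \sum_(j < n) (fun y => tau y ord0 j *: 'e_j).
  by apply/funext => y; rewrite fct_sumE {1}(row_sum_delta (tau y)).
by apply: differentiable_sum => j; exact: differentiableZl.
Qed.

Lemma differentiable_coordw tau x j :
  differentiable tau x -> differentiable (fun y => tau y ord0 j) x.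
Proof.
move=> dtau; apply: (@differentiable_comp _ _ _ _ tau
  (fun N : 'rV[R]_n => N ord0 j : R)) => //; exact: differentiable_coord.
Qed.

Lemma derive_coordw tau x v j : differentiable tau x ->
  ('D_v tau x) ord0 j = 'D_v (fun y => tau y ord0 j) x.
Proof.
move=> dtau; rewrite derive_mx; first by rewrite mxE.
exact: diff_derivable.
Qed.

Lemma jacobianE tau x i j : differentiable tau x ->
  jacobian tau x i j = partial i (fun y => tau y ord0 j) x.
Proof.
by move=> dtau; rewrite /partial -derive_coordw // deriveE // /jacobian !mxE.
Qed.

Lemma partial_comp f tau x i :
  differentiable f (tau x) -> differentiable tau x ->
  partial i (f \o tau) x =
  \sum_j partial i (fun y => tau y ord0 j) x * partial j f (tau x).
Proof.
move=> df dtau; rewrite partialE; last exact: differentiable_comp.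
rewrite diff_comp //= diff_partial //; apply: eq_bigr => j _; congr (_ * _).
by rewrite -deriveE // derive_coordw.
Qed.
End ChainRule.

Section CkDef.
Variables (R : realType) (n : nat) (V : set 'rV[R]_n).

(** A version of [smooth_on] graded by the order of differentiation: closure under
operations is proved by induction on that order. *)
Fixpoint Ck (k : nat) (f : 'rV[R]_n -> R) : Prop :=
  (forall x, V x -> differentiable f x) /\
  if k is k'.+1 then forall i, Ck k' (partial i f) else True.
End CkDef.

Section Ck.
Variables (R : realType).

Lemma smooth_onP n (V : set 'rV[R]_n) f :
  smooth_on V f <-> forall k, Ck V k f.
Proof.
split=> [sf k|H s x Vx].
  have df x : V x -> differentiable f x by exact: (sf [::]).
  elim: k f sf df => [|k IH] f sf df; split=> // i.
  by apply: IH; [|move=> x; exact: (sf [:: i])] => s x Vx; have := sf (rcons s i) x Vx; rewrite foldr_rcons.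
elim/last_ind: s f H => [|s i IH] f H; first exact: (H 0%N).1.
by rewrite foldr_rcons; apply: IH => k; exact: (H k.+1).2.
Qed.

Lemma Ck_diff n k (V : set 'rV[R]_n) f x : Ck V k f -> V x -> differentiable f x.
Proof. by case: k => [|k] []; move=> H _ /H. Qed.

Lemma CkS n k (V : set 'rV[R]_n) f i : Ck V k.+1 f -> Ck V k (partial i f).
Proof. by case=> _; exact. Qed.

Lemma CkW n k (V : set 'rV[R]_n) f : Ck V k.+1 f -> Ck V k f.
Proof.
elim: k f => [|k IH] f [df dpf]; split=> // i; exact: IH.
Qed.

Lemma Ck_ext n k (V : set 'rV[R]_n) f g : open V ->
  (forall x, V x -> f x = g x) -> Ck V k f -> Ck V k g.
Proof.
move=> oV; elim: k f g => [|k IH] f g fg [df dpf]; split=> //.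
- move=> x Vx; apply: differentiable_near_eq (df _ Vx).
  by apply: filterS (open_nbhs_nbhs (conj oV Vx)); exact: fg.
- move=> x Vx; apply: differentiable_near_eq (df _ Vx).
  by apply: filterS (open_nbhs_nbhs (conj oV Vx)); exact: fg.
- move=> i; apply: IH (dpf i) => x Vx; apply: partial_near_eq.
  by apply: filterS (open_nbhs_nbhs (conj oV Vx)); exact: fg.
Qed.

Lemma Ck_sub n k (V W : set 'rV[R]_n) f : W `<=` V -> Ck V k f -> Ck W k f.
Proof.
move=> WV; elim: k f => [|k IH] f [df dpf]; split=> //; try by move=> x /WV/df.
by move=> i; apply: IH; exact: dpf.
Qed.

Lemma Ck_cst n k (V : set 'rV[R]_n) (a : R) : Ck V k (fun=> a).
Proof.
elim: k a => [|k IH] a; split=> //; try by move=> x _; exact: differentiable_cst.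
move=> i; by rewrite (_ : partial i _ = fun=> 0) //; apply/funext => x; exact: partial_cst.
Qed.

Lemma CkD n k (V : set 'rV[R]_n) f g : open V ->
  Ck V k f -> Ck V k g -> Ck V k (fun y => f y + g y).
Proof.
move=> oV; elim: k f g => [|k IH] f g Cf Cg; split=> //;
  try by move=> x Vx; apply: differentiableD; [exact: Ck_diff Cf Vx|exact: Ck_diff Cg Vx].
move=> i; apply: (@Ck_ext n k V (fun y => partial i f y + partial i g y)) => //.
  by move=> x Vx; rewrite partialD //; [exact: Ck_diff Cf Vx|exact: Ck_diff Cg Vx].
by apply: IH; exact: CkS.
Qed.

Lemma CkM n k (V : set 'rV[R]_n) f g : open V ->
  Ck V k f -> Ck V k g -> Ck V k (fun y => f y * g y).
Proof.
move=> oV; elim: k f g => [|k IH] f g Cf Cg; split=> //;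
  try by move=> x Vx; apply: differentiableM; [exact: Ck_diff Cf Vx|exact: Ck_diff Cg Vx].
move=> i.
apply: (@Ck_ext n k V (fun y => partial i f y * g y + f y * partial i g y)) => //.
  by move=> x Vx; rewrite partialM //; [exact: Ck_diff Cf Vx|exact: Ck_diff Cg Vx].
by apply: CkD => //; apply: IH; do [exact: CkS | exact: CkW].
Qed.

Lemma Ck_sum n k (V : set 'rV[R]_n) (I : Type) (r : seq I) (Q : pred I)
  (F : I -> 'rV[R]_n -> R) : open V ->
  (forall j, Q j -> Ck V k (F j)) ->
  Ck V k (fun y => \sum_(j <- r | Q j) F j y).
Proof.
move=> oV CF; elim: r => [|j r IH].
  apply: (@Ck_ext n k V (fun=> 0)) => //; last exact: Ck_cst.
  by move=> x _; rewrite big_nil.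
apply: (@Ck_ext n k V (fun y => (if Q j then F j y else 0) +
    \sum_(j <- r | Q j) F j y)) => //.
  by move=> x _; rewrite big_cons; case: ifP; rewrite ?add0r.
by apply: CkD => //; case: (boolP (Q j)) => [|_]; [exact: CF|exact: Ck_cst].
Qed.

(** The chain rule writes the partial derivatives of f \o tau as sums of products of
functions to which the induction hypothesis applies. *)
Lemma Ck_comp m n k (V : set 'rV[R]_m) (W : set 'rV[R]_n) f tau :
  open V -> (forall x, V x -> W (tau x)) ->
  (forall j, Ck V k (fun y => tau y ord0 j)) ->
  Ck W k f -> Ck V k (f \o tau).
Proof.
move=> oV VW; elim: k f => [|k IH] f Ct Cf; have df x := Ck_diff Cf (x := x).
  split=> // x Vx; apply: differentiable_comp; last exact/df/VW.
  by apply: differentiable_rV => j; exact: (Ct j).1.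
have dt x : V x -> differentiable tau x.
  by move=> Vx; apply: differentiable_rV => j; exact: (Ct j).1.
split=> [x Vx|i].
  by apply: differentiable_comp; [exact: dt|exact/df/VW].
apply: (@Ck_ext _ k V (fun x => \sum_j partial i (fun y => tau y ord0 j) x *
   ((partial j f) \o tau) x)) => //.
  by move=> x Vx; rewrite partial_comp //; [exact/df/VW|exact: dt].
apply: Ck_sum => // j _; apply: CkM => //; first exact: (Ct j).2.
by apply: IH; [move=> j'; exact: CkW | exact: CkS].
Qed.

Lemma CkN n k (V : set 'rV[R]_n) f : open V ->
  Ck V k f -> Ck V k (fun y => - f y).
Proof.
move=> oV Cf; apply: (@Ck_ext n k V (fun y => -1 * f y)) => //.
  by move=> x _; rewrite mulN1r.
by apply: CkM => //; exact: Ck_cst.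
Qed.

Lemma CkV n k (V : set 'rV[R]_n) f : open V ->
  (forall x, V x -> f x != 0) -> Ck V k f -> Ck V k (fun y => (f y)^-1).
Proof.
move=> oV f0; elim: k => [|k IH] Cf.
  by split=> // x Vx; apply: differentiableV; [exact: Ck_diff Cf Vx|exact: f0].
split=> [x Vx|i].
  by apply: differentiableV; [exact: Ck_diff Cf Vx|exact: f0].
have CV := IH (CkW Cf).
apply: (@Ck_ext n k V (fun y => - ((f y)^-1 * (f y)^-1) * partial i f y)) => //.
  move=> x Vx; rewrite /partial deriveV; [|exact: f0|].
    by rewrite expr2 invfM.
  exact/diff_derivable/(Ck_diff Cf Vx).
apply: CkM => //; last exact: Cf.2.
by apply: CkN => //; exact: CkM.
Qed.

Lemma Ck_sqrt n k (V : set 'rV[R]_n) f : open V ->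
  (forall x, V x -> 0 < f x) -> Ck V k f -> Ck V k (fun y => Num.sqrt (f y)).
Proof.
move=> oV f0; elim: k => [|k IH] Cf.
  split=> // x Vx.
  have i : 'I_n.+1 := ord0.
  apply: (@differentiable_comp _ _ _ _ f Num.sqrt); first exact: Ck_diff Cf Vx.
  exact/derivable1_diffP/(@ex_derive _ _ _ _ _ _ _ (is_derive1_sqrt (f0 x Vx))).
have D x : V x -> forall i, differentiable (Num.sqrt \o f) x /\
    partial i (Num.sqrt \o f) x = (2 * Num.sqrt (f x))^-1 * partial i f x.
  move=> Vx i; apply: partial_comp1; first exact: Ck_diff Cf Vx.
  exact: is_derive1_sqrt (f0 x Vx).
split=> [x Vx|i].
  apply: (@differentiable_comp _ _ _ _ f Num.sqrt); first exact: Ck_diff Cf Vx.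
  exact/derivable1_diffP/(@ex_derive _ _ _ _ _ _ _ (is_derive1_sqrt (f0 x Vx))).
apply: (@Ck_ext n k V (fun y => (2 * Num.sqrt (f y))^-1 * partial i f y)) => //.
  by move=> x Vx; have [_ <-] := D x Vx i.
apply: CkM => //; last exact: Cf.2.
apply: CkV => //.
  by move=> x Vx; rewrite mulf_neq0// gt_eqF// sqrtr_gt0 f0.
by apply: CkM => //; [exact: Ck_cst|exact/IH/CkW].
Qed.

End Ck.

(** * A smooth function flat at the origin *)

Section Flat.
Variable R : realType.

(** The powers of 1/t make the family closed under differentiation, up to linear
combinations; [flat 0] is the usual exp(-1/t). *)
Definition flat (m : nat) (t : R) : R :=
  if 0 < t then t^-1 ^+ m * expR (- t^-1) else 0.

(** From exp u >= u^(m+1)/(m+1)! with u = 1/t. This is what makes the derivative at the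
origin exist. *)
Lemma flat_le m (t : R) : 0 <= flat m t <= m.+1`!%:R * `|t|.
Proof.
rewrite /flat; case: ifPn => [t0|_]; last first.
  by rewrite lexx /= mulr_ge0.
rewrite mulr_ge0 ?exprn_ge0 ?invr_ge0 ?(ltW t0) ?expR_ge0 //= gtr0_norm //.
have u0 : 0 < t^-1 by rewrite invr_gt0.
have := expR_ge1Dxn m (ltW u0); rewrite expRN.
move: u0.
rewrite -[X in _ <= _ * X](invrK t).
move: (t^-1) => u u0 H.
rewrite ler_pdivrMr ?expR_gt0 // mulrAC ler_pdivlMr // -exprSr.
have F0 : 0 < m.+1`!%:R :> R by rewrite ltr0n fact_gt0.
rewrite -ler_pdivrMl // mulrC; apply: le_trans H.
by rewrite lerDr.
Qed.

(** At the origin the difference quotient of [flat m] is [flat m.+1], hence O(t) by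
[flat_le]. *)
Lemma is_derive_flat m (t : R) :
  is_derive t 1 (flat m) (- m%:R * flat m.+1 t + flat m.+2 t).
Proof.
have [t0|t0|->] := ltgtP t 0.
- rewrite /flat !ltNge (ltW t0) /= mulr0 addr0.
  apply: near_eq_is_derive (is_derive_cst (0 : R) t 1).
  near=> y; have: y < 0 by near: y; exact: lt_nbhsl.
  by move=> y0; rewrite ltNge (ltW y0).
- rewrite /flat t0.
  apply: (@near_eq_is_derive _ _ _
    ((fun y : R => y^-1 ^+ m) * (expR \o (fun y => - y^-1)))).
    near=> y; have y0 : 0 < y.
      rewrite -oppr_lt0; near: y; apply: Nlt_nbhsl; rewrite oppr_lt0 //.
    by rewrite y0.
  have tn0 : t != 0 by rewrite gt_eqF.
  have dV : is_derive t 1 (fun y : R => y^-1) (- t^-1 ^+ 2).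
    have := @is_deriveV R id t 1 1 tn0 (is_derive_id t 1).
    by rewrite exprVn /GRing.scale /= mulr1.
  have dE : is_derive t 1 (expR \o (fun y => - y^-1))
      (t^-1 ^+ 2 * expR (- t^-1)).
    split.
      apply/derivable1_diffP; apply: differentiable_comp.
        apply/derivable1_diffP; apply: derivableN; by case: dV.
      apply/derivable1_diffP; exact: derivable_expR.
    rewrite -derive1E derive1_comp //.
    rewrite !derive1E derive_val mulrC; congr (_ * _).
    rewrite deriveN; last by case: dV.
    by rewrite (@derive_val _ _ _ _ _ _ _ dV) opprK.
  case: m => [|m].
    rewrite mulr0n oppr0 mul0r add0r.
    apply: near_eq_is_derive dE; near=> y => /=.
    by rewrite fctE /= expr0 mul1r.
  have dP := is_deriveX m.+1 dV.
  have E : (fun y : R => y^-1 ^+ m.+1) = (fun y : R => y^-1) ^+ m.+1.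
    by apply/funext => y; rewrite exprfctE.
  rewrite E; apply: is_derive_eq (is_deriveM dP dE) _; rewrite -E.
  have rearrange (e u : R) : u ^+ m.+1 * (u ^+ 2 * e)
      + e * (m.+1%:R * u ^+ m * - u ^+ 2)
      = - m.+1%:R * (u ^+ m.+2 * e) + u ^+ m.+3 * e by rewrite !exprS; ring.
  exact: rearrange.
- have flat0 k : flat k (0 : R) = 0 by rewrite /flat ltxx.
  rewrite !flat0 mulr0 addr0.
  suff H : (fun h : R => h^-1 *: ((flat m \o shift 0) (h *: (1 : R)) - flat m 0))
      @ 0^' --> (0 : R).
    by split; [apply/cvg_ex; exists 0 | apply/cvg_lim].
  apply/cvgr0Pnorm_le => e e0.
  near=> h.
  have hn0 : h != 0 by near: h; exact: nbhs_dnbhs_neq.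
  rewrite /= flat0 subr0 addr0 /GRing.scale /= mulr1.
  have -> : `|h^-1 * flat m h| = flat m.+1 h.
    rewrite /flat; case: ifPn => [h0|_]; last by rewrite mulr0 normr0.
    rewrite exprS mulrA ger0_norm // mulr_ge0 ?expR_ge0 //.
    by rewrite mulr_ge0 ?exprn_ge0 ?invr_ge0 ?(ltW h0).
  have /andP[_ /le_trans] := flat_le m.+1 h; apply.
  have F0 : 0 < m.+2`!%:R :> R by rewrite ltr0n fact_gt0.
  rewrite mulrC -ler_pdivlMr //.
  by near: h; apply: dnbhs0_le; rewrite divr_gt0.
Unshelve. all: by end_near. Qed.

Lemma Ck_flat n k (V : set 'rV[R]_n) f m : open V ->
  Ck V k f -> Ck V k (flat m \o f).
Proof.
move=> oV; elim: k m => [|k IH] m Cf.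
  split=> // x Vx; apply: differentiable_comp; first exact: Ck_diff Cf Vx.
  by apply/derivable1_diffP/ex_derive; exact: is_derive_flat.
split=> [x Vx|i].
  apply: differentiable_comp; first exact: Ck_diff Cf Vx.
  by apply/derivable1_diffP/ex_derive; exact: is_derive_flat.
apply: (@Ck_ext _ n k V (fun y => (- m%:R * (flat m.+1 \o f) y +
   (flat m.+2 \o f) y) * partial i f y)) => //.
  move=> x Vx.
  by have [_ ->] := partial_comp1 i (Ck_diff Cf Vx) (is_derive_flat m (f x)).
have Cf' := CkW Cf.
apply: CkM => //; last exact: Cf.2.
apply: CkD => //; last exact: IH.
by apply: CkM => //; [exact: Ck_cst|exact: IH].
Qed.
End Flat.

(** * Symmetry of second derivatives *)

Section Lines.
Variables (R : realType) (n : nat).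
Implicit Types (f : 'rV[R]_n -> R) (x y v : 'rV[R]_n).

Lemma is_derive_line f y v t (d : R) : is_derive (y + t *: v) v f d ->
  is_derive t 1 (fun s : R => f (y + s *: v)) d.
Proof.
have E : (fun h : R => h^-1 *: (((fun s : R => f (y + s *: v)) \o shift t) (h *: 1)
     - f (y + t *: v))) =
   (fun h : R => h^-1 *: ((f \o shift (y + t *: v)) (h *: v) - f (y + t *: v))).
  apply/funext => h /=; congr (_ *: (f _ - _)).
  by rewrite [h *: 1]mulr1 scalerDl addrCA.
by case=> df Df; split; rewrite /derivable /derive E.
Qed.

Lemma mvt_line f y v t : 0 < t ->
  (forall c, 0 <= c <= t -> differentiable f (y + c *: v)) ->
  exists2 c, 0 < c < t & f (y + t *: v) - f y = t * 'D_v f (y + c *: v).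
Proof.
move=> t0 df.
have [c ct] : exists2 c, c \in `]0, t[ &
    f (y + t *: v) - f (y + 0 *: v) = 'D_v f (y + c *: v) * (t - 0).
  apply: (@MVT R (fun s : R => f (y + s *: v)) (fun s => 'D_v f (y + s *: v))) => //.
    move=> c; rewrite in_itv /= => /andP[c0 ct].
    apply: is_derive_line; apply: derivableP; apply: diff_derivable.
    by apply: df; rewrite !ltW.
  apply: derivable_within_continuous => c; rewrite in_itv /= => ct.
  apply/ex_derive; apply: is_derive_line; apply: derivableP.
  exact/diff_derivable/df.
rewrite scale0r addr0 subr0 mulrC => ->; by exists c.
Qed.

Lemma coord_norm_le v i : `|v ord0 i| <= `|v|.
Proof.
rewrite [leRHS]/Num.Def.normr /= mx_normrE.
exact: (le_bigmax _ (fun ij : 'I_1 * 'I_n => `|v ij.1 ij.2|) (ord0, i)).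
Qed.

Lemma norm_delta_le i : `|'e_i : 'rV[R]_n| <= 1.
Proof.
rewrite [leLHS]/Num.Def.normr /= mx_normrE.
apply: bigmax_le => // -[k l] _ /=; rewrite mxE.
by case: (_ && _); rewrite ?normr1 ?normr0.
Qed.

(** The mean value theorem on the segment from x to x + h bounds the remainder by the
oscillation of the coefficients a i, which is small by continuity. *)
Lemma differentiable_directional f (a : 'I_n -> 'rV[R]_n -> R) x :
  (\forall y \near x, forall v, is_derive y v f (\sum_i v ord0 i * a i y)) ->
  (forall i, {for x, continuous (a i)}) -> differentiable f x.
Proof.
move=> Hf ca.
pose L (v : 'rV[R]_n) := \sum_i v ord0 i * a i x.
have Llin : linear L.
  move=> k u v; rewrite /L scaler_sumr -big_split; apply: eq_bigr => i _.
  by rewrite !mxE mulrDl scalerAl.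
pose LL : {linear 'rV[R]_n -> R} := HB.pack L (GRing.isLinear.Build _ _ _ _ L Llin).
apply: (@differentiable_approx R _ _ _ _ LL).
  exact: linear_rV_continuous.
move=> e e0.
(* n.+1 rather than n, as n may be zero *)
pose e' := e / n.+1%:R.
have e'0 : 0 < e' by rewrite divr_gt0.
have Hn : \forall y \near x, (forall v, is_derive y v f (\sum_i v ord0 i * a i y))
    /\ forall i, `|a i y - a i x| <= e'.
  apply: filterI => //.
  apply: (@filter_forall _ _ (fun i y => `|a i y - a i x| <= e') (nbhs x) _) => i.
  have /cvgrPdist_le/(_ _ e'0) := ca i.
  by apply: filterS => y; rewrite distrC.
have /nbhs_ballP[r /= r0 Hr] := Hn.
near=> h.
have hr : `|h| < r.
  near: h; apply/nbhs_ballP; exists r => //= z.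
  by rewrite -ball_normE /= sub0r normrN.
have inB c : 0 <= c <= 1 -> ball x r (x + c *: h).
  move=> /andP[c0 c1]; rewrite -ball_normE /= opprD addNKr normrN normrZ.
  by rewrite (le_lt_trans _ hr)// ler_piMl// ger0_norm.
have [c c01] : exists2 c, c \in `]0, 1[ & f (x + 1 *: h) - f (x + 0 *: h) =
    (\sum_i h ord0 i * a i (x + c *: h)) * (1 - 0).
  apply: (@MVT R (fun s : R => f (x + s *: h))
     (fun s => \sum_i h ord0 i * a i (x + s *: h))) => //.
    move=> c; rewrite in_itv /= => /andP[c0 c1].
    apply: is_derive_line.
    have c01 : 0 <= c <= 1 by rewrite !ltW.
    by have [/(_ h) H _] := Hr _ (inB c c01); exact: H.
  apply: derivable_within_continuous => c; rewrite in_itv /= => c01.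
  apply/ex_derive; apply: is_derive_line.
  by have [/(_ h) H _] := Hr _ (inB c c01); exact: H.
rewrite in_itv /= in c01.
rewrite scale1r scale0r addr0 subr0 mulr1 (addrC h) => ->.
rewrite /L -sumrB.
apply: le_trans (ler_norm_sum _ _ _) _.
have [|_ Hc] := Hr _ (inB c _); first by case/andP: c01 => /ltW -> /ltW.
apply: (@le_trans _ _ (\sum_(i < n) e' * `|h|)).
  apply: ler_sum => i _; rewrite -mulrBr normrM mulrC.
  by apply: ler_pM; rewrite ?Hc ?coord_norm_le.
rewrite sumr_const card_ord -mulr_natr mulrAC ler_wpM2r //.
by rewrite /e' mulrAC ler_pdivrMr // ler_pM2l // ler_nat.
Unshelve. all: by end_near. Qed.

(** The mean value theorem in the direction i, then in the direction j. *)
Lemma second_difference f x i j (r h : R) : 0 < h -> 2 * h < r ->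
  (forall y, ball x r y -> differentiable f y /\ differentiable (partial i f) y) ->
  exists2 y, `|y - x| <= 2 * h &
    f (x + h *: 'e_j + h *: 'e_i) - f (x + h *: 'e_i) -
      (f (x + h *: 'e_j) - f x) = h * (h * partial j (partial i f) y).
Proof.
move=> h0 hr df.
have close c d : 0 <= c <= h -> 0 <= d <= h ->
    `|x - (x + d *: 'e_j + c *: 'e_i)| <= 2 * h.
  move=> /andP[c0 ch] /andP[d0 dh].
  rewrite -addrA opprD addNKr normrN (le_trans (ler_normD _ _))// !normrZ.
  rewrite (ger0_norm c0) (ger0_norm d0) mulr_natl mulr2n lerD //.
    by rewrite (le_trans _ dh) // ler_piMr // norm_delta_le.
  by rewrite (le_trans _ ch) // ler_piMr // norm_delta_le.
have inB c d : 0 <= c <= h -> 0 <= d <= h ->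
    ball x r (x + d *: 'e_j + c *: 'e_i).
  by move=> ch dh; rewrite -ball_normE /=; exact: le_lt_trans (close _ _ ch dh) hr.
have hh : 0 <= h <= h by rewrite lexx ltW.
have h00 : 0 <= (0 : R) <= h by rewrite lexx ltW.
have [c c0h] : exists2 c, c \in `]0, h[ &
    (f (x + h *: 'e_j + h *: 'e_i) - f (x + h *: 'e_i)) -
    (f (x + h *: 'e_j + 0 *: 'e_i) - f (x + 0 *: 'e_i)) =
    (partial i f (x + h *: 'e_j + c *: 'e_i) - partial i f (x + c *: 'e_i))
      * (h - 0).
  have dline c : 0 <= c <= h -> is_derive c 1
      (fun s : R => f (x + h *: 'e_j + s *: 'e_i) - f (x + s *: 'e_i))
      (partial i f (x + h *: 'e_j + c *: 'e_i) - partial i f (x + c *: 'e_i)).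
    move=> ch; apply: is_deriveB; apply: is_derive_line; apply: derivableP;
      apply: diff_derivable.
      by have [] := df _ (inB _ _ ch hh).
    by have := df _ (inB _ _ ch h00); rewrite scale0r addr0 => -[].
  apply: (@MVT R (fun s : R => f (x + h *: 'e_j + s *: 'e_i) - f (x + s *: 'e_i))
    (fun c => partial i f (x + h *: 'e_j + c *: 'e_i)
              - partial i f (x + c *: 'e_i))) => //.
    by move=> c; rewrite in_itv /= => /andP[c0 ch]; apply: dline; rewrite !ltW.
  apply: derivable_within_continuous => c; rewrite in_itv /= => ch.
  by apply/ex_derive; exact: dline.
rewrite in_itv /= in c0h.
have ch : 0 <= c <= h by case/andP: c0h => /ltW -> /ltW.
rewrite !scale0r !addr0 => ->; rewrite subr0 (addrAC x).
have [|d /andP[d0 dh] ->] := @mvt_line (partial i f) (x + c *: 'e_i) 'e_j h h0.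
  by move=> d dh; have := df _ (inB _ _ ch dh); rewrite addrAC => -[].
exists (x + d *: 'e_j + c *: 'e_i).
  by rewrite distrC close // !ltW.
by rewrite mulrC /partial addrAC.
Qed.

(** The second difference of [second_difference] is symmetric in i and j, so the two mixed
derivatives agree at points arbitrarily close to x. *)
Theorem partialC f x i j r : 0 < r ->
  (forall y, ball x r y -> differentiable f y) ->
  (forall y k, ball x r y -> differentiable (partial k f) y) ->
  {for x, continuous (partial i (partial j f))} ->
  {for x, continuous (partial j (partial i f))} ->
  partial i (partial j f) x = partial j (partial i f) x.
Proof.
move=> r0 df dpf cij cji; apply/eqP; rewrite -subr_eq0 -normr_le0.
apply/ler_addgt0Pl => e e0; rewrite addr0.
have half_dist (s t u : R) : `|s - u| <= e / 2 -> `|t - u| <= e / 2 -> `|s - t| <= e.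
  move=> su tu; rewrite (splitr e) -(subrK u s) -addrA.
  by rewrite (le_trans (ler_normD _ _))// lerD // distrC.
have e2 : 0 < e / 2 by rewrite divr_gt0.
have /cvgrPdist_le/(_ _ e2)/nbhs_ballP[r1 /= r10 H1] := cij.
have /cvgrPdist_le/(_ _ e2)/nbhs_ballP[r2 /= r20 H2] := cji.
(* the intermediate points are within 2 h of x, hence in all three balls *)
pose d := Num.min r (Num.min r1 r2); pose h := d / 3.
have d0 : 0 < d by rewrite !lt_min r0 r10 r20.
have h0 : 0 < h by rewrite divr_gt0.
have hd : 2 * h < d by rewrite /h; lra.
have hr : 2 * h < r by rewrite (lt_le_trans hd) // /d ge_min lexx.
have [y1 y1x E1] := @second_difference f x i j r h h0 hr
  (fun y By => conj (df y By) (dpf y i By)).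
have [y2 y2x E2] := @second_difference f x j i r h h0 hr
  (fun y By => conj (df y By) (dpf y j By)).
have E : partial j (partial i f) y1 = partial i (partial j f) y2.
  apply: (mulfI (lt0r_neq0 h0)); apply: (mulfI (lt0r_neq0 h0)).
  have swap (s t u w : R) : s - t - (u - w) = s - u - (t - w) by ring.
  apply: (etrans (esym E1)); apply: etrans E2.
  by rewrite (addrAC x (h *: 'e_j)); exact: swap.
have inB y s : `|y - x| <= 2 * h -> d <= s -> ball x s y.
  move=> yx ds; rewrite -ball_normE /= distrC.
  exact: le_lt_trans yx (lt_le_trans hd ds).
have B1 := H2 y1 (inB y1 r2 y1x (ltac:(by rewrite !ge_min lexx !orbT))).
have B2 := H1 y2 (inB y2 r1 y2x (ltac:(by rewrite !ge_min lexx !orbT))).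
by move: B1; rewrite E; exact: half_dist B2.
Qed.

Lemma smooth_partialC V f x i j : open V -> smooth_on V f -> V x ->
  partial i (partial j f) x = partial j (partial i f) x.
Proof.
move=> oV sf Vx.
have /nbhs_ballP[r /= r0 rV] := open_nbhs_nbhs (conj oV Vx).
apply: (@partialC _ _ _ _ r) => //.
- by move=> y /rV; exact: (sf [::]).
- by move=> y k /rV; exact: (sf [:: k]).
- exact/differentiable_continuous/(sf [:: i; j]).
- exact/differentiable_continuous/(sf [:: j; i]).
Qed.
End Lines.

(** * The Poincare lemma *)

Section Poincare.
Variables (R : realType) (n : nat).
Implicit Types (f : 'rV[R]_n -> R) (x y v : 'rV[R]_n).

(** Converse of [is_derive_line]: derivatives under the integral sign are those of
functions of one real variable. *)
Lemma is_derive_of_line f y v (d : R) :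
  is_derive (0 : R) 1 (fun s : R => f (y + s *: v)) d -> is_derive y v f d.
Proof.
have E : (fun h : R => h^-1 *: (((fun s : R => f (y + s *: v)) \o shift 0) (h *: 1)
     - f (y + 0 *: v))) =
   (fun h : R => h^-1 *: ((f \o shift y) (h *: v) - f y)).
  apply/funext => h /=; rewrite scale0r !addr0.
  by congr (_ *: (f _ - _)); rewrite [h *: 1]mulr1 addrC.
by case=> + <-; rewrite /derivable /derive E => df; split.
Qed.

Lemma near_bounded f x : differentiable f x ->
  \forall y \near x, `|f y| <= `|f x| + 1.
Proof.
move=> /differentiable_continuous/cvgrPdist_le/(_ _ ltr01).
apply: filterS => y /= H; rewrite -lerBlDl.
by apply: le_trans H; rewrite distrC; exact: lerB_dist.
Qed.

Lemma ball_segment x0 r y t : ball x0 r y -> 0 <= t <= 1 ->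
  ball x0 r (x0 + t *: (y - x0)).
Proof.
rewrite -ball_normE /= distrC => yr /andP[t0 t1].
rewrite opprD addNKr normrN normrZ ger0_norm //.
by rewrite (le_lt_trans _ yr)// ler_piMl.
Qed.

Section Cone.
Variables (a : 'I_n -> 'rV[R]_n -> R) (x0 : 'rV[R]_n) (r C : R).
Local Notation B := (ball x0 r).
Hypothesis r0 : 0 < r.
Hypothesis da : forall y i, B y -> differentiable (a i) y.
Hypothesis dpa : forall y i j, B y -> differentiable (partial j (a i)) y.
Hypothesis bda : forall y i j, B y -> `|partial j (a i) y| <= C.
Hypothesis ba : forall y i, B y -> `|a i y| <= C.
Hypothesis closed_a :
  forall y i j, B y -> partial i (a j) y = partial j (a i) y.

Definition cone_integrand y (t : R) : R :=
  \sum_i a i (x0 + t *: (y - x0)) * (y - x0) ord0 i.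

(** The homotopy formula: the integral of the form along the segment from x0 to y. *)
Definition cone y : R :=
  \int[lebesgue_measure]_(t in `[0, 1]) cone_integrand y t.

Lemma is_derive_dir f (y v : 'rV[R]_n) : differentiable f y ->
  is_derive y v f (\sum_j v ord0 j * partial j f y).
Proof.
move=> df; rewrite -diff_partial // -deriveE //.
exact/derivableP/diff_derivable.
Qed.

Lemma continuous_within_derivable (g dg : R -> R) :
  (forall t : R, 0 <= t <= 1 -> is_derive t 1 g (dg t)) ->
  {within `[0, 1], continuous g}.
Proof.
move=> H; apply: derivable_within_continuous => t; rewrite in_itv /= => t01.
by apply/ex_derive; exact: H.
Qed.

Lemma is_derive_bigsum (F : 'I_n -> R -> R) (dF : 'I_n -> R) (t : R) :
  (forall i, is_derive t 1 (F i) (dF i)) ->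
  is_derive t 1 (fun s => \sum_i F i s) (\sum_i dF i).
Proof.
move=> H.
have -> : (fun s => \sum_i F i s) = \sum_i F i.
  by apply/funext => s; rewrite fct_sumE.
exact: is_derive_sum.
Qed.

Lemma is_derive_mul (f g : R -> R) (t df dg : R) :
  is_derive t 1 f df -> is_derive t 1 g dg ->
  is_derive t 1 (fun s => f s * g s) (df * g t + f t * dg).
Proof.
move=> Hf Hg; apply: is_derive_eq (is_deriveM Hf Hg) _.
by rewrite addrC /GRing.scale /= [g t * _]mulrC.
Qed.

Lemma is_derive_mul_cst (f : R -> R) (t df k : R) :
  is_derive t 1 f df -> is_derive t 1 (fun s => f s * k) (df * k).
Proof.
move=> Hf; apply: is_derive_eq (is_derive_mul Hf (is_derive_cst k t 1)) _.
by rewrite mulr0 addr0.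
Qed.

Lemma cone_integrable y : B y ->
  lebesgue_measure.-integrable `[0, 1] (EFin \o cone_integrand y).
Proof.
move=> By; apply: continuous_compact_integrable; first exact: segment_compact.
apply: (@continuous_within_derivable _ (fun t => \sum_i
   (\sum_j (y - x0) ord0 j * partial j (a i) (x0 + t *: (y - x0))) * (y - x0) ord0 i))
  => t t01.
apply: is_derive_bigsum => i; apply: is_derive_mul_cst.
by apply: is_derive_line; apply: is_derive_dir; apply: da; exact: ball_segment.
Qed.

Definition cone_deriv y v (t : R) : R :=
  \sum_i ((\sum_j (t *: v) ord0 j * partial j (a i) (x0 + t *: (y - x0)))
             * (y - x0) ord0 i + a i (x0 + t *: (y - x0)) * v ord0 i).

Lemma cone_integrand_derive y v t u : 0 <= t <= 1 -> B (y + u *: v) ->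
  is_derive u 1 (fun s => cone_integrand (y + s *: v) t)
    (cone_deriv (y + u *: v) v t).
Proof.
move=> t01 Bu; apply: is_derive_bigsum => i; apply: is_derive_mul.
  have E s : x0 + t *: (y + s *: v - x0) = (x0 + t *: (y - x0)) + s *: (t *: v).
    by rewrite (addrAC y) scalerDr addrA !scalerA (mulrC t).
  have -> : (fun s => a i (x0 + t *: (y + s *: v - x0))) =
     (fun s => a i ((x0 + t *: (y - x0)) + s *: (t *: v))).
    by apply/funext => s; rewrite E.
  rewrite E; apply: is_derive_line; apply: is_derive_dir.
  by rewrite -E; apply: da; exact: ball_segment.
rewrite (_ : (fun _ => _) = fun s : R => (y - x0) ord0 i + s * v ord0 i); last first.
  by apply/funext => s; rewrite !mxE addrAC.
apply: is_derive_eq (is_deriveD (is_derive_cst _ _ _)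
  (is_derive_mul_cst (v ord0 i) (is_derive_id u 1))) _.
by rewrite add0r mul1r.
Qed.

(** A bound independent of t and y, as differentiation under the integral requires. *)
Lemma cone_deriv_bound y v (t : R) : 0 <= t <= 1 -> B y ->
  `|cone_deriv y v t| <= \sum_(i < n) ((\sum_(j < n) `|v| * C) * r + C * `|v|).
Proof.
move=> t01 By; apply: le_trans (ler_norm_sum _ _ _) _.
apply: ler_sum => i _; have Bt := ball_segment By t01.
have yr : `|(y - x0) ord0 i| <= r.
  apply: le_trans (coord_norm_le _ _) _.
  by move: By; rewrite -ball_normE /= distrC; exact: ltW.
apply: le_trans (ler_normD _ _) _; apply: lerD.
  rewrite normrM; apply: ler_pM => //.
  apply: le_trans (ler_norm_sum _ _ _) _; apply: ler_sum => j _.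
  rewrite normrM; apply: ler_pM => //; last exact: bda.
  rewrite mxE normrM -[leRHS]mul1r; apply: ler_pM => //; last exact: coord_norm_le.
  by case/andP: t01 => t0 t1; rewrite ger0_norm.
by rewrite normrM; apply: ler_pM => //; [exact: ba|exact: coord_norm_le].
Qed.

(** Closedness exchanges the indices of the derivatives of a, and the integrand becomes a
total derivative in t. *)
Lemma cone_deriv_primitive y v (t : R) : B y -> 0 <= t <= 1 ->
  is_derive t 1 (fun s : R => s * \sum_i a i (x0 + s *: (y - x0)) * v ord0 i)
    (cone_deriv y v t).
Proof.
move=> By t01; have Bt := ball_segment By t01.
apply: is_derive_eq (is_derive_mul (is_derive_id t 1) (is_derive_bigsum (fun i =>
   is_derive_mul_cst (v ord0 i) (is_derive_line (is_derive_dir (y - x0) (da i Bt)))))) _.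
rewrite mul1r /cone_deriv big_split /= addrC; congr (_ + _).
rewrite mulr_sumr.
transitivity (\sum_i \sum_j t * ((y - x0) ord0 j *
    partial j (a i) (x0 + t *: (y - x0)) * v ord0 i)).
  by apply: eq_bigr => i _; rewrite mulr_suml mulr_sumr.
rewrite exchange_big /=; apply: eq_bigr => i _; rewrite mulr_suml.
apply: eq_bigr => j _; rewrite closed_a // [(t *: v) _ _]mxE.
by move: ((y - x0) ord0 i) (v ord0 j) (partial _ _ _) => p q s; ring.
Qed.

Lemma cone_deriv_continuous y v : B y ->
  {within `[0, 1], continuous (cone_deriv y v)}.
Proof.
move=> By.
pose D (i : 'I_n) t := \sum_k (y - x0) ord0 k * partial k (a i) (x0 + t *: (y - x0)).
pose D2 (i j : 'I_n) t := \sum_k (y - x0) ord0 k *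
   partial k (partial j (a i)) (x0 + t *: (y - x0)).
apply: (@continuous_within_derivable _ (fun t : R => \sum_i
   ((\sum_j (v ord0 j * partial j (a i) (x0 + t *: (y - x0)) + (t * v ord0 j) * D2 i j t))
             * (y - x0) ord0 i
    + D i t * v ord0 i))) => t t01.
have Bt := ball_segment By t01.
have -> : cone_deriv y v = fun s : R => \sum_i
    ((\sum_j (s * v ord0 j) * partial j (a i) (x0 + s *: (y - x0)))
             * (y - x0) ord0 i + a i (x0 + s *: (y - x0)) * v ord0 i).
  apply/funext => s; apply: eq_bigr => i _; congr (_ * _ + _).
  by apply: eq_bigr => j _; rewrite mxE.
apply: is_derive_bigsum => i; apply: is_deriveD.
  apply: is_derive_mul_cst.
  apply: is_derive_bigsum => j; apply: is_derive_mul.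
    apply: is_derive_eq (is_derive_mul_cst (v ord0 j) (is_derive_id t 1)) _.
    by rewrite mul1r.
  by apply: is_derive_line; apply: is_derive_dir; exact: dpa.
apply: is_derive_mul_cst.
by apply: is_derive_line; apply: is_derive_dir; exact: da.
Qed.

Lemma cone_deriv_integral y v : B y ->
  \int[lebesgue_measure]_(t in `[0, 1]) cone_deriv y v t = \sum_i v ord0 i * a i y.
Proof.
move=> By; rewrite /Rintegral.
have P t := @cone_deriv_primitive y v t By.
pose F s : R := s * \sum_i a i (x0 + s *: (y - x0)) * v ord0 i.
have cF := @continuous_within_derivable F (cone_deriv y v) P.
rewrite (@continuous_FTC2 R (cone_deriv y v) F 0 1) //.
- rewrite /= /F mul0r subr0 mul1r.
  by apply: eq_bigr => i _; rewrite scale1r addrC subrK mulrC.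
- exact: cone_deriv_continuous.
- have [_ cl cr] := (continuous_within_itvP F ltr01).1 cF.
  split=> // t; rewrite in_itv /= => /andP[t0 t1].
  by apply/ex_derive; apply: P; rewrite !ltW.
- move=> t; rewrite in_itv /= => /andP[t0 t1].
  rewrite derive1E; apply: derive_val; apply: P; rewrite !ltW //.
Qed.

Lemma is_derive_cone y v : B y -> is_derive y v cone (\sum_i v ord0 i * a i y).
Proof.
move=> By; apply: is_derive_of_line.
(* small enough for y + u *: v to stay in the ball when |u| < eta *)
pose eta := (r - `|y - x0|) / (`|v| + 1).
have v1 : 0 < `|v| + 1 by rewrite ltr_wpDl.
have yr : 0 < r - `|y - x0|.
  by move: By; rewrite -ball_normE /= distrC subr_gt0.
have eta0 : 0 < eta by rewrite divr_gt0.
have inB u : u \in `](- eta), eta[ -> B (y + u *: v).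
  rewrite in_itv /= -ltr_norml => ueta.
  rewrite -ball_normE /= distrC addrAC (le_lt_trans (ler_normD _ _))//.
  rewrite -ltrBrDl normrZ; apply: (@le_lt_trans _ _ (`|u| * (`|v| + 1))).
    by rewrite ler_wpM2l // lerDl.
  by rewrite -ltr_pdivlMr.
pose K := \sum_(i < n) ((\sum_(j < n) `|v| * C) * r + C * `|v|).
have I0 : [set` `](- eta), eta[] (0 : R) by rewrite /= in_itv /= eta0 oppr_lt0 eta0.
have D u t : [set` `](- eta), eta[] u -> [set` `[0, 1]] t ->
    is_derive u 1 (fun s => cone_integrand (y + s *: v) t) (cone_deriv (y + u *: v) v t).
  by move=> /inB Bu; rewrite /= in_itv /= => t01; exact: cone_integrand_derive.
have intK : lebesgue_measure.-integrable `[0, 1] (EFin \o cst K).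
  apply: continuous_compact_integrable; first exact: segment_compact.
  by apply: continuous_subspaceT; exact: cst_continuous.
have K0 : 0 <= K by apply: le_trans (cone_deriv_bound v (t := 0) _ By); rewrite ?lexx ?ler01.
pose f u t := cone_integrand (y + u *: v) t.
have mI : measurable (`[0, 1] : set (measurableTypeR R)) by exact: measurable_itv.
have intf u : [set` `](- eta), eta[] u -> lebesgue_measure.-integrable `[0, 1] (EFin \o f u).
  by move=> /inB Bu; exact: cone_integrable.
have df u t : [set` `](- eta), eta[] u -> [set` `[0, 1]] t -> derivable (f^~ t) u 1.
  by move=> Iu It; apply/ex_derive; exact: D.
have bf u t : [set` `](- eta), eta[] u -> [set` `[0, 1]] t -> `|partial1of2 f u t| <= cst K t.
  move=> Iu It; rewrite partial1of2E (@derive_val _ _ _ _ _ _ _ (D u t Iu It)).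
  by apply: cone_deriv_bound; [move: It; rewrite /= in_itv|exact: inB].
have D1 := derivable_under_integral mI I0 intf df (fun=> K0) intK bf.
have D2 := differentiation_under_integral mI I0 intf df (fun=> K0) intK bf.
split; first exact: D1.
rewrite -derive1E [LHS]D2 -cone_deriv_integral //.
apply: eq_Rintegral => t; rewrite inE => It.
rewrite -[X in cone_deriv X](addr0 y) -(scale0r v).
by rewrite /partial1of2 derive1E; apply: derive_val; exact: D.
Qed.

End Cone.

Lemma smooth_on_sub (V W : set 'rV[R]_n) f : W `<=` V -> smooth_on V f -> smooth_on W f.
Proof. by move=> WV sf s x /WV; exact: sf. Qed.

Lemma smooth_on_ext (V : set 'rV[R]_n) f g : open V -> (forall x, V x -> f x = g x) ->
  smooth_on V f -> smooth_on V g.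
Proof.
by move=> oV fg /smooth_onP Cf; apply/smooth_onP => k; exact: Ck_ext (Cf k).
Qed.

Lemma smooth_on_partials (V : set 'rV[R]_n) f (a : 'I_n -> 'rV[R]_n -> R) : open V ->
  (forall x, V x -> differentiable f x) ->
  (forall i x, V x -> partial i f x = a i x) ->
  (forall i, smooth_on V (a i)) -> smooth_on V f.
Proof.
move=> oV df dfa sa; apply/smooth_onP => -[|k]; split=> // i.
apply: (@Ck_ext _ _ _ _ (a i)) => //; first by move=> x Vx; rewrite dfa.
by move/smooth_onP: (sa i); exact.
Qed.

(** The integral along segments is only seen to have directional derivatives; as these
depend continuously on the point, [differentiable_directional] gives differentiability,
and its partial derivatives are smooth. *)
Theorem poincare (V : set 'rV[R]_n) (a : 'I_n -> 'rV[R]_n -> R) x0 : open V -> V x0 ->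
  (forall i, smooth_on V (a i)) ->
  (forall x i j, V x -> partial i (a j) x = partial j (a i) x) ->
  exists (W : set 'rV[R]_n) f, [/\ open W, W x0, W `<=` V, smooth_on W f &
    forall x i, W x -> partial i f x = a i x].
Proof.
move=> oV Vx0 sa ca.
have da x i : V x -> differentiable (a i) x by exact: (sa i [::]).
have dpa x i j : V x -> differentiable (partial j (a i)) x by exact: (sa i [:: j]).
pose C := \sum_i (`|a i x0| + 1) + \sum_i \sum_j (`|partial j (a i) x0| + 1).
have C1 i : `|a i x0| + 1 <= C.
  rewrite /C (bigD1 i) //= -addrA lerDl addr_ge0 ?sumr_ge0 // => k _.
  by rewrite sumr_ge0.
have C2 i j : `|partial j (a i) x0| + 1 <= C.
  rewrite /C [leRHS]addrC (bigD1 i) //= (bigD1 j) //= -!(addrA (`|partial j (a i) x0| + 1)) lerDl.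
  rewrite !addr_ge0 ?sumr_ge0 // => k _.
  by rewrite sumr_ge0.
have H : \forall y \near x0, [/\ V y, forall i, `|a i y| <= C &
    forall i j, `|partial j (a i) y| <= C].
  near=> y; split.
  - by near: y; exact: open_nbhs_nbhs.
  - near: y; apply: (@filter_forall _ _ (fun i y => `|a i y| <= C) (nbhs x0) _) => i.
    have := near_bounded (da x0 i Vx0); apply: filterS => y H.
    exact: le_trans H (C1 i).
  - near: y; apply: (@filter_forall _ _ (fun i y => forall j,
      `|partial j (a i) y| <= C) (nbhs x0) _) => i.
    apply: (@filter_forall _ _ (fun j y =>
      `|partial j (a i) y| <= C) (nbhs x0) _) => j.
    have := near_bounded (dpa x0 i j Vx0); apply: filterS => y H.
    exact: le_trans H (C2 i j).
have /nbhs_ballP[r /= r0 Hr] := H.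
have D y v (By : ball x0 r y) : is_derive y v (cone a x0) (\sum_i v ord0 i * a i y).
  apply: (@is_derive_cone a x0 r C) => //.
  - by move=> z i /Hr[Vz _ _]; exact: da.
  - by move=> z i j /Hr[Vz _ _]; exact: dpa.
  - by move=> z i j /Hr[_ _].
  - by move=> z i /Hr[_ + _].
  - by move=> z i j /Hr[Vz _ _]; exact: ca.
have oB := @ball_open _ _ x0 r.
have pE i x : ball x0 r x -> partial i (cone a x0) x = a i x.
  move=> Bx; rewrite /partial (@derive_val _ _ _ _ _ _ _ (D x 'e_i Bx)).
  rewrite (bigD1 i) //= big1 => [|j ji]; first by rewrite mxE !eqxx mul1r addr0.
  by rewrite mxE (negbTE ji) mul0r.
exists (ball x0 r), (cone a x0); split.
- exact: oB.
- exact: ballxx.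
- by move=> y /Hr[].
- apply: (smooth_on_partials (a := a)) => //.
  + move=> x Bx; apply: (@differentiable_directional _ _ _ a).
      have : nbhs x (ball x0 r) by apply: open_nbhs_nbhs.
      by apply: filterS => y By v; exact: D.
    by move=> i; have [Vx _ _] := Hr _ Bx; exact/differentiable_continuous/da.
  + by move=> i; apply: smooth_on_sub (sa i) => y /Hr[].
- by move=> x i; exact: pE.
Unshelve. all: by end_near. Qed.

End Poincare.

Lemma near_neq0 (R : realType) (T : topologicalType) (F : T -> R) (x0 : T) :
  {for x0, continuous F} -> F x0 != 0 -> \forall x \near x0, F x != 0.
Proof.
move=> /cvgrPdist_lt/(_ `|F x0|) cF F0; move: cF; rewrite normr_gt0 => /(_ F0).
by apply: filterS => x; apply: contraTneq => ->; rewrite subr0 ltxx.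
Qed.

(** If F x0 were nonzero, then F would be nonzero near x0, and A would not meet
a neighbourhood of x0. This passes from the points where the 1-form does not vanish
to all points. *)
Lemma vanish_by_density (R : realType) (T : topologicalType) (F : T -> R) (A : set T) (x0 : T) :
  {for x0, continuous F} ->
  (\forall x \near x0, A x -> F x = 0) ->
  ((\forall x \near x0, ~ A x) -> F x0 = 0) -> F x0 = 0.
Proof.
move=> cF FA FnA; apply: contrapT => /eqP F0; move/eqP: (F0); apply; apply: FnA.
move: FA; apply: filterS2 (near_neq0 cF F0) => x Fx FA Ax.
by move: Fx; rewrite FA ?eqxx.
Qed.

(** * Contravariant derivatives in a frame *)

Section FrameAlgebra.
Variables (R : realFieldType) (n : nat).
Implicit Types (P H Da DA W : 'M[R]_n) (dP dH D : 'I_n -> 'M[R]_n) (a v : 'rV[R]_n).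

(** The matrices dF stand for the partial derivatives of a matrix-valued function at one
point, so that the algebra of this part involves no limits. *)
Definition dir m k (v : 'rV[R]_n) (dF : 'I_n -> 'M[R]_(m, k)) : 'M[R]_(m, k) :=
  \sum_l v ord0 l *: dF l.

Lemma dirE m k v (dF : 'I_n -> 'M[R]_(m, k)) i j :
  dir v dF i j = \sum_l v ord0 l * dF l i j.
Proof. by rewrite /dir summxE; apply: eq_bigr => l _; rewrite mxE. Qed.

(** Row i is the contravariant derivative D_{e_i} a, where row j of D i is D_{e_i} e_j and
row l of Da is the l-th partial derivative of a. *)
Definition form_deriv P Da D a : 'M[R]_n :=
  \matrix_(i, k) (row i P *m Da + a *m D i) ord0 k.

(** Torsion-freeness turns a *m D i into a *m dP, which the derivative of the equation
a *m P = 0 expresses by Da. *)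
Lemma form_derivE P Da D a (dP : 'I_n -> 'M[R]_n) :
  P^T = - P -> (forall k, row k Da *m P + a *m dP k = 0) ->
  (forall k, (dP k)^T = - dP k) ->
  (forall i j k, D i j k - D j i k = dP k i j) ->
  form_deriv P Da D a = P *m (Da - Da^T) + \sum_i a ord0 i *: D i.
Proof.
move=> skP daP skdP tor; apply/matrixP => i k; rewrite /form_deriv mxE mulmxBr.
rewrite !mxE -addrA; congr (_ + _).
  by apply: eq_bigr => j _; rewrite mxE.
have -> : \sum_j P i j * Da^T j k = \sum_j a ord0 j * dP k j i.
  have /matrixP/(_ ord0 i) := daP k; rewrite !mxE => /eqP.
  rewrite addrC addr_eq0 => /eqP ->; rewrite -sumrN; apply: eq_bigr => j _.
  have /matrixP/(_ j i) := skP; rewrite !mxE => ->.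
  by rewrite mulNr mulrC.
rewrite summxE -sumrN -big_split; apply: eq_bigr => j _ /=.
rewrite mxE -mulrN -mulrDr; congr (_ * _).
have := tor i j k.
have /matrixP/(_ i j) := skdP k; rewrite !mxE => -> <-; ring.
Qed.

(** In the symmetric part the terms with D add up, by the metric condition, to the
derivative of H along a *m P, which is zero. Only the exterior derivative of a remains. *)
Lemma frame_symmetric_part P H Da D a (dP dH : 'I_n -> 'M[R]_n) :
  P^T = - P -> (forall k, row k Da *m P + a *m dP k = 0) ->
  (forall k, (dP k)^T = - dP k) -> a *m P = 0 ->
  (forall i j k, D i j k - D j i k = dP k i j) ->
  H^T = H -> (forall i, dir (row i P) dH = D i *m H + H *m (D i)^T) ->
  let K := form_deriv P Da D a *m H in
  let B := P *m (Da - Da^T) *m H in K + K^T = B + B^T.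
Proof.
move=> skP daP skdP aP tor symH met K B.
pose S := \sum_i a ord0 i *: D i.
have E : K = B + S *m H by rewrite /K (form_derivE skP daP skdP tor) mulmxDl.
suff SH : S *m H + (S *m H)^T = 0.
  by rewrite E linearD /= addrACA SH addr0.
rewrite trmx_mul symH /S mulmx_suml linear_sum mulmx_sumr -big_split /=.
transitivity (\sum_i a ord0 i *: dir (row i P) dH).
  by apply: eq_bigr => i _; rewrite linearZ /= -scalemxAl -scalemxAr met scalerDr.
transitivity (dir (a *m P) dH); last first.
  by rewrite aP /dir big1 // => l _; rewrite mxE scale0r.
apply/matrixP => i j; rewrite dirE summxE.
under eq_bigr do rewrite mxE dirE mulr_sumr.
rewrite exchange_big /=; apply: eq_bigr => l _.
rewrite mxE mulr_suml; apply: eq_bigr => k _; rewrite !mxE; ring.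
Qed.

(** Components of the Lie derivative of P along X, where DX is the Jacobian matrix of X. *)
Definition lie_of P (dP : 'I_n -> 'M[R]_n) (X : 'rV[R]_n) (DX : 'M[R]_n) : 'M[R]_n :=
  dir X dP - DX^T *m P - P *m DX.

(** The metric condition rewrites K as P *m DA - N, where DA is the Jacobian of a *m H and
N contracts D with a *m H; antisymmetrized, N becomes a derivative of P because D is
torsion-free. *)
Lemma frame_skew_part P H Da D a (dP dH : 'I_n -> 'M[R]_n) :
  P^T = - P -> 
  (forall i j k, D i j k - D j i k = dP k i j) ->
  H^T = H -> (forall i, dir (row i P) dH = D i *m H + H *m (D i)^T) ->
  let K := form_deriv P Da D a *m H in
  let DA := \matrix_(k, j) (row k Da *m H + a *m dH k) ord0 j in
  K - K^T = - lie_of P dP (a *m H) DA.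
Proof.
move=> skP tor symH met K DA.
pose N := \matrix_(i, j) \sum_k (a *m H) ord0 k * D i j k.
have E : K = P *m DA - N.
  apply/matrixP => i j; rewrite /K /N !mxE.
  transitivity ((row i (form_deriv P Da D a) *m H) ord0 j).
    by rewrite mxE; apply: eq_bigr => k _; rewrite !mxE.
  have -> : row i (form_deriv P Da D a) = row i P *m Da + a *m D i.
    by apply/rowP => k; rewrite !mxE.
  rewrite mulmxDl -!mulmxA.
  have -> : D i *m H = dir (row i P) dH - H *m (D i)^T by rewrite met addrK.
  rewrite mulmxBr [a *m (H *m _)]mulmxA addrA !mxE; congr (_ - _); last first.
    by apply: eq_bigr => k _; rewrite [(D i)^T _ _]mxE.
  rewrite [X in _ + X](_ : _ = \sum_k P i k * (a *m dH k) ord0 j); last first.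
    under eq_bigr do rewrite dirE mulr_sumr.
    rewrite exchange_big /=; apply: eq_bigr => l _.
    by rewrite [in RHS]mxE mulr_sumr; apply: eq_bigr => k _; rewrite [row _ _ _ _]mxE mulrCA.
  rewrite -big_split /=; apply: eq_bigr => k _; rewrite [row i P _ _]mxE -mulrDr.
  have DAE : DA k j = (row k Da *m H) ord0 j + (a *m dH k) ord0 j.
    by rewrite /DA mxE [LHS]mxE.
  by rewrite DAE -row_mul [row _ _ _ _]mxE.
have NN : N - N^T = dir (a *m H) dP.
  apply/matrixP => i j; rewrite dirE !mxE -sumrB; apply: eq_bigr => k _.
  by rewrite -mulrBr tor.
rewrite E linearB /= /lie_of -NN trmx_mul skP mulmxN.
by apply/matrixP => i j; rewrite !mxE; ring.
Qed.
End FrameAlgebra.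

(** * Bivectors and covectors in dimension three *)

Section ThreeDim.
Variables (R : realFieldType).
Implicit Types (u v w a b : 'rV[R]_3) (M P H G Da W : 'M[R]_3).

Definition o0 : 'I_3 := @Ordinal 3 0 isT.
Definition o1 : 'I_3 := @Ordinal 3 1 isT.
Definition o2 : 'I_3 := @Ordinal 3 2 isT.

Lemma ord3P (Q : 'I_3 -> Prop) : Q o0 -> Q o1 -> Q o2 -> forall i, Q i.
Proof.
move=> H0 H1 H2 [[|[|[|//]]] lti].
- by rewrite (_ : Ordinal lti = o0) //; apply/val_inj.
- by rewrite (_ : Ordinal lti = o1) //; apply/val_inj.
- by rewrite (_ : Ordinal lti = o2) //; apply/val_inj.
Qed.

Lemma sum3E (V : nmodType) (F : 'I_3 -> V) : \sum_i F i = F o0 + F o1 + F o2.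
Proof.
rewrite !big_ord_recl big_ord0 addr0 addrA.
by congr (F _ + F _ + F _); apply/val_inj.
Qed.

(** The matrix of the cross product: u *m hat v is v x u. *)
Definition hat v : 'M[R]_3 := \matrix_(i, j)
  match (i : nat), (j : nat) with
  | 0%N, 1%N => v ord0 o2 | 1%N, 0%N => - v ord0 o2
  | 1%N, 2%N => v ord0 o0 | 2%N, 1%N => - v ord0 o0
  | 2%N, 0%N => v ord0 o1 | 0%N, 2%N => - v ord0 o1
  | _, _ => 0
  end.

Definition unhat (P : 'M[R]_3) : 'rV[R]_3 :=
  \row_k match (k : nat) with 0%N => P o1 o2 | 1%N => P o2 o0 | _ => P o0 o1 end.

Lemma skew_entries P i j : P^T = - P -> P j i = - P i j.
Proof. by move=> /matrixP/(_ i j); rewrite !mxE. Qed.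

Lemma skew_diag P i : P^T = - P -> P i i = 0.
Proof. by move=> /(skew_entries i i) H; lra. Qed.

Lemma skew_eq P M : P^T = - P -> M^T = - M -> P o0 o1 = M o0 o1 ->
  P o1 o2 = M o1 o2 -> P o2 o0 = M o2 o0 -> P = M.
Proof.
move=> sP sM E2 E0 E1; apply/matrixP; apply: ord3P; apply: ord3P;
  rewrite ?skew_diag ?E2 ?E0 ?E1 //.
- by rewrite (skew_entries o2 o0 sP) (skew_entries o2 o0 sM) E1.
- by rewrite (skew_entries o0 o1 sP) (skew_entries o0 o1 sM) E2.
- by rewrite (skew_entries o1 o2 sP) (skew_entries o1 o2 sM) E0.
Qed.

Lemma unhatK P : P^T = - P -> hat (unhat P) = P.
Proof.
move=> sk; apply/matrixP; apply: ord3P; apply: ord3P; rewrite !mxE /= ?mxE /= //.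
all: by rewrite ?(skew_diag _ sk) // -skew_entries.
Qed.

Lemma hatK v : unhat (hat v) = v.
Proof. by apply/rowP; apply: ord3P; rewrite !mxE. Qed.

Lemma hat_linear : linear hat.
Proof.
move=> k u v; apply/matrixP; apply: ord3P; apply: ord3P; rewrite !mxE /= ?mxE; ring.
Qed.

HB.instance Definition _ := GRing.isLinear.Build _ _ _ _ hat hat_linear.

Lemma hatZ k v : hat (k *: v) = k *: hat v. Proof. exact: linearZ. Qed.

Lemma hat_mul v Da : hat (v *m Da) = \sum_l v ord0 l *: hat (row l Da).
Proof.
rewrite mulmx_sum_row (linear_sum hat); apply: eq_bigr => l _; exact: hatZ.
Qed.

Lemma hat_skew v : (hat v)^T = - hat v.
Proof. apply/matrixP; apply: ord3P; apply: ord3P; rewrite !mxE /=; ring. Qed.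

Lemma hat_inj : injective hat. Proof. exact: can_inj hatK. Qed.

Lemma mul_hat_self a : a *m hat a = 0.
Proof. apply/rowP; apply: ord3P; rewrite !mxE sum3E !mxE /=; ring. Qed.

Lemma mul_hat0 a b i j : b *m hat a = 0 -> b ord0 i * a ord0 j = b ord0 j * a ord0 i.
Proof.
move=> /rowP H; have := (H o0, H o1, H o2).
rewrite !mxE !sum3E !mxE /= => -[[H0 H1] H2].
by elim/ord3P: i; elim/ord3P: j; lra.
Qed.

(** The infinitesimal form of [hat_conj]. *)
Lemma hat_trace M v :
  M *m hat v + hat v *m M^T = \tr M *: hat v - hat (v *m M).
Proof.
apply/matrixP; apply: ord3P; apply: ord3P;
  rewrite !(mxE, sum3E, sum3E) /= /mxtrace ?sum3E; ring.
Qed.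

Lemma hat_hat a w : hat a *m hat w = w^T *m a - ((a *m w^T) ord0 ord0)%:M.
Proof.
apply/matrixP; apply: ord3P; apply: ord3P;
  rewrite !(mxE, sum3E, big_ord1) /=; ring.
Qed.

(** Entries indexed by natural numbers let [/=] evaluate the indices of minors. *)
Lemma mx_inordE n (M : 'M[R]_n.+1) :
  exists f : nat -> nat -> R, M = \matrix_(i, j) f i j.
Proof.
exists (fun p q => M (inord p) (inord q)).
by apply/matrixP => i j; rewrite mxE !inord_val.
Qed.

Lemma det2E (M : 'M[R]_2) :
  \det M = M ord0 ord0 * M ord_max ord_max - M ord0 ord_max * M ord_max ord0.
Proof.
have [f ->] := mx_inordE M.
rewrite (expand_det_row _ ord0) !big_ord_recl big_ord0 /cofactor !det_mx11.
by rewrite !mxE /= /bump /= expr0 expr1 addr0; ring.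
Qed.

Lemma det3E M : \det M =
  M o0 o0 * (M o1 o1 * M o2 o2 - M o1 o2 * M o2 o1)
  - M o0 o1 * (M o1 o0 * M o2 o2 - M o1 o2 * M o2 o0)
  + M o0 o2 * (M o1 o0 * M o2 o1 - M o1 o1 * M o2 o0).
Proof.
have [f ->] := mx_inordE M.
rewrite (expand_det_row _ o0) sum3E /cofactor !det2E !mxE /= /bump /=.
by rewrite !(expr0, expr1, expr2); ring.
Qed.

(** The cross product is equivariant up to the determinant. *)
Lemma hat_conj M u : M *m hat (u *m M) *m M^T = \det M *: hat u.
Proof.
apply: skew_eq.
- by rewrite !trmx_mul trmxK hat_skew mulNmx mulmxN mulmxA.
- by rewrite linearZ /= hat_skew scalerN.
all: rewrite det3E !(mxE, sum3E, sum3E) /=;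
  move: (u ord0 o0) (u ord0 o1) (u ord0 o2) (M o0 o0) (M o0 o1) (M o0 o2)
    (M o1 o0) (M o1 o1) (M o1 o2) (M o2 o0) (M o2 o1) (M o2 o2); clear=> *; ring.
Qed.

(** Each test vector consists of cofactors of the last row of a leading block, so that its
quadratic form is the product of two consecutive leading minors. *)
Lemma posdef_det_gt0 G : G^T = G ->
  (forall v, v != 0 -> 0 < (v *m G *m v^T) ord0 ord0) -> 0 < \det G.
Proof.
move=> symG pos.
have sG i j : G j i = G i j by have /matrixP/(_ i j) := symG; rewrite mxE.
have quad v : (v *m G *m v^T) ord0 ord0 =
   \sum_i \sum_j v ord0 i * G i j * v ord0 j.
  rewrite mxE exchange_big /=; apply: eq_bigr => j _.
  by rewrite !mxE mulr_suml.
pose mkv (p q r : R) : 'rV[R]_3 :=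
  \row_k match (k : nat) with 0%N => p | 1%N => q | _ => r end.
have G0 : 0 < G o0 o0.
  have := pos (mkv 1 0 0); rewrite quad !sum3E !mxE /=.
  have -> : mkv 1 0 0 != 0.
    by apply/eqP => /rowP/(_ o0); rewrite !mxE /= => /eqP; rewrite oner_eq0.
  by move=> /(_ isT); rewrite !(mul0r, mulr0, addr0, mul1r, mulr1).
have m0 : 0 < G o0 o0 * G o1 o1 - G o0 o1 * G o0 o1.
  have := pos (mkv (- G o0 o1) (G o0 o0) 0); rewrite quad !sum3E !mxE /=.
  have -> : mkv (- G o0 o1) (G o0 o0) 0 != 0.
    by apply/eqP => /rowP/(_ o1); rewrite !mxE /= => /eqP; rewrite gt_eqF.
  move=> /(_ isT); rewrite (sG o0 o1) => H.
  rewrite -(pmulr_rgt0 _ G0); apply: lt_le_trans H _.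
  by rewrite le_eqVlt; apply/orP; left; apply/eqP; ring.
pose m := G o0 o0 * G o1 o1 - G o0 o1 * G o0 o1.
pose c0 := G o0 o1 * G o1 o2 - G o0 o2 * G o1 o1.
pose c1 := G o0 o1 * G o0 o2 - G o0 o0 * G o1 o2.
have := pos (mkv c0 c1 m); rewrite quad !sum3E !mxE /=.
have -> : mkv c0 c1 m != 0.
  by apply/eqP => /rowP/(_ o2); rewrite !mxE /= => /eqP; rewrite gt_eqF.
move=> /(_ isT); rewrite (sG o0 o1) (sG o0 o2) (sG o1 o2) => H.
rewrite -(pmulr_rgt0 _ m0); apply: lt_le_trans H _.
rewrite le_eqVlt; apply/orP; left; apply/eqP.
by rewrite det3E (sG o0 o1) (sG o0 o2) (sG o1 o2) /m /c0 /c1; ring.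
Qed.

(** With W = hat w and A = a *m H, [hat_hat] turns the hypothesis into
w^T A + A^T w = 2 (a.w) H. The trace against G gives a.w = 0, and
w^T A + A^T w = 0 forces w = 0 as A is not zero. *)
Lemma sym_contraction_eq0 G H W a k : H^T = H -> G *m H = 1%:M -> k != 0 ->
  W^T = - W -> a != 0 ->
  (k *: hat a) *m W *m H + ((k *: hat a) *m W *m H)^T = 0 -> W = 0.
Proof.
move=> symH GH k0 skW a0; rewrite -(unhatK skW); move: (unhat W) => w.
have HG := mulmx1C GH.
rewrite -!scalemxAl linearZ /= -scalerDr => /eqP; rewrite scaler_eq0 (negbTE k0) /=.
move/eqP; rewrite !trmx_mul symH !hat_skew !(mulmxN, mulNmx) opprK.
rewrite !hat_hat.
set c := (a *m w^T) ord0 ord0.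
have -> : (w *m a^T) ord0 ord0 = c.
  by rewrite /c !mxE; apply: eq_bigr => l _; rewrite !mxE mulrC.
rewrite mulmxBl mulmxBr !mul_scalar_mx !mul_mx_scalar => E.
have tw : \tr (w^T *m a) = c.
  by rewrite mxtrace_mulC /mxtrace big_ord1.
have c0 : c = 0.
  have t1 : \tr (w^T *m a *m H *m G) = c by rewrite -mulmxA HG mulmx1.
  have t2 : \tr (H *m (a^T *m w) *m G) = c.
    by rewrite mxtrace_mulC [G *m (H *m _)]mulmxA GH mul1mx -mxtrace_tr trmx_mul trmxK tw.
  have := congr1 (fun X => \tr (X *m G)) E.
  rewrite mul0mx mxtrace0 mulmxDl !mulmxBl -!scalemxAl HG mxtraceD !linearB /=.
  by rewrite t1 t2 !mxtraceZ mxtrace1; lra.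
move: E; rewrite c0 !scale0r !subr0 => E.
pose A := a *m H.
have A0 : A != 0.
  apply: contraNneq a0 => A0; have : A *m G = 0 by rewrite A0 mul0mx.
  by rewrite /A -mulmxA HG mulmx1 => ->.
have {}E i j : w ord0 i * A ord0 j + A ord0 i * w ord0 j = 0.
  have /matrixP/(_ i j) := E.
  rewrite -[w^T *m a *m H]mulmxA -/A.
  have -> : H *m (a^T *m w) = A^T *m w.
    by rewrite /A trmx_mul symH mulmxA.
  by rewrite !mxE !big_ord1 !mxE.
suff -> : w = 0 by rewrite linear0.
have /rV0Pn[i Ai] := A0.
have wi : w ord0 i = 0.
  by have := E i i; rewrite (mulrC (A _ _)) -mulr2n => /eqP; rewrite mulrn_eq0 /= mulf_eq0 (negbTE Ai) orbF => /eqP.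
apply/rowP => j; rewrite mxE; have := E j i.
by rewrite wi mulr0 addr0 => /eqP; rewrite mulf_eq0 (negbTE Ai) orbF => /eqP.
Qed.

(** A bivector s^-1 hat a at one point, together with the first derivatives of s and a. *)
Section Dual.
Variables (s : R) (a : 'rV[R]_3) (Da : 'M[R]_3) (ds : 'I_3 -> R) (dP : 'I_3 -> 'M[R]_3).
Hypothesis s0 : s != 0.
Let P := s^-1 *: hat a.
Hypothesis dPE : forall l, dP l = s^-1 *: hat (row l Da) - (s^-1 * s^-1 * ds l) *: hat a.

Lemma dir_dual v : dir v dP =
  s^-1 *: hat (v *m Da) - (s^-1 * s^-1 * \sum_l v ord0 l * ds l) *: hat a.
Proof.
rewrite /dir; under eq_bigr do rewrite dPE scalerBr.
rewrite sumrB; congr (_ - _).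
  rewrite hat_mul scaler_sumr; apply: eq_bigr => l _.
  by rewrite !scalerA mulrC.
under eq_bigr do rewrite scalerA.
rewrite -scaler_suml; congr (_ *: _).
by rewrite mulr_sumr; apply: eq_bigr => l _; rewrite mulrCA.
Qed.

(** By [hat_trace] the left-hand side is s^-1 hat (D_{e_i} a) plus a multiple of hat a. Its
coefficient involves tr (D i), which the metric condition ties to the derivative of the
volume, and it vanishes. *)
Lemma bivec_deriv G H (dH D : 'I_3 -> 'M[R]_3) : G *m H = 1%:M -> H^T = H ->
  (forall i, dir (row i P) dH = D i *m H + H *m (D i)^T) ->
  (forall l, \tr (G *m dH l) = - (2 * s^-1 * ds l)) ->
  forall i, dir (row i P) dP - D i *m P - P *m (D i)^T =
    s^-1 *: hat (row i (form_deriv P Da D a)).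
Proof.
move=> GH symH met vol i.
have HG := mulmx1C GH.
have trD : \tr (D i) = - (s^-1 * \sum_l row i P ord0 l * ds l).
  have E : \tr (G *m dir (row i P) dH) = \tr (D i) + \tr (D i).
    rewrite met mulmxDr mxtraceD; congr (_ + _).
      by rewrite mxtrace_mulC -mulmxA HG mulmx1.
    by rewrite mulmxA GH mul1mx mxtrace_tr.
  have E2 : \tr (G *m dir (row i P) dH) =
      - (2 * (s^-1 * \sum_l row i P ord0 l * ds l)).
    rewrite /dir mulmx_sumr linear_sum mulrA mulr_sumr -sumrN.
    apply: eq_bigr => l _ /=.
    by rewrite -scalemxAr linearZ /= vol mulrN mulrCA !mulrA.
  by move: E; rewrite E2; lra.
rewrite dir_dual -addrA -opprD.
have -> : D i *m P + P *m (D i)^T = s^-1 *: (\tr (D i) *: hat a - hat (a *m D i)).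
  by rewrite -hat_trace scalerDr /P -scalemxAr -scalemxAl.
have -> : row i (form_deriv P Da D a) = row i P *m Da + a *m D i.
  by apply/rowP => k; rewrite !mxE.
rewrite trD (linearD hat) /=; move: (\sum_l _) => d.
move: (hat _) (hat (a *m _)) (hat a) => A B C.
by apply/matrixP => k l; rewrite !mxE; ring.
Qed.

(** The divergence with respect to the density s. *)
Definition div_of (X : 'rV[R]_3) (DX : 'M[R]_3) : R :=
  \tr DX + s^-1 * \sum_l X ord0 l * ds l.

(** [hat_trace] evaluates DX^T *m P + P *m DX; its trace term and the derivative of s
combine into the divergence. *)
Lemma lie_of_dual X DX : lie_of P dP X DX =
  s^-1 *: hat (X *m Da + a *m DX^T - div_of X DX *: a).
Proof.
rewrite /lie_of dir_dual -addrA -opprD.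
have -> : DX^T *m P + P *m DX = s^-1 *: (\tr DX *: hat a - hat (a *m DX^T)).
  have := hat_trace DX^T a; rewrite trmxK mxtrace_tr => <-.
  by rewrite scalerDr /P -scalemxAr -scalemxAl.
rewrite (linearB hat) (linearD hat) /= hatZ /div_of; move: (\sum_l _) => d.
move: (hat _) (hat _) (hat a) => A B C.
by apply/matrixP => i j; rewrite !mxE; ring.
Qed.

(** The symmetric Christoffel symbols contract to zero with the skew matrix P, and their
trace cancels the derivative of s. *)
Lemma divergence_dual (C : 'I_3 -> 'I_3 -> 'I_3 -> R) :
  (forall i k l, C i k l = C i l k) ->
  (forall l, \sum_i C i i l = s^-1 * ds l) ->
  forall j, \sum_i (dP i i j + \sum_l (C i i l * P l j + C j i l * P i l)) =
    s^-1 * \sum_i hat (row i Da) i j.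
Proof.
move=> symC trC j.
have E1 : \sum_i \sum_l C j i l * P i l = 0.
  have E : \sum_i \sum_l C j i l * P i l = - \sum_i \sum_l C j i l * P i l.
    rewrite {1}exchange_big -sumrN; apply: eq_bigr => i _.
    rewrite -sumrN; apply: eq_bigr => l _.
    by rewrite symC -mulrN; congr (_ * _); rewrite /P; elim/ord3P: i; elim/ord3P: l; rewrite !mxE /=; ring.
  lra.
have E2 : \sum_i \sum_l C i i l * P l j = s^-1 * \sum_l ds l * P l j.
  rewrite exchange_big /= mulr_sumr; apply: eq_bigr => l _.
  by rewrite -mulr_suml trC mulrA.
rewrite big_split /=.
under [X in _ + X]eq_bigr do rewrite big_split /=.
rewrite big_split /= E1 E2 addr0 /P.
rewrite !mulr_sumr -big_split /=; apply: eq_bigr => i _.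
rewrite dPE !mxE; ring.
Qed.

Lemma curl_eq0 : (forall j, \sum_i hat (row i Da) i j = 0) <-> Da - Da^T = 0.
Proof.
split=> [H|/matrixP H j].
  have H0 := H o0; have H1 := H o1; have H2 := H o2.
  move: H0 H1 H2; rewrite !sum3E !mxE /= => H0 H1 H2.
  by apply/matrixP; apply: ord3P; apply: ord3P; rewrite !mxE /=; lra.
have H01 := H o0 o1; have H02 := H o0 o2; have H12 := H o1 o2.
move: H01 H02 H12; rewrite !mxE => H01 H02 H12.
by elim/ord3P: j; rewrite sum3E !mxE /=; lra.
Qed.

(** By skew-symmetry only the component 012 matters, and there all terms cancel because
Da is symmetric. *)
Lemma schouten_dual : Da - Da^T = 0 -> forall i j k,
  let term i j k := \sum_l P i l * dP l j k in
  term i j k + term j k i + term k i j = 0.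
Proof.
move=> /matrixP H.
have H01 := H o0 o1; have H02 := H o0 o2; have H12 := H o1 o2.
move: H01 H02 H12; rewrite !mxE => /subr0_eq H01 /subr0_eq H02 /subr0_eq H12.
pose t i j k := \sum_l P i l * dP l j k.
have tskew i j k : t i j k = - t i k j.
  rewrite /t -sumrN; apply: eq_bigr => l _; rewrite -mulrN; congr (_ * _).
  have sdP : (dP l)^T = - dP l.
    by rewrite dPE linearB !linearZ /= !hat_skew !scalerN opprD opprK.
  exact: (skew_entries _ _ sdP).
have t012 : t o0 o1 o2 + t o1 o2 o0 + t o2 o0 o1 = 0.
  rewrite /t /P !sum3E !dPE !mxE /= H01 H02 H12.
  move: s^-1 (a ord0 o0) (a ord0 o1) (a ord0 o2) (Da o0 o0) (Da o1 o0) (Da o2 o0)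
    (Da o1 o1) (Da o2 o1) (Da o2 o2) (ds o0) (ds o1) (ds o2).
  by clear=> *; ring.
move=> i j k /=; rewrite -/(t i j k) -/(t j k i) -/(t k i j).
have := (tskew i j k, tskew j k i, tskew k i j, t012) => -[[[]]].
clear tskew t012; clearbody t => T1 T2 T3 T4.
by move: T1 T2 T3 T4; elim/ord3P: i; elim/ord3P: j; elim/ord3P: k; lra.
Qed.
End Dual.

End ThreeDim.

(** * Changes of coordinates *)

Section CoordinateChange.
Variables (R : comUnitRingType) (n : nat) (T F : 'M[R]_n).
Hypotheses (TF : T *m F = 1%:M) (FT : F *m T = 1%:M).

Lemma mulmx_trFT k (b : 'M[R]_(k, n)) : b *m F^T *m T^T = b.
Proof. by rewrite -mulmxA -trmx_mul TF trmx1 mulmx1. Qed.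

Lemma mulmx_TF k (b : 'M[R]_(k, n)) : b *m T *m F = b.
Proof. by rewrite -mulmxA TF mulmx1. Qed.

Lemma invmx_conj (G : 'M[R]_n) : G \in unitmx ->
  invmx (F *m G *m F^T) = T^T *m invmx G *m T.
Proof.
move=> Gu.
have H : T^T *m invmx G *m T *m (F *m G *m F^T) = 1%:M.
  by rewrite !mulmxA mulmx_TF mulmxKV // -trmx_mul FT trmx1.
have [_ U] := mulmx1_unit H.
by rewrite -[RHS](mulmxK U) H mul1mx.
Qed.

Lemma sharp_conj k (a : 'M[R]_(k, n)) (G : 'M[R]_n) : G \in unitmx ->
  a *m invmx G *m T = a *m F^T *m invmx (F *m G *m F^T).
Proof. by move=> Gu; rewrite invmx_conj // !mulmxA mulmx_trFT. Qed.

Lemma anchor_conj k (a : 'M[R]_(k, n)) (P : 'M[R]_n) :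
  a *m P *m T = a *m F^T *m (T^T *m P *m T).
Proof. by rewrite !mulmxA mulmx_trFT. Qed.

Lemma pairing_conj k l (X : 'M[R]_(k, n)) (b : 'M[R]_(l, n)) :
  X *m T *m (b *m F^T)^T = X *m b^T.
Proof. by rewrite trmx_mul trmxK mulmxA mulmx_TF. Qed.
End CoordinateChange.

(** Locked, so that comparing two Jacobian matrices never unfolds a derivative. *)
HB.lock Definition jac (R : realType) (n : nat) (M : smooth_manifold R n)
  (c d : chart R n M) (p : M) : 'M[R]_n := jacobian (transition c d) (coord c p).

Section Charts.
Variables (R : realType) (n : nat) (M : smooth_manifold R n).
Implicit Types (c d e : chart R n M) (p : M).

Definition image_of c : set 'rV[R]_n := coord c @` dom c.

Lemma image_of_open c : open (image_of c). Proof. exact: coord_open. Qed.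

Lemma image_of_coord c p : dom c p -> image_of c (coord c p).
Proof. by exists p. Qed.

Lemma near_point c p (U : set M) : dom c p -> nbhs p U ->
  \forall y \near coord c p, [/\ image_of c y, dom c (point c y),
    coord c (point c y) = y & U (point c y)].
Proof.
move=> cp Up.
have H1 : \forall y \near coord c p, image_of c y.
  by apply: open_nbhs_nbhs; split; [exact: image_of_open|exact: image_of_coord].
have H2 : \forall y \near coord c p, U (point c y).
  by apply: (point_cont cp); rewrite coordK.
move: H2; apply: filterS2 H1 => y [q cq <-]; rewrite coordK // => Uq.
by split => //; exists q.
Qed.

Lemma coord_image_open c (U : set M) : open U -> open (coord c @` (U `&` dom c)).
Proof.
move=> oU; rewrite openE => _ [p [Up cp] <-]; rewrite /interior.
have := near_point cp (open_nbhs_nbhs (conj oU Up)).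
by apply: filterS => y [_ dy ycy Uy]; exists (point c y).
Qed.

Lemma transition_coord c d p : dom c p -> transition c d (coord c p) = coord d p.
Proof. by move=> cp; rewrite /transition /= coordK. Qed.

Lemma transition_smooth c d j : @atlas R n M c -> @atlas R n M d ->
  smooth_on (coord c @` (dom c `&` dom d)) (fun x => transition c d x ord0 j).
Proof. by move=> ac ad; exact: atlas_smooth. Qed.

Lemma overlap_open c d : open (coord c @` (dom c `&` dom d)).
Proof. by rewrite setIC; apply: coord_image_open; exact: dom_open. Qed.

Lemma transition_diff c d p : @atlas R n M c -> @atlas R n M d ->
  dom c p -> dom d p -> differentiable (transition c d) (coord c p).
Proof.
move=> ac ad cp dp; apply: differentiable_rV => j.
by apply: (transition_smooth j ac ad [::]); exists p.
Qed.

Lemma jac_entry c d p i j : @atlas R n M c -> @atlas R n M d -> dom c p -> dom d p ->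
  partial i (fun y => transition c d y ord0 j) (coord c p) = jac c d p i j.
Proof. by move=> ac ad cp dp; rewrite jac.unlock jacobianE //; exact: transition_diff. Qed.

Lemma partial_transition c d p i (f : 'rV[R]_n -> R) :
  @atlas R n M c -> @atlas R n M d -> dom c p -> dom d p ->
  differentiable f (coord d p) ->
  partial i (f \o transition c d) (coord c p)
  = \sum_j jac c d p i j * partial j f (coord d p).
Proof.
move=> ac ad cp dp; rewrite -(transition_coord d cp) => df.
rewrite partial_comp //; last exact: transition_diff.
by apply: eq_bigr => j _; congr (_ * _); exact: jac_entry.
Qed.

Lemma jac_comp c d e p : @atlas R n M c -> @atlas R n M d -> @atlas R n M e ->
  dom c p -> dom d p -> dom e p -> jac c e p = jac c d p *m jac d e p.
Proof.
move=> ac ad ae cp dp ep; apply/matrixP => i k.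
rewrite [RHS]mxE -(jac_entry i k ac ae cp ep).
rewrite (@partial_near_eq _ _ _ _
  ((fun y => transition d e y ord0 k) \o transition c d)); last first.
  have := near_point cp (open_nbhs_nbhs (conj (@dom_open _ _ _ d) dp)).
  by apply: filterS => y [_ _ _ dy]; rewrite /transition /= coordK.
rewrite (partial_transition i ac ad cp dp).
  by apply: eq_bigr => j _; congr (_ * _); exact: jac_entry.
by apply: differentiable_coordw; exact: transition_diff.
Qed.

Lemma jac_id c p : @atlas R n M c -> dom c p -> jac c c p = 1%:M.
Proof.
move=> ac cp; apply/matrixP => i j; rewrite -(jac_entry i j ac ac cp cp).
rewrite (@partial_near_eq _ _ _ _ (fun y : 'rV[R]_n => y ord0 j)); first exact: partial_coord.
have : \forall y \near coord c p, [/\ image_of c y, dom c (point c y),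
    coord c (point c y) = y & setT (point c y)] by apply: near_point => //; exact: filterT.
by apply: filterS => y [_ _ yE _]; rewrite /transition /= yE.
Qed.

Lemma jac_inv c d p : @atlas R n M c -> @atlas R n M d -> dom c p -> dom d p ->
  jac c d p *m jac d c p = 1%:M.
Proof. by move=> ac ad cp dp; rewrite -jac_comp // jac_id. Qed.

Let at_atlas p := @chart_at_atlas R n M p.
Let at_dom p := @chart_at_dom R n M p.
Hint Resolve at_atlas at_dom : core.

Lemma vec_inE c (X : M -> 'rV[R]_n) p : dom c p ->
  vec_in c X (coord c p) = X p *m jac (chart_at p) c p.
Proof. by move=> cp; rewrite /vec_in coordK // jac.unlock. Qed.
Lemma form_inE c (a : M -> 'rV[R]_n) p : dom c p ->
  form_in c a (coord c p) = a p *m (jac c (chart_at p) p)^T.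
Proof. by move=> cp; rewrite /form_in coordK // jac.unlock. Qed.
Lemma bivec_inE c (P : M -> 'M[R]_n) p : dom c p ->
  bivec_in c P (coord c p) = (jac (chart_at p) c p)^T *m P p *m jac (chart_at p) c p.
Proof. by move=> cp; rewrite /bivec_in coordK // jac.unlock. Qed.
Lemma metric_inE c (g : M -> 'M[R]_n) p : dom c p ->
  metric_in c g (coord c p) = jac c (chart_at p) p *m g p *m (jac c (chart_at p) p)^T.
Proof. by move=> cp; rewrite /metric_in coordK // jac.unlock. Qed.

Lemma form_in_chart_at a p : form_in (chart_at p) a (coord (chart_at p) p) = a p.
Proof. by rewrite form_inE // jac_id // trmx1 mulmx1. Qed.

Section Change.
Variables (c d : chart R n M) (p : M).
Hypotheses (ac : @atlas R n M c) (ad : @atlas R n M d) (cp : dom c p) (dp : dom d p).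

Lemma form_in_change a : form_in c a (coord c p) = form_in d a (coord d p) *m (jac c d p)^T.
Proof. by rewrite (form_inE a cp) (form_inE a dp) (jac_comp ac ad (at_atlas p) cp dp (at_dom p)) trmx_mul mulmxA. Qed.

Lemma vec_in_change X : vec_in d X (coord d p) = vec_in c X (coord c p) *m jac c d p.
Proof. by rewrite (vec_inE X cp) (vec_inE X dp) (jac_comp (at_atlas p) ac ad (at_dom p) cp dp) mulmxA. Qed.

Lemma bivec_in_change P :
  bivec_in d P (coord d p) = (jac c d p)^T *m bivec_in c P (coord c p) *m jac c d p.
Proof. by rewrite (bivec_inE P cp) (bivec_inE P dp) (jac_comp (at_atlas p) ac ad (at_dom p) cp dp) trmx_mul !mulmxA. Qed.

End Change.

Section AtPoint.
Variables (c : chart R n M) (p : M).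
Hypotheses (ac : @atlas R n M c) (cp : dom c p).

Let TF := jac_inv (at_atlas p) ac (at_dom p) cp.
Let FT := jac_inv ac (at_atlas p) cp (at_dom p).

Lemma invmx_metric_in g : g p \in unitmx ->
  invmx (metric_in c g (coord c p)) = (jac (chart_at p) c p)^T *m invmx (g p) *m jac (chart_at p) c p.
Proof. by move=> gu; rewrite (metric_inE g cp); exact: invmx_conj. Qed.

Lemma vec_in_sharp g a : g p \in unitmx -> vec_in c (sharp g a) (coord c p) =
  form_in c a (coord c p) *m invmx (metric_in c g (coord c p)).
Proof.
move=> gu; rewrite (metric_inE g cp) (vec_inE _ cp) (form_inE _ cp).
exact: sharp_conj.
Qed.

Lemma vec_in_anchor P a : vec_in c (anchor P a) (coord c p) =
  form_in c a (coord c p) *m bivec_in c P (coord c p).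
Proof.
rewrite (bivec_inE _ cp) (vec_inE _ cp) (form_inE _ cp); exact: anchor_conj.
Qed.

Lemma pairing_in X b : vec_in c X (coord c p) *m (form_in c b (coord c p))^T
  = X p *m (b p)^T.
Proof. rewrite (vec_inE _ cp) (form_inE _ cp); exact: pairing_conj. Qed.

Lemma form_prod_in g a b : g p \in unitmx -> form_prod g a b p =
  (form_in c a (coord c p) *m invmx (metric_in c g (coord c p))
    *m (form_in c b (coord c p))^T) ord0 ord0.
Proof. by move=> gu; rewrite -(vec_in_sharp _ gu) pairing_in. Qed.

Lemma bivec_eval_in P a b : bivec_eval P a b p =
  (form_in c a (coord c p) *m bivec_in c P (coord c p)
    *m (form_in c b (coord c p))^T) ord0 ord0.
Proof. by rewrite -vec_in_anchor pairing_in. Qed.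

Definition grad_in (f : M -> R) (x : 'rV[R]_n) : 'rV[R]_n :=
  \row_i partial i (f \o point c) x.

(** Differentiability in the chart c suffices: the chain rule carries it over to
[chart_at p]. *)
Lemma form_in_differential f : differentiable (f \o point c) (coord c p) ->
  form_in c (differential f) (coord c p) = grad_in f (coord c p).
Proof.
move=> df; rewrite (form_inE _ cp).
suff -> : differential f p = grad_in f (coord c p) *m (jac (chart_at p) c p)^T.
  by rewrite -mulmxA -trmx_mul FT trmx1 mulmx1.
apply/rowP => i; rewrite [LHS]mxE [RHS]mxE.
rewrite (@partial_near_eq _ _ _ _ ((f \o point c) \o transition (chart_at p) c)); last first.
  have := near_point (at_dom p) (open_nbhs_nbhs (conj (@dom_open _ _ _ c) cp)).
  by apply: filterS => y [_ _ _ cy]; rewrite /transition /= coordK.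
rewrite (partial_transition _ (at_atlas p) ac (at_dom p) cp) //.
by apply: eq_bigr => j _; rewrite !mxE mulrC.
Qed.

Lemma act_in X f : differentiable (f \o point c) (coord c p) ->
  act X f p = (vec_in c X (coord c p) *m (grad_in f (coord c p))^T) ord0 ord0.
Proof.
by move=> df; rewrite -(form_in_differential df) pairing_in.
Qed.
End AtPoint.
End Charts.

(** * Derivatives of matrix-valued functions *)

(** Both matrices of partial derivatives are locked, for the same reason as [jac]. *)
HB.lock Definition pdm (R : realType) (n m k : nat) (l : 'I_n)
    (F : 'rV[R]_n -> 'M[R]_(m, k)) (x : 'rV[R]_n) : 'M[R]_(m, k) :=
  \matrix_(i, j) partial l (fun y => F y i j) x.

HB.lock Definition Dmx (R : realType) (n k : nat)
    (b : 'rV[R]_n -> 'rV[R]_k) (x : 'rV[R]_n) : 'M[R]_(n, k) :=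
  \matrix_(l, j) partial l (fun y => b y ord0 j) x.

Definition mdiff (R : realType) (n m k : nat) (F : 'rV[R]_n -> 'M[R]_(m, k)) x :=
  forall i j, differentiable (fun y => F y i j) x.

Definition msmooth (R : realType) (n m k : nat) (V : set 'rV[R]_n)
    (F : 'rV[R]_n -> 'M[R]_(m, k)) :=
  forall i j, smooth_on V (fun y => F y i j).

Section MatrixDerivative.
Variables (R : realType) (n : nat).
Implicit Types (x : 'rV[R]_n) (l : 'I_n).

Lemma pdmE m k l (F : 'rV[R]_n -> 'M[R]_(m, k)) x i j :
  pdm l F x i j = partial l (fun y => F y i j) x.
Proof. by rewrite pdm.unlock mxE. Qed.

Lemma DmxE k (b : 'rV[R]_n -> 'rV[R]_k) x l j :
  Dmx b x l j = partial l (fun y => b y ord0 j) x.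
Proof. by rewrite Dmx.unlock mxE. Qed.

Lemma row_Dmx k (b : 'rV[R]_n -> 'rV[R]_k) x l : row l (Dmx b x) = pdm l b x.
Proof. by apply/rowP => j; rewrite mxE DmxE pdmE. Qed.

Lemma mdiff_near_eq m k (F K : 'rV[R]_n -> 'M[R]_(m, k)) x :
  (\near x, F x = K x) -> mdiff F x -> mdiff K x.
Proof.
move=> FK dF i j; apply: differentiable_near_eq (dF i j).
by apply: filterS FK => y ->.
Qed.

Lemma pdm_near_eq m k l (F K : 'rV[R]_n -> 'M[R]_(m, k)) x :
  (\near x, F x = K x) -> pdm l F x = pdm l K x.
Proof.
move=> FK; apply/matrixP => i j; rewrite !pdmE; apply: partial_near_eq.
by apply: filterS FK => y ->.
Qed.

Lemma Dmx_near_eq k (b b' : 'rV[R]_n -> 'rV[R]_k) x :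
  (\near x, b x = b' x) -> Dmx b x = Dmx b' x.
Proof. by move=> bb; apply/row_matrixP => l; rewrite !row_Dmx; exact: pdm_near_eq. Qed.

Lemma mdiff_mul m k q (F : 'rV[R]_n -> 'M[R]_(m, k)) (K : 'rV[R]_n -> 'M[R]_(k, q)) x :
  mdiff F x -> mdiff K x -> mdiff (fun y => F y *m K y) x.
Proof.
move=> dF dK i j.
apply: (@differentiable_near_eq _ _ (fun y => \sum_r F y i r * K y r j)).
  by near=> y; rewrite mxE.
by apply: differentiable_bigsum => r _; apply: differentiableM; [exact: dF|exact: dK].
Unshelve. all: by end_near. Qed.

Lemma pdm_mul m k q l (F : 'rV[R]_n -> 'M[R]_(m, k)) (K : 'rV[R]_n -> 'M[R]_(k, q)) x :
  mdiff F x -> mdiff K x ->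
  pdm l (fun y => F y *m K y) x = pdm l F x *m K x + F x *m pdm l K x.
Proof.
move=> dF dK; apply/matrixP => i j; rewrite pdmE.
rewrite (@partial_near_eq _ _ _ _ (fun y => \sum_r F y i r * K y r j)); last first.
  by near=> y; rewrite mxE.
rewrite partial_sum; last first.
  by move=> r _; apply: differentiableM; [exact: dF|exact: dK].
rewrite !mxE -big_split /=; apply: eq_bigr => r _.
by rewrite !pdmE partialM; [|exact: dF|exact: dK].
Unshelve. all: by end_near. Qed.

Lemma mdiff_tr m k (F : 'rV[R]_n -> 'M[R]_(m, k)) x :
  mdiff F x -> mdiff (fun y => (F y)^T) x.
Proof.
move=> dF i j; apply: (@differentiable_near_eq _ _ (fun y => F y j i)) => //.
by near=> y; rewrite mxE.
Unshelve. all: by end_near. Qed.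

Lemma pdm_tr m k l (F : 'rV[R]_n -> 'M[R]_(m, k)) x :
  pdm l (fun y => (F y)^T) x = (pdm l F x)^T.
Proof.
apply/matrixP => i j; rewrite mxE !pdmE; apply: partial_near_eq.
by near=> y; rewrite mxE.
Unshelve. all: by end_near. Qed.

Lemma pdm_scale m k l (f : 'rV[R]_n -> R) (F : 'rV[R]_n -> 'M[R]_(m, k)) x :
  differentiable f x -> mdiff F x ->
  pdm l (fun y => f y *: F y) x = partial l f x *: F x + f x *: pdm l F x.
Proof.
move=> df dF; apply/matrixP => i j; rewrite pdmE.
rewrite (@partial_near_eq _ _ _ _ (fun y => f y * F y i j)); last first.
  by near=> y; rewrite mxE.
by rewrite !mxE pdmE partialM //; exact: dF.
Unshelve. all: by end_near. Qed.

Lemma pdm_cst m k l (A : 'M[R]_(m, k)) x : pdm l (fun=> A) x = 0.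
Proof. by apply/matrixP => i j; rewrite pdmE partial_cst mxE. Qed.

Lemma Dmx_cst k (v : 'rV[R]_k) x : Dmx (fun=> v) x = 0.
Proof. by apply/matrixP => l j; rewrite DmxE partial_cst mxE. Qed.

Lemma pdm_opp m k l (F : 'rV[R]_n -> 'M[R]_(m, k)) x : mdiff F x ->
  pdm l (fun y => - F y) x = - pdm l F x.
Proof.
move=> dF; apply/matrixP => i j; rewrite mxE !pdmE -partialN; last exact: dF.
by apply: partial_near_eq; near=> y; rewrite mxE.
Unshelve. all: by end_near. Qed.

Lemma pdm_inv l (F H : 'rV[R]_n -> 'M[R]_n) x : mdiff F x -> mdiff H x ->
  (\near x, F x *m H x = 1%:M) -> pdm l H x = - (H x *m pdm l F x *m H x).
Proof.
move=> dF dH FH.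
have : pdm l (fun y => F y *m H y) x = 0.
  by rewrite -[RHS](pdm_cst l 1%:M x); exact: pdm_near_eq.
rewrite pdm_mul // => /eqP; rewrite addrC addr_eq0 => /eqP E.
have HF := mulmx1C (nbhs_singleton FH).
by have := congr1 (mulmx (H x)) E; rewrite mulmxA HF mul1mx mulmxN mulmxA.
Qed.

Lemma Dmx_mul k q (b : 'rV[R]_n -> 'rV[R]_k) (H : 'rV[R]_n -> 'M[R]_(k, q)) x :
  mdiff b x -> mdiff H x ->
  Dmx (fun y => b y *m H y) x = Dmx b x *m H x + \matrix_l (b x *m pdm l H x).
Proof.
move=> db dH; apply/row_matrixP => l.
by rewrite row_Dmx pdm_mul // linearD /= row_mul row_Dmx rowK.
Qed.

Lemma dir_sym m v (dF : 'I_n -> 'M[R]_m) :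
  (forall l, (dF l)^T = dF l) -> (dir v dF)^T = dir v dF.
Proof.
by move=> s; rewrite /dir linear_sum; apply: eq_bigr => l _; rewrite linearZ /= s.
Qed.

Lemma dir_skew m v (dF : 'I_n -> 'M[R]_m) :
  (forall l, (dF l)^T = - dF l) -> (dir v dF)^T = - dir v dF.
Proof.
move=> s; rewrite /dir linear_sum -sumrN; apply: eq_bigr => l _.
by rewrite linearZ /= s scalerN.
Qed.

Lemma msmooth_diff m k (V : set 'rV[R]_n) (F : 'rV[R]_n -> 'M[R]_(m, k)) x :
  msmooth V F -> V x -> mdiff F x.
Proof. by move=> sF Vx i j; exact: (sF i j [::]). Qed.

Lemma smooth_onD (V : set 'rV[R]_n) f g : open V -> smooth_on V f -> smooth_on V g ->
  smooth_on V (fun y => f y + g y).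
Proof. by move=> oV /smooth_onP sf /smooth_onP sg; apply/smooth_onP => k; exact: CkD. Qed.
Lemma smooth_onM (V : set 'rV[R]_n) f g : open V -> smooth_on V f -> smooth_on V g ->
  smooth_on V (fun y => f y * g y).
Proof. by move=> oV /smooth_onP sf /smooth_onP sg; apply/smooth_onP => k; exact: CkM. Qed.
Lemma smooth_onN (V : set 'rV[R]_n) f : open V -> smooth_on V f -> smooth_on V (fun y => - f y).
Proof. by move=> oV /smooth_onP sf; apply/smooth_onP => k; exact: CkN. Qed.
Lemma smooth_on_cst (V : set 'rV[R]_n) a : smooth_on V (fun=> a).
Proof. by apply/smooth_onP => k; exact: Ck_cst. Qed.
Lemma smooth_onV (V : set 'rV[R]_n) f : open V -> (forall x, V x -> f x != 0) ->
  smooth_on V f -> smooth_on V (fun y => (f y)^-1).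
Proof. by move=> oV f0 /smooth_onP sf; apply/smooth_onP => k; exact: CkV. Qed.
Lemma smooth_on_sqrt (V : set 'rV[R]_n) f : open V -> (forall x, V x -> 0 < f x) ->
  smooth_on V f -> smooth_on V (fun y => Num.sqrt (f y)).
Proof. by move=> oV f0 /smooth_onP sf; apply/smooth_onP => k; exact: Ck_sqrt. Qed.
Lemma smooth_on_sum (V : set 'rV[R]_n) (I : Type) (r : seq I) (Q : pred I)
  (F : I -> 'rV[R]_n -> R) : open V -> (forall j, Q j -> smooth_on V (F j)) ->
  smooth_on V (fun y => \sum_(j <- r | Q j) F j y).
Proof.
move=> oV sF; apply/smooth_onP => k; apply: Ck_sum => // j Qj.
by move/smooth_onP: (sF j Qj); exact.
Qed.
Lemma smooth_on_prod (V : set 'rV[R]_n) (I : Type) (r : seq I) (Q : pred I)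
  (F : I -> 'rV[R]_n -> R) : open V -> (forall j, Q j -> smooth_on V (F j)) ->
  smooth_on V (fun y => \prod_(j <- r | Q j) F j y).
Proof.
move=> oV sF; elim: r => [|j r IH].
  apply: (@smooth_on_ext _ _ _ (fun=> 1)) => //; last exact: smooth_on_cst.
  by move=> x _; rewrite big_nil.
apply: (@smooth_on_ext _ _ _ (fun y => (if Q j then F j y else 1) *
    \prod_(j <- r | Q j) F j y)) => //.
  by move=> x _; rewrite big_cons; case: ifP; rewrite ?mul1r.
apply: smooth_onM => //; case: (boolP (Q j)) => [Qj|_]; first exact: sF.
exact: smooth_on_cst.
Qed.
Lemma smooth_on_partial (V : set 'rV[R]_n) f i : smooth_on V f -> smooth_on V (partial i f).
Proof.
move=> /smooth_onP sf; apply/smooth_onP => k; exact: (sf k.+1).2.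
Qed.

Section Msmooth.
Variable V : set 'rV[R]_n.
Hypothesis oV : open V.

Lemma msmooth_ext m k (F K : 'rV[R]_n -> 'M[R]_(m, k)) :
  (forall x, V x -> F x = K x) -> msmooth V F -> msmooth V K.
Proof.
by move=> FK sF i j; apply: smooth_on_ext (sF i j) => // x Vx; rewrite FK.
Qed.

Lemma msmooth_mul m k q (F : 'rV[R]_n -> 'M[R]_(m, k)) (K : 'rV[R]_n -> 'M[R]_(k, q)) :
  msmooth V F -> msmooth V K -> msmooth V (fun y => F y *m K y).
Proof.
move=> sF sK i j; apply: (@smooth_on_ext _ _ _ (fun y => \sum_r F y i r * K y r j)) => //.
  by move=> x _; rewrite mxE.
by apply: smooth_on_sum => // r _; exact: smooth_onM.
Qed.

Lemma msmooth_add m k (F K : 'rV[R]_n -> 'M[R]_(m, k)) :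
  msmooth V F -> msmooth V K -> msmooth V (fun y => F y + K y).
Proof.
move=> sF sK i j; apply: (@smooth_on_ext _ _ _ (fun y => F y i j + K y i j)) => //.
  by move=> x _; rewrite mxE.
exact: smooth_onD.
Qed.

Lemma msmooth_tr m k (F : 'rV[R]_n -> 'M[R]_(m, k)) :
  msmooth V F -> msmooth V (fun y => (F y)^T).
Proof.
move=> sF i j; apply: (@smooth_on_ext _ _ _ (fun y => F y j i)) => //.
by move=> x _; rewrite mxE.
Qed.

Lemma msmooth_scale m k f (F : 'rV[R]_n -> 'M[R]_(m, k)) :
  smooth_on V f -> msmooth V F -> msmooth V (fun y => f y *: F y).
Proof.
move=> sf sF i j; apply: (@smooth_on_ext _ _ _ (fun y => f y * F y i j)) => //.
  by move=> x _; rewrite mxE.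
exact: smooth_onM.
Qed.

Lemma msmooth_opp m k (F : 'rV[R]_n -> 'M[R]_(m, k)) :
  msmooth V F -> msmooth V (fun y => - F y).
Proof.
move=> sF i j; apply: (@smooth_on_ext _ _ _ (fun y => - F y i j)) => //.
  by move=> x _; rewrite mxE.
exact: smooth_onN.
Qed.

Lemma msmooth_pdm m k l (F : 'rV[R]_n -> 'M[R]_(m, k)) :
  msmooth V F -> msmooth V (pdm l F).
Proof.
move=> sF i j; apply: (@smooth_on_ext _ _ _ (partial l (fun y => F y i j))) => //.
  by move=> x _; rewrite pdmE.
exact: smooth_on_partial.
Qed.

Lemma msmooth_Dmx k (b : 'rV[R]_n -> 'rV[R]_k) : msmooth V b -> msmooth V (Dmx b).
Proof.
move=> sF i j; apply: (@smooth_on_ext _ _ _ (partial i (fun y => b y ord0 j))) => //.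
  by move=> x _; rewrite DmxE.
exact: smooth_on_partial.
Qed.

Lemma smooth_on_det m (F : 'rV[R]_n -> 'M[R]_m) :
  msmooth V F -> smooth_on V (fun y => \det (F y)).
Proof.
move=> sF; rewrite /determinant; apply: smooth_on_sum => // s _.
apply: smooth_onM => //; first exact: smooth_on_cst.
by apply: smooth_on_prod.
Qed.

Lemma msmooth_inv m (F : 'rV[R]_n -> 'M[R]_m) :
  (forall x, V x -> F x \in unitmx) ->
  msmooth V F -> msmooth V (fun y => invmx (F y)).
Proof.
move=> uF sF; apply: (@msmooth_ext _ _ (fun y => (\det (F y))^-1 *: \adj (F y))).
  by move=> x Vx; rewrite /invmx (uF _ Vx).
apply: msmooth_scale.
  apply: smooth_onV => //; last exact: smooth_on_det.
  by move=> x Vx; rewrite -unitfE -unitmxE uF.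
move=> i j; apply: (@smooth_on_ext _ _ _ (fun y => cofactor (F y) j i)) => //.
  by move=> x _; rewrite mxE.
apply: smooth_onM => //; first exact: smooth_on_cst.
apply: smooth_on_det => i' j'.
apply: (@smooth_on_ext _ _ _ (fun y => F y (lift j i') (lift i j'))) => //.
by move=> x _; rewrite !mxE.
Qed.

Lemma msmooth_dir m k (v : 'rV[R]_n -> 'rV[R]_n) (dF : 'I_n -> 'rV[R]_n -> 'M[R]_(m, k)) :
  msmooth V v -> (forall l, msmooth V (dF l)) ->
  msmooth V (fun y => dir (v y) (fun l => dF l y)).
Proof.
move=> sv sF i j.
apply: (@smooth_on_ext _ _ _ (fun y => \sum_l v y ord0 l * dF l y i j)) => //.
  by move=> x _; rewrite dirE.
by apply: smooth_on_sum => // l _; apply: smooth_onM => //; exact: sF.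
Qed.
End Msmooth.

(** * Contravariant Christoffel symbols *)

Section Symbols.
Variables (G H P : 'M[R]_n) (dH dP : 'I_n -> 'M[R]_n).

(** The Jacobian matrix of y |-> b *m F y for a constant covector b. *)
Definition rows_of (b : 'rV[R]_n) (dF : 'I_n -> 'M[R]_n) : 'M[R]_n :=
  \matrix_l (b *m dF l).

Lemma mul_rows_of u b dF : u *m rows_of b dF = b *m dir u dF.
Proof.
rewrite mulmx_sum_row /dir mulmx_sumr; apply: eq_bigr => l _.
by rewrite rowK -scalemxAr.
Qed.

(** The Koszul formula solved for the connection: D_b c is the derivative of c along
b *m P plus c *m symbol b. *)
Definition symbol (b : 'rV[R]_n) : 'M[R]_n :=
  2^-1 *: (dir (b *m P) dH + P *m rows_of b dH + (rows_of b dH)^T *m P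
    - H *m rows_of b dP - dir (b *m H) dP + (rows_of b dP)^T *m H) *m G.

Hypotheses (HG : H *m G = 1%:M) (GH : G *m H = 1%:M) (sG : G^T = G) (sH : H^T = H) (sP : P^T = - P)
  (sdH : forall l, (dH l)^T = dH l) (sdP : forall l, (dP l)^T = - dP l).

Lemma symbol_metric b : symbol b *m H + H *m (symbol b)^T = dir (b *m P) dH.
Proof.
have -> : H *m (symbol b)^T = (symbol b *m H)^T by rewrite [RHS]trmx_mul sH.
have -> : symbol b *m H = 2^-1 *: (dir (b *m P) dH + P *m rows_of b dH
   + (rows_of b dH)^T *m P
    - H *m rows_of b dP - dir (b *m H) dP + (rows_of b dP)^T *m H).
  by rewrite /symbol -mulmxA GH mulmx1.
have trD (X Y : 'M[R]_n) : (X + Y)^T = X^T + Y^T by exact: linearD.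
have trN (X : 'M[R]_n) : (- X)^T = - X^T by exact: linearN.
rewrite linearZ /= -scalerDr !(trD, trN) !trmx_mul !trmxK sH sP.
rewrite (dir_sym _ sdH) (dir_skew _ sdP) mulNmx mulmxN.
move: (dir (b *m P) dH) (P *m rows_of b dH) ((rows_of b dH)^T *m P)
  (H *m rows_of b dP) (dir (b *m H) dP) ((rows_of b dP)^T *m H) => A B C D E F.
by apply/matrixP => i j; rewrite !mxE; field.
Qed.

Lemma mul_rows_ofT (b c : 'rV[R]_n) dF k :
  (c *m (rows_of b dF)^T) ord0 k = (b *m dF k *m c^T) ord0 ord0.
Proof. by rewrite !mxE; apply: eq_bigr => j _; rewrite !mxE mulrC. Qed.

Lemma rows_ofT_sym b c : c *m (rows_of b dH)^T = b *m (rows_of c dH)^T.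
Proof.
apply/rowP => k; rewrite !mul_rows_ofT -[RHS]trace_mx11 -mxtrace_tr trace_mx11.
by rewrite !trmx_mul trmxK sdH mulmxA.
Qed.

Lemma rows_ofT_skew b c : c *m (rows_of b dP)^T = - (b *m (rows_of c dP)^T).
Proof.
apply/rowP => k; rewrite [RHS]mxE !mul_rows_ofT -[X in - X]trace_mx11 -mxtrace_tr trace_mx11.
by rewrite !trmx_mul trmxK sdP mulmxA mulmxN mulNmx [in RHS]mxE opprK.
Qed.

Lemma symbol_torsion b c : c *m symbol b - b *m symbol c = c *m (rows_of b dP)^T.
Proof.
have E u w : u *m symbol w = 2^-1 *: (u *m dir (w *m P) dH + w *m dir (u *m P) dH
    + u *m (rows_of w dH)^T *m P - w *m dir (u *m H) dP - u *m dir (w *m H) dP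
    + u *m (rows_of w dP)^T *m H) *m G.
  rewrite /symbol mulmxA -scalemxAr; congr (_ *: _ *m _).
  by rewrite !mulmxDr !mulmxN !mulmxA !mul_rows_of.
rewrite !E (rows_ofT_sym b c) (rows_ofT_skew c b) mulNmx -mulmxBl -scalerBr.
rewrite [X in _ *: X](_ : _ = 2 *: (c *m (rows_of b dP)^T *m H)); last first.
  move: (_ *m H) (c *m dir _ _) (b *m dir _ _) (_ *m P) (c *m dir _ _) (b *m dir _ _).
  by move=> A B C D E' F; apply/rowP => i; rewrite !mxE; ring.
by rewrite scalerA mulVf ?pnatr_eq0 // scale1r -(mulmxA _ H G) HG mulmx1.
Qed.
End Symbols.
End MatrixDerivative.

(** * Differential operators in charts *)

Section InvariantFormula.
Variables (R : realType) (n : nat) (G H P : 'M[R]_n) (dH dP : 'I_n -> 'M[R]_n).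
Hypotheses (GH : G *m H = 1%:M) (sP : P^T = - P).

(** Twice the Koszul formula, arranged so that only exterior derivatives, gradients of
scalars and Lie brackets occur: none of these depends on a choice of coordinates. *)
Lemma conn_invariant (b c : 'rV[R]_n) (Db Dc : 'M[R]_n) :
  let X := b *m P in let Y := c *m P in
  let gH := c *m H *m Db^T + c *m (rows_of b dH)^T + b *m H *m Dc^T in
  let gP := c *m P^T *m Db^T + c *m (rows_of b dP)^T + b *m P *m Dc^T in
  2 *: ((X *m Dc + c *m symbol G H P dH dP b) *m H) =
  (X *m (Dc - Dc^T) - Y *m (Db - Db^T) + gP) *m H
  + (gH + c *m H *m (Db - Db^T) + b *m H *m (Dc - Dc^T)) *m P
  + (X *m (Dc *m H + rows_of c dH) - c *m H *m (Db *m P + rows_of b dP))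
  + (Y *m (Db *m H + rows_of b dH) - b *m H *m (Dc *m P + rows_of c dP)).
Proof.
move=> X Y gH gP; rewrite /gH /gP sP.
have E : c *m symbol G H P dH dP b *m H =
   2^-1 *: (c *m dir (b *m P) dH + b *m dir (c *m P) dH
    + c *m (rows_of b dH)^T *m P - b *m dir (c *m H) dP - c *m dir (b *m H) dP
    + c *m (rows_of b dP)^T *m H).
  rewrite /symbol mulmxA -mulmxA GH mulmx1 -scalemxAr; congr (_ *: _).
  by rewrite !mulmxDr !mulmxN !mulmxA !mul_rows_of.
have S1 : X *m (Dc - Dc^T) - Y *m (Db - Db^T) + (c *m - P *m Db^T
    + c *m (rows_of b dP)^T + b *m P *m Dc^T) = X *m Dc - Y *m Db + c *m (rows_of b dP)^T.
  rewrite !mulmxBr mulmxN mulNmx -/X -/Y.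
  move: (X *m Dc) (X *m Dc^T) (Y *m Db) (Y *m Db^T) (c *m _) => r1 r2 r3 r4 r5.
  by apply/rowP => i; rewrite !mxE; ring.
have S2 : c *m H *m Db^T + c *m (rows_of b dH)^T + b *m H *m Dc^T
    + c *m H *m (Db - Db^T) + b *m H *m (Dc - Dc^T)
    = c *m H *m Db + b *m H *m Dc + c *m (rows_of b dH)^T.
  rewrite !mulmxBr.
  move: (c *m H *m Db) (c *m H *m Db^T) (b *m H *m Dc) (b *m H *m Dc^T) (c *m _)
    => r1 r2 r3 r4 r5.
  by apply/rowP => i; rewrite !mxE; ring.
rewrite S1 S2 mulmxDl E scalerDr scalerA mulfV ?pnatr_eq0 // scale1r.
rewrite !(mulmxDr X) !(mulmxDr Y) !(mulmxDr (_ *m H)) !mul_rows_of !mulmxDl mulNmx !mulmxA.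
move: (X *m Dc *m H) (Y *m Db *m H) (c *m _ *m H) (c *m H *m Db *m P)
  (b *m H *m Dc *m P) (c *m (rows_of b dH)^T *m P) (c *m dir _ dH) (b *m dir _ dH)
  (b *m dir _ dP) (c *m dir _ dP) => r1 r2 r3 r4 r5 r6 r7 r8 r9 r10.
by apply/rowP => i; rewrite !mxE; ring.
Qed.
Lemma koszul_algebra (b c : 'rV[R]_n) (Db Dc : 'M[R]_n) :
  (forall l, (dP l)^T = - dP l) ->
  b *m P *m Dc + c *m (Db *m P + rows_of b dP)^T
  - (c *m P *m Db + b *m (Dc *m P + rows_of c dP)^T)
  - (c *m P^T *m Db^T + c *m (rows_of b dP)^T + b *m P *m Dc^T)
  = b *m P *m Dc - c *m P *m Db + c *m (rows_of b dP)^T.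
Proof.
move=> sdP.
have trD (A B : 'M[R]_n) : (A + B)^T = A^T + B^T by exact: linearD.
rewrite !trD !trmx_mul !mulmxDr !mulmxA (rows_ofT_skew sdP c b) sP !mulmxN !mulNmx.
move: (b *m P *m Dc) (b *m P *m Dc^T) (c *m P *m Db) (c *m P *m Db^T) (c *m _)
  => r1 r2 r3 r4 r5.
by apply/rowP => i; rewrite !mxE; ring.
Qed.
End InvariantFormula.

(** TX and TY come from the second derivatives of the change of coordinates, whose symmetry
is the last hypothesis; they cancel in the bracket. *)
Lemma bracket_algebra (R : realType) n (X Y : 'rV[R]_n) (J DX DY DX' DY' TX TY : 'M[R]_n) :
  J *m DX' = DX *m J + TX -> J *m DY' = DY *m J + TY -> X *m TY = Y *m TX ->
  X *m J *m DY' - Y *m J *m DX' = (X *m DY - Y *m DX) *m J.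
Proof.
move=> EX EY T; rewrite -!mulmxA EX EY !mulmxDr T !mulmxA.
by rewrite opprD addrACA subrr addr0 -mulmxBl.
Qed.

(** The Lie bracket, from the values and the Jacobian matrices of two vector fields. *)
Definition bracket (R : realType) n (X Y : 'rV[R]_n) (DX DY : 'M[R]_n) : 'rV[R]_n :=
  X *m DY - Y *m DX.

Section Dictionary.
Variables (R : realType) (n : nat) (M : smooth_manifold R n).
Implicit Types (c d : chart R n M) (a b : M -> 'rV[R]_n) (X : M -> 'rV[R]_n)
  (P g : M -> 'M[R]_n) (x : 'rV[R]_n).

Lemma ext_dE c a x : ext_d c a x = Dmx (form_in c a) x - (Dmx (form_in c a) x)^T.
Proof. by apply/matrixP => i j; rewrite !mxE !DmxE. Qed.

Lemma lie_bivecE c X P x : lie_bivec c X P x =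
  lie_of (bivec_in c P x) (fun l => pdm l (bivec_in c P) x) (vec_in c X x)
    (Dmx (vec_in c X) x).
Proof.
have subE (A B : 'M[R]_n) i j : (A - B) i j = A i j - B i j by rewrite !mxE.
apply/matrixP => i j; rewrite [LHS]mxE /lie_of !subE dirE ![(_ *m _) i j]mxE.
rewrite -!sumrB; apply: eq_bigr => k _.
by rewrite [_^T _ _]mxE pdmE !DmxE; congr (_ - _ - _); exact: mulrC.
Qed.

Lemma lie_formE c X b x : lie_form c X b x =
  vec_in c X x *m Dmx (form_in c b) x + form_in c b x *m (Dmx (vec_in c X) x)^T.
Proof.
have addE (u v : 'rV[R]_n) j : (u + v) ord0 j = u ord0 j + v ord0 j by rewrite !mxE.
apply/rowP => j; rewrite [LHS]mxE addE ![(_ *m _) _ j]mxE -big_split /=.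
by apply: eq_bigr => k _; rewrite [_^T _ _]mxE !DmxE.
Qed.

Lemma grad_in_scalar c (f : M -> R) (K : 'rV[R]_n -> 'M[R]_1) x :
  (\near x, f (point c x) = K x ord0 ord0) ->
  grad_in c f x =  \row_l pdm l K x ord0 ord0.
Proof.
by move=> fK; apply/rowP => l; rewrite !mxE pdmE; exact: partial_near_eq.
Qed.

Lemma grad_bilinear (beta gamma : 'rV[R]_n -> 'rV[R]_n) (F : 'rV[R]_n -> 'M[R]_n) x :
  mdiff beta x -> mdiff gamma x -> mdiff F x ->
   \row_l pdm l (fun y => beta y *m F y *m (gamma y)^T) x ord0 ord0 =
  gamma x *m (F x)^T *m (Dmx beta x)^T
  + gamma x *m (rows_of (beta x) (fun l => pdm l F x))^T
  + beta x *m F x *m (Dmx gamma x)^T.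
Proof.
move=> db dg dF; apply/rowP => l; rewrite mxE.
rewrite pdm_mul; [|exact: mdiff_mul|exact: mdiff_tr].
have addE k (u v : 'M[R]_(1, k)) j : (u + v) ord0 j = u ord0 j + v ord0 j by rewrite !mxE.
rewrite pdm_mul // pdm_tr mulmxDl !addE; congr (_ + _ + _).
- rewrite -[LHS]trace_mx11 -mxtrace_tr trace_mx11 !trmx_mul trmxK mulmxA.
  rewrite -row_Dmx [LHS]mxE [RHS]mxE; apply: eq_bigr => j _.
  by rewrite [(row _ _)^T _ _]mxE [row _ _ _ _]mxE [(Dmx _ _)^T _ _]mxE.
- by rewrite [RHS]mul_rows_ofT.
- rewrite -row_Dmx [LHS]mxE [RHS]mxE; apply: eq_bigr => j _.
  by rewrite [(row _ _)^T _ _]mxE [row _ _ _ _]mxE [(Dmx _ _)^T _ _]mxE.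
Qed.

Section Smooth.
Variables (c : chart R n M).
Hypothesis ac : @atlas R n M c.

Lemma smooth_form_ms a : smooth_form a -> msmooth (image_of c) (form_in c a).
Proof. by move=> sa i j; rewrite (ord1 i); exact: sa. Qed.

Lemma bivector_ms P : bivector_field P -> msmooth (image_of c) (bivec_in c P).
Proof. by case=> _ sP i j; exact: sP. Qed.

Lemma metric_ms g : riemannian_metric g -> msmooth (image_of c) (metric_in c g).
Proof. by case=> _ _ sg i j; exact: sg. Qed.

Lemma bivec_in_skew P x : bivector_field P -> (bivec_in c P x)^T = - bivec_in c P x.
Proof.
case=> skP _; rewrite /bivec_in; move: (jac_to _ _) => T.
by rewrite !trmx_mul trmxK skP mulNmx mulmxN mulmxA.
Qed.

Lemma metric_in_sym g x : riemannian_metric g -> (metric_in c g x)^T = metric_in c g x.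
Proof.
case=> symg _ _; rewrite /metric_in; move: (jac_from _ _) => T.
by rewrite !trmx_mul trmxK symg mulmxA.
Qed.

Lemma posdef_unitmx (G : 'M[R]_n) :
  (forall v : 'rV[R]_n, v != 0 -> 0 < (v *m G *m v^T) ord0 ord0) -> G \in unitmx.
Proof.
move=> pos; rewrite -row_free_unit -kermx_eq0; apply/rowV0P => v /sub_kermxP vG.
by apply: contraTeq isT => /pos; rewrite vG mul0mx mxE ltxx.
Qed.

Lemma metric_unitmx g p : riemannian_metric g -> g p \in unitmx.
Proof. by case=> _ pos _; apply: posdef_unitmx; exact: pos. Qed.

Lemma metric_in_posdef g p : riemannian_metric g -> dom c p ->
  forall v : 'rV[R]_n, v != 0 -> 0 < (v *m metric_in c g (coord c p) *m v^T) ord0 ord0.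
Proof.
case=> _ pos _ cp v v0; rewrite (metric_inE g cp).
have FT := jac_inv ac (@chart_at_atlas R n M p) cp (@chart_at_dom R n M p).
move: (jac c _ p) (jac _ c p) FT => F T FT.
rewrite !mulmxA -(mulmxA _ F^T) -trmx_mul; apply: pos.
by apply: contraNneq v0 => vF; rewrite -(mulmx1 v) -FT mulmxA vF mul0mx.
Qed.

Lemma metric_in_unitmx g p : riemannian_metric g -> dom c p ->
  metric_in c g (coord c p) \in unitmx.
Proof. by move=> hg cp; apply: posdef_unitmx; exact: metric_in_posdef. Qed.

Lemma cometric_ms g : riemannian_metric g ->
  msmooth (image_of c) (fun x => invmx (metric_in c g x)).
Proof.
move=> hg; apply: msmooth_inv; [exact: image_of_open| |exact: metric_ms].
by move=> _ [p cp <-]; exact: metric_in_unitmx.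
Qed.

Lemma cometric_sym g x : riemannian_metric g ->
  (invmx (metric_in c g x))^T = invmx (metric_in c g x).
Proof. by move=> hg; rewrite trmx_inv metric_in_sym. Qed.

Lemma near_image p (Q : 'rV[R]_n -> Prop) : dom c p ->
  (forall q, dom c q -> Q (coord c q)) -> \forall y \near coord c p, Q y.
Proof.
move=> cp H.
have := open_nbhs_nbhs (conj (@image_of_open _ _ _ c) (image_of_coord cp)).
by apply: filterS => _ [q cq <-]; exact: H.
Qed.

Lemma Dmx_anchor P a p : dom c p -> mdiff (form_in c a) (coord c p) ->
  mdiff (bivec_in c P) (coord c p) ->
  Dmx (vec_in c (anchor P a)) (coord c p) =
  Dmx (form_in c a) (coord c p) *m bivec_in c P (coord c p)
  + rows_of (form_in c a (coord c p)) (fun l => pdm l (bivec_in c P) (coord c p)).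
Proof.
move=> cp da dP.
rewrite -[rows_of _ _]/(\matrix_l (_ *m _)) -Dmx_mul //.
by apply: Dmx_near_eq; apply: near_image => // q cq; exact: vec_in_anchor.
Qed.

Lemma Dmx_sharp g a p : (forall q, g q \in unitmx) ->
  dom c p -> mdiff (form_in c a) (coord c p) ->
  mdiff (fun x => invmx (metric_in c g x)) (coord c p) ->
  Dmx (vec_in c (sharp g a)) (coord c p) =
  Dmx (form_in c a) (coord c p) *m invmx (metric_in c g (coord c p))
  + rows_of (form_in c a (coord c p))
      (fun l => pdm l (fun x => invmx (metric_in c g x)) (coord c p)).
Proof.
move=> ug cp da dH.
rewrite -[rows_of _ _]/(\matrix_l (_ *m _)) -Dmx_mul //.
by apply: Dmx_near_eq; apply: near_image => // q cq; exact: vec_in_sharp.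
Qed.

Lemma grad_in_form_prod g a b p : (forall q, g q \in unitmx) ->
  dom c p -> mdiff (form_in c a) (coord c p) -> mdiff (form_in c b) (coord c p) ->
  mdiff (fun x => invmx (metric_in c g x)) (coord c p) ->
  let x := coord c p in let H := fun x => invmx (metric_in c g x) in
  grad_in c (form_prod g a b) x =
  form_in c b x *m (H x)^T *m (Dmx (form_in c a) x)^T
  + form_in c b x *m (rows_of (form_in c a x) (fun l => pdm l H x))^T
  + form_in c a x *m H x *m (Dmx (form_in c b) x)^T.
Proof.
move=> ug cp da db dH x H; rewrite -grad_bilinear //; apply: grad_in_scalar.
apply: near_image => // q cq; rewrite coordK //; exact: form_prod_in.
Qed.

Lemma grad_in_bivec_eval P a b p :
  dom c p -> mdiff (form_in c a) (coord c p) -> mdiff (form_in c b) (coord c p) ->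
  mdiff (bivec_in c P) (coord c p) ->
  let x := coord c p in
  grad_in c (bivec_eval P a b) x =
  form_in c b x *m (bivec_in c P x)^T *m (Dmx (form_in c a) x)^T
  + form_in c b x *m (rows_of (form_in c a x) (fun l => pdm l (bivec_in c P) x))^T
  + form_in c a x *m bivec_in c P x *m (Dmx (form_in c b) x)^T.
Proof.
move=> cp da db dH x; rewrite -grad_bilinear //; apply: grad_in_scalar.
apply: near_image => // q cq; rewrite coordK //; exact: bivec_eval_in.
Qed.

Lemma diff_scalar (f : M -> R) (K : 'rV[R]_n -> 'M[R]_1) p : dom c p ->
  (forall q, dom c q -> f q = K (coord c q) ord0 ord0) ->
  mdiff K (coord c p) -> differentiable (f \o point c) (coord c p).
Proof.
move=> cp fK dK; apply: differentiable_near_eq (dK ord0 ord0).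
by apply: near_image => // q cq; rewrite /= coordK // fK.
Qed.

Lemma diff_form_prod g a b p : (forall q, g q \in unitmx) ->
  dom c p -> mdiff (form_in c a) (coord c p) -> mdiff (form_in c b) (coord c p) ->
  mdiff (fun x => invmx (metric_in c g x)) (coord c p) ->
  differentiable (form_prod g a b \o point c) (coord c p).
Proof.
move=> ug cp da db dH; apply: (@diff_scalar _ (fun x =>
  form_in c a x *m invmx (metric_in c g x) *m (form_in c b x)^T)) => //.
  by move=> q cq; exact: form_prod_in.
by apply: mdiff_mul; [exact: mdiff_mul|exact: mdiff_tr].
Qed.

Lemma diff_bivec_eval P a b p :
  dom c p -> mdiff (form_in c a) (coord c p) -> mdiff (form_in c b) (coord c p) ->
  mdiff (bivec_in c P) (coord c p) ->
  differentiable (bivec_eval P a b \o point c) (coord c p).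
Proof.
move=> cp da db dH; apply: (@diff_scalar _ (fun x =>
  form_in c a x *m bivec_in c P x *m (form_in c b x)^T)) => //.
  by move=> q cq; exact: bivec_eval_in.
by apply: mdiff_mul; [exact: mdiff_mul|exact: mdiff_tr].
Qed.

Lemma koszulE P a b p : bivector_field P -> dom c p ->
  mdiff (form_in c a) (coord c p) -> mdiff (form_in c b) (coord c p) ->
  mdiff (bivec_in c P) (coord c p) ->
  let x := coord c p in let Px := bivec_in c P x in
  let dP := fun l => pdm l (bivec_in c P) x in
  koszul c P a b x =
  form_in c a x *m Px *m Dmx (form_in c b) x - form_in c b x *m Px *m Dmx (form_in c a) x
  + form_in c b x *m (rows_of (form_in c a x) dP)^T.
Proof.
move=> hP cp da db dP x Px dPx; rewrite /koszul !lie_formE.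
rewrite (form_in_differential ac cp); last exact: diff_bivec_eval.
rewrite grad_in_bivec_eval // !Dmx_anchor // !vec_in_anchor //.
apply: koszul_algebra; first exact: bivec_in_skew.
move=> l; rewrite -pdm_tr -pdm_opp //; apply: pdm_near_eq.
by near=> y; exact: bivec_in_skew.
Unshelve. all: by end_near. Qed.
End Smooth.

(** * Transformation of first derivatives *)

Section Covariance.
Variables (c d : chart R n M) (p : M).
Hypotheses (ac : @atlas R n M c) (ad : @atlas R n M d) (cp : dom c p) (dp : dom d p).
Let x := coord c p.
Let J := jac c d p.
Let tau m := fun y => transition c d y ord0 m.

Lemma near_overlap (Q : 'rV[R]_n -> Prop) :
  (forall q, dom c q -> dom d q -> Q (coord c q)) -> \forall y \near coord c p, Q y.
Proof.
move=> H; have := near_point cp (open_nbhs_nbhs (conj (@dom_open _ _ _ d) dp)).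
by apply: filterS => y [_ cy yE dy]; have := H _ cy dy; rewrite yE.
Qed.

Lemma tau_partial_diff i m : differentiable (partial i (tau m)) x.
Proof. by apply: (transition_smooth m ac ad [:: i]); exists p. Qed.

Lemma tau_partialC i j m : partial i (partial j (tau m)) x = partial j (partial i (tau m)) x.
Proof.
apply: (@smooth_partialC _ _ (coord c @` (dom c `&` dom d))).
- exact: overlap_open.
- exact: transition_smooth.
- by exists p.
Qed.

(** The inhomogeneous term in the transformation of the Jacobian matrix of a form. It is
symmetric, which is why the exterior derivative is a tensor. *)
Definition hess (w : 'rV[R]_n) : 'M[R]_n :=
  \matrix_(k, j) \sum_m w ord0 m * partial k (partial j (tau m)) x.

Lemma hess_sym w : (hess w)^T = hess w.
Proof.
apply/matrixP => k j; rewrite [LHS]mxE /hess [LHS]mxE [RHS]mxE.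
by apply: eq_bigr => m _; rewrite (tau_partialC j k).
Qed.

Lemma Dmx_form_change b : mdiff (form_in d b) (coord d p) ->
  Dmx (form_in c b) x = J *m Dmx (form_in d b) (coord d p) *m J^T
    + hess (form_in d b (coord d p)).
Proof.
move=> db; apply/matrixP => k j; rewrite DmxE.
rewrite (@partial_near_eq _ _ _ _ (fun y => \sum_m
   ((fun z => form_in d b z ord0 m) \o transition c d) y * partial j (tau m) y)); last first.
  apply: near_overlap => q cq dq; rewrite (form_in_change ac ad cq dq) mxE.
  apply: eq_bigr => m _; rewrite [_^T _ _]mxE -(jac_entry j m ac ad cq dq) /=.
  by rewrite (transition_coord d cq).
have dbt m : differentiable ((fun z => form_in d b z ord0 m) \o transition c d) x.
  apply: differentiable_comp; first exact: transition_diff.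
  by rewrite (transition_coord d cp); exact: db.
rewrite partial_sum; last first.
  by move=> m _; apply: differentiableM; [exact: dbt|exact: tau_partial_diff].
have addE (A B : 'M[R]_n) i l : (A + B) i l = A i l + B i l by rewrite !mxE.
rewrite addE [X in _ + X]mxE [(_ *m J^T) _ _]mxE -big_split /=.
apply: eq_bigr => m _.
apply: etrans (partialM k (dbt m) (tau_partial_diff j m)) _.
apply: (congr2 (fun u v => u + v)); apply: (congr2 (fun u v => u * v)).
- apply: etrans (partial_transition k ac ad cp dp (db ord0 m)) _.
  by rewrite [RHS]mxE; apply: eq_bigr => l _; rewrite DmxE.
- by rewrite [RHS]mxE; exact: jac_entry.
- by rewrite /= (transition_coord d cp).
- exact: erefl.
Qed.

(** The same term for vector fields. *)
Definition hess_vec (X : 'rV[R]_n) : 'M[R]_n :=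
  \matrix_(k, m) \sum_i X ord0 i * partial k (partial i (tau m)) x.

Lemma hess_vecC (X Y : 'rV[R]_n) : X *m hess_vec Y = Y *m hess_vec X.
Proof.
apply/rowP => m; rewrite [LHS]mxE [RHS]mxE.
transitivity (\sum_k \sum_i X ord0 k * (Y ord0 i * partial k (partial i (tau m)) x)).
  by apply: eq_bigr => k _; rewrite [hess_vec _ _ _]mxE mulr_sumr.
rewrite exchange_big /=; apply: eq_bigr => i _.
rewrite [hess_vec _ _ _]mxE mulr_sumr; apply: eq_bigr => k _.
by rewrite mulrCA (tau_partialC i k).
Qed.

Lemma Dmx_vec_change X : mdiff (vec_in d X) (coord d p) -> mdiff (vec_in c X) x ->
  J *m Dmx (vec_in d X) (coord d p) = Dmx (vec_in c X) x *m J + hess_vec (vec_in c X x).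
Proof.
move=> dX cX; apply/matrixP => k m.
have addE (A B : 'M[R]_n) i l : (A + B) i l = A i l + B i l by rewrite !mxE.
transitivity (partial k ((fun z => vec_in d X z ord0 m) \o transition c d) x).
  rewrite (partial_transition k ac ad cp dp); last exact: dX.
  by rewrite mxE; apply: eq_bigr => l _; rewrite DmxE.
rewrite (@partial_near_eq _ _ _ _ (fun y => \sum_i
   vec_in c X y ord0 i * partial i (tau m) y)); last first.
  apply: near_overlap => q cq dq; rewrite /= (transition_coord d cq).
  rewrite (vec_in_change ac ad cq dq) mxE.
  by apply: eq_bigr => i _; rewrite -(jac_entry i m ac ad cq dq).
rewrite partial_sum; last first.
  by move=> i _; apply: differentiableM; [exact: cX|exact: tau_partial_diff].
rewrite addE [X in _ + X]mxE [(_ *m J) _ _]mxE -big_split /=.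
apply: eq_bigr => i _.
apply: etrans (partialM k (cX ord0 i) (tau_partial_diff i m)) _.
apply: (congr2 (fun u v => u + v)); apply: (congr2 (fun u v => u * v)); try exact: erefl.
- by rewrite DmxE.
- exact: jac_entry.
Qed.

Lemma bracket_change X Y : mdiff (vec_in d X) (coord d p) -> mdiff (vec_in c X) x ->
  mdiff (vec_in d Y) (coord d p) -> mdiff (vec_in c Y) x ->
  bracket (vec_in d X (coord d p)) (vec_in d Y (coord d p))
    (Dmx (vec_in d X) (coord d p)) (Dmx (vec_in d Y) (coord d p)) =
  bracket (vec_in c X x) (vec_in c Y x) (Dmx (vec_in c X) x) (Dmx (vec_in c Y) x) *m J.
Proof.
move=> dX cX dY cY; rewrite /bracket !(vec_in_change ac ad cp dp) -/x -/J.
exact: bracket_algebra (Dmx_vec_change dX cX) (Dmx_vec_change dY cY) (hess_vecC _ _).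
Qed.
End Covariance.
End Dictionary.

(** * Existence of the metric contravariant connection *)

Lemma conn_change_algebra (R : realType) n (J Gc Hc Hd Pc Pd Wac Wbc Wad Wbd : 'M[R]_n)
  (conc cond Xc Yc Xd Yd Ac Bc Ad Bd gPc gPd gHc gHd br1c br2c br1d br2d : 'rV[R]_n) :
  J \in unitmx -> Hc *m Gc = 1%:M -> Hd = J^T *m Hc *m J -> Pd = J^T *m Pc *m J ->
  Wac = J *m Wad *m J^T -> Wbc = J *m Wbd *m J^T ->
  Xd = Xc *m J -> Yd = Yc *m J -> Ad = Ac *m J -> Bd = Bc *m J ->
  gPc = gPd *m J^T -> gHc = gHd *m J^T -> br1d = br1c *m J -> br2d = br2c *m J ->
  2 *: (conc *m Hc) = (Xc *m Wbc - Yc *m Wac + gPc) *m Hc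
    + (gHc + Bc *m Wac + Ac *m Wbc) *m Pc + br1c + br2c ->
  2 *: (cond *m Hd) = (Xd *m Wbd - Yd *m Wad + gPd) *m Hd
    + (gHd + Bd *m Wad + Ad *m Wbd) *m Pd + br1d + br2d ->
  conc = cond *m J^T.
Proof.
move=> uJ HG -> -> -> -> -> -> -> -> -> -> -> -> Ec Ed.
have E : 2 *: (conc *m Hc *m J) = 2 *: (cond *m (J^T *m Hc *m J)).
  rewrite Ed scalemxAl Ec !(mulmxDl, mulmxDr, mulNmx, mulmxA).
  by [].
move/(congr1 (fun v => 2^-1 *: v *m invmx J *m Gc)): E.
rewrite !scalerA mulVf ?pnatr_eq0 // !scale1r !mulmxA !mulmxK //.
by rewrite -!(mulmxA _ Hc) HG !mulmx1.
Qed.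

(** The common core of D g = 0, where F is the inverse metric, and of D P = 0, where F is
the bivector. *)
Lemma pairing_derivative (R : realType) n (F N Db Dc : 'M[R]_n) (X b c : 'rV[R]_n)
    (dF : 'I_n -> 'M[R]_n) :
  N *m F + F *m N^T = dir X dF ->
  (X *m (c *m F^T *m Db^T + c *m (rows_of b dF)^T + b *m F *m Dc^T)^T) ord0 ord0 =
  ((X *m Db + b *m N) *m F *m c^T) ord0 ord0
  + (b *m F *m (X *m Dc + c *m N)^T) ord0 ord0.
Proof.
move=> met.
have trD k l (A B : 'M[R]_(k, l)) : (A + B)^T = A^T + B^T by exact: linearD.
have addE (u v : 'M[R]_1) : (u + v) ord0 ord0 = u ord0 ord0 + v ord0 ord0 by rewrite mxE.
have tr11 (u : 'M[R]_1) : u^T ord0 ord0 = u ord0 ord0 by rewrite mxE.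
rewrite !trD !trmx_mul !trmxK !mulmxDr !mulmxDl !mulmxA !addE mul_rows_of -met.
rewrite mulmxDr mulmxDl !addE !mulmxA.
have -> : (X *m Dc *m F^T *m b^T) ord0 ord0 = (b *m F *m Dc^T *m X^T) ord0 ord0.
  by rewrite -tr11 !trmx_mul !trmxK !mulmxA.
by ring.
Qed.

Section SymbolLinear.
Variables (R : realType) (n : nat) (G H P : 'M[R]_n) (dH dP : 'I_n -> 'M[R]_n).

Lemma dir_linear m k (r : R) (u v : 'rV[R]_n) (dF : 'I_n -> 'M[R]_(m, k)) :
  dir (r *: u + v) dF = r *: dir u dF + dir v dF.
Proof.
rewrite /dir scaler_sumr -big_split; apply: eq_bigr => l _ /=.
by rewrite !mxE scalerDl scalerA.
Qed.

Lemma rows_of_linear (r : R) (u v : 'rV[R]_n) (dF : 'I_n -> 'M[R]_n) :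
  rows_of (r *: u + v) dF = r *: rows_of u dF + rows_of v dF.
Proof. by apply/row_matrixP => l; rewrite linearD linearZ /= !rowK mulmxDl -scalemxAl. Qed.

Lemma symbol_linear (r : R) (u v : 'rV[R]_n) :
  symbol G H P dH dP (r *: u + v) = r *: symbol G H P dH dP u + symbol G H P dH dP v.
Proof.
have mL k l (A B : 'M[R]_(k, n)) (C : 'M[R]_(n, l)) :
  (r *: A + B) *m C = r *: (A *m C) + B *m C by rewrite mulmxDl -scalemxAl.
have mR k l (A B : 'M[R]_(n, l)) (C : 'M[R]_(k, n)) :
  C *m (r *: A + B) = r *: (C *m A) + C *m B by rewrite mulmxDr -scalemxAr.
have trL (A B : 'M[R]_n) : (r *: A + B)^T = r *: A^T + B^T by exact: linearP.
rewrite /symbol !rows_of_linear !mL !mR !trL !mL !dir_linear.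
move: (dir (u *m P) dH) (dir (v *m P) dH) (P *m rows_of u dH) (P *m rows_of v dH)
  ((rows_of u dH)^T *m P) ((rows_of v dH)^T *m P)
  (H *m rows_of u dP) (H *m rows_of v dP) (dir (u *m H) dP) (dir (v *m H) dP)
  ((rows_of u dP)^T *m H) ((rows_of v dP)^T *m H) => A A' B B' C C' D D' E E' F F'.
rewrite scalemxAl -mulmxDl; congr (_ *m _).
by apply/matrixP => i j; rewrite !mxE; ring.
Qed.
End SymbolLinear.

Lemma msmooth_rows_of (R : realType) n (V : set 'rV[R]_n) (b : 'rV[R]_n -> 'rV[R]_n)
    (dF : 'I_n -> 'rV[R]_n -> 'M[R]_n) : open V -> msmooth V b ->
  (forall l, msmooth V (dF l)) -> msmooth V (fun y => rows_of (b y) (fun l => dF l y)).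
Proof.
move=> oV sb sF i j; apply: (@smooth_on_ext _ _ _ (fun y => (b y *m dF i y) ord0 j)) => //.
  by move=> x _; rewrite [RHS]mxE.
exact: msmooth_mul.
Qed.

Lemma Dmx_scale_add (R : realType) n k (f : 'rV[R]_n -> R) (b b' : 'rV[R]_n -> 'rV[R]_k) x :
  differentiable f x -> mdiff b x -> mdiff b' x ->
  Dmx (fun y => f y *: b y + b' y) x =
  f x *: Dmx b x + Dmx b' x + (\row_l partial l f x)^T *m b x.
Proof.
move=> df db db'; apply/matrixP => l j; rewrite DmxE.
rewrite (@partial_near_eq _ _ _ _ (fun y => f y * b y ord0 j + b' y ord0 j)); last first.
  by near=> y; rewrite !mxE.
apply: etrans (partialD l (differentiableM df (db ord0 j)) (db' ord0 j)) _.
rewrite (partialM l df (db ord0 j)).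
have addE (A B : 'M[R]_(n, k)) i m : (A + B) i m = A i m + B i m by rewrite !mxE.
have scE a (A : 'M[R]_(n, k)) i m : (a *: A) i m = a * A i m by rewrite !mxE.
rewrite !addE scE [(_^T *m _) _ _]mxE big_ord1 [_^T _ _]mxE [(\row_ _ _) _ _]mxE.
by rewrite !DmxE; ring.
Unshelve. all: by end_near. Qed.

Section Connection.
Variables (R : realType) (n : nat) (M : smooth_manifold R n).
Variables (g P : M -> 'M[R]_n).
Hypotheses (hg : riemannian_metric g) (hP : bivector_field P).
Implicit Types (c d : chart R n M) (a b : M -> 'rV[R]_n).

Definition cometric_in c := fun x : 'rV[R]_n => invmx (metric_in c g x).

Definition symbol_in c x (b : 'rV[R]_n) : 'M[R]_n :=
  symbol (metric_in c g x) (cometric_in c x) (bivec_in c P x)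
    (fun l => pdm l (cometric_in c) x) (fun l => pdm l (bivec_in c P) x) b.

Definition conn_in c a b (x : 'rV[R]_n) : 'rV[R]_n :=
  form_in c a x *m bivec_in c P x *m Dmx (form_in c b) x
  + form_in c b x *m symbol_in c x (form_in c a x).

Let ug q : g q \in unitmx := metric_unitmx q hg.

Section At.
Variables (c : chart R n M) (p : M).
Hypotheses (ac : @atlas R n M c) (cp : dom c p).
Let x := coord c p.
Let Vx : image_of c x := image_of_coord cp.

Lemma form_mdiff a : smooth_form a -> mdiff (form_in c a) x.
Proof. by move=> sa; apply: msmooth_diff (smooth_form_ms ac sa) Vx. Qed.
Lemma bivec_mdiff : mdiff (bivec_in c P) x.
Proof. by apply: msmooth_diff (bivector_ms ac hP) Vx. Qed.
Lemma cometric_mdiff : mdiff (cometric_in c) x.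
Proof. by apply: msmooth_diff (cometric_ms ac hg) Vx. Qed.
Lemma metric_mdiff : mdiff (metric_in c g) x.
Proof. by apply: msmooth_diff (metric_ms ac hg) Vx. Qed.

Lemma metricK : metric_in c g x *m cometric_in c x = 1%:M.
Proof. by rewrite mulmxV // (metric_in_unitmx ac hg cp). Qed.
Lemma cometricK : cometric_in c x *m metric_in c g x = 1%:M.
Proof. by rewrite mulVmx // (metric_in_unitmx ac hg cp). Qed.

Lemma pdm_bivec_skew l : (pdm l (bivec_in c P) x)^T = - pdm l (bivec_in c P) x.
Proof.
rewrite -pdm_tr -pdm_opp; last exact: bivec_mdiff.
by apply: pdm_near_eq; near=> y; exact: bivec_in_skew.
Unshelve. all: by end_near. Qed.

Lemma pdm_cometric_sym l : (pdm l (cometric_in c) x)^T = pdm l (cometric_in c) x.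
Proof.
rewrite -pdm_tr; apply: pdm_near_eq; near=> y; exact: cometric_sym.
Unshelve. all: by end_near. Qed.

Lemma anchor_mdiff a : smooth_form a -> mdiff (vec_in c (anchor P a)) x.
Proof.
move=> sa.
apply: (@mdiff_near_eq _ _ _ _ (fun y => form_in c a y *m bivec_in c P y)).
  by apply: near_image => // q cq; rewrite (vec_in_anchor ac cq).
by apply: mdiff_mul; [exact: form_mdiff|exact: bivec_mdiff].
Qed.

Lemma sharp_mdiff a : smooth_form a -> mdiff (vec_in c (sharp g a)) x.
Proof.
move=> sa.
apply: (@mdiff_near_eq _ _ _ _ (fun y => form_in c a y *m cometric_in c y)).
  by apply: near_image => // q cq; rewrite (vec_in_sharp ac cq).
by apply: mdiff_mul; [exact: form_mdiff|exact: cometric_mdiff].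
Qed.

(** Each term on the right transforms as a tensor, hence so does the left-hand side. *)
Lemma conn_in_invariant a b : smooth_form a -> smooth_form b ->
  2 *: (conn_in c a b x *m cometric_in c x) =
  (vec_in c (anchor P a) x *m ext_d c b x - vec_in c (anchor P b) x *m ext_d c a x
     + grad_in c (bivec_eval P a b) x) *m cometric_in c x
  + (grad_in c (form_prod g a b) x + vec_in c (sharp g b) x *m ext_d c a x
     + vec_in c (sharp g a) x *m ext_d c b x) *m bivec_in c P x
  + bracket (vec_in c (anchor P a) x) (vec_in c (sharp g b) x)
      (Dmx (vec_in c (anchor P a)) x) (Dmx (vec_in c (sharp g b)) x)
  + bracket (vec_in c (anchor P b) x) (vec_in c (sharp g a) x)
      (Dmx (vec_in c (anchor P b)) x) (Dmx (vec_in c (sharp g a)) x).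
Proof.
move=> sa sb.
have da := form_mdiff sa; have db := form_mdiff sb.
rewrite !ext_dE (vec_in_anchor ac cp) (vec_in_anchor ac cp).
rewrite (vec_in_sharp ac cp _ (ug p)) (vec_in_sharp ac cp _ (ug p)).
rewrite (grad_in_form_prod ac ug cp da db cometric_mdiff).
rewrite (grad_in_bivec_eval ac cp da db bivec_mdiff).
rewrite (Dmx_anchor ac cp da bivec_mdiff) (Dmx_anchor ac cp db bivec_mdiff).
rewrite (Dmx_sharp ac ug cp da cometric_mdiff) (Dmx_sharp ac ug cp db cometric_mdiff).
rewrite (cometric_sym c x hg).
rewrite /bracket.
exact: (conn_invariant (fun l => pdm l (cometric_in c) x)
  (fun l => pdm l (bivec_in c P) x) metricK (bivec_in_skew c x hP)
  (form_in c a x) (form_in c b x)).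
Qed.
End At.

Lemma ext_d_change_algebra (Wc Wd Dc Dd J S : 'M[R]_n) :
  Wc = Dc - Dc^T -> Wd = Dd - Dd^T -> Dc = J *m Dd *m J^T + S -> S^T = S ->
  Wc = J *m Wd *m J^T.
Proof.
move=> -> -> -> sS.
have trD (A B : 'M[R]_n) : (A + B)^T = A^T + B^T by exact: linearD.
rewrite trD sS !trmx_mul trmxK mulmxBr mulmxBl !mulmxA.
by rewrite opprD addrACA subrr addr0.
Qed.

Lemma ext_d_change c d p a : @atlas R n M c -> @atlas R n M d -> dom c p -> dom d p ->
  mdiff (form_in d a) (coord d p) ->
  ext_d c a (coord c p) = jac c d p *m ext_d d a (coord d p) *m (jac c d p)^T.
Proof.
move=> ac ad cp dp da.
exact: (ext_d_change_algebra (ext_dE c a _) (ext_dE d a _)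
  (Dmx_form_change ac ad cp dp da) (hess_sym ac ad cp dp _)).
Qed.

Lemma grad_in_change c d p f : @atlas R n M c -> @atlas R n M d -> dom c p -> dom d p ->
  differentiable (f \o point c) (coord c p) -> differentiable (f \o point d) (coord d p) ->
  grad_in c f (coord c p) = grad_in d f (coord d p) *m (jac c d p)^T.
Proof.
move=> ac ad cp dp df df'; rewrite -(form_in_differential ac cp df).
by rewrite -(form_in_differential ad dp df') (form_in_change ac ad cp dp).
Qed.

Lemma conn_in_change c d p a b : @atlas R n M c -> @atlas R n M d -> dom c p -> dom d p ->
  smooth_form a -> smooth_form b ->
  conn_in c a b (coord c p) = conn_in d a b (coord d p) *m (jac c d p)^T.
Proof.
move=> ac ad cp dp sa sb.
have dac := form_mdiff ac cp sa; have dbc := form_mdiff ac cp sb.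
have dad := form_mdiff ad dp sa; have dbd := form_mdiff ad dp sb.
have JK := jac_inv ac ad cp dp.
have [uJ _] := mulmx1_unit JK.
apply: (conn_change_algebra uJ (cometricK ac cp) _ (bivec_in_change ac ad cp dp P)
  (ext_d_change ac ad cp dp dad) (ext_d_change ac ad cp dp dbd)
  (vec_in_change ac ad cp dp (anchor P a)) (vec_in_change ac ad cp dp (anchor P b))
  (vec_in_change ac ad cp dp (sharp g a)) (vec_in_change ac ad cp dp (sharp g b))
  _ _ _ _ (conn_in_invariant ac cp sa sb) (conn_in_invariant ad dp sa sb)).
- have Ec : cometric_in c (coord c p) = _ := invmx_metric_in ac cp (ug p).
  have Ed : cometric_in d (coord d p) = _ := invmx_metric_in ad dp (ug p).
  rewrite Ed Ec (jac_comp (@chart_at_atlas R n M p) ac ad (@chart_at_dom R n M p) cp dp).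
  move: (jac _ c p) (jac c d p) (invmx _) => J1 J2 H0.
  by rewrite trmx_mul !mulmxA.
- apply: grad_in_change => //.
    exact: diff_bivec_eval (bivec_mdiff ac cp).
  exact: diff_bivec_eval (bivec_mdiff ad dp).
- apply: grad_in_change => //.
    exact: diff_form_prod (cometric_mdiff ac cp).
  exact: diff_form_prod (cometric_mdiff ad dp).
- apply: bracket_change => //; by [exact: anchor_mdiff|exact: sharp_mdiff].
- apply: bracket_change => //; by [exact: anchor_mdiff|exact: sharp_mdiff].
Qed.

Definition connection a b : M -> 'rV[R]_n :=
  fun p => conn_in (chart_at p) a b (coord (chart_at p) p).

Lemma form_in_connection c a b p : @atlas R n M c -> dom c p ->
  smooth_form a -> smooth_form b ->
  form_in c (connection a b) (coord c p) = conn_in c a b (coord c p).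
Proof.
move=> ac cp sa sb; rewrite (form_inE _ cp).
rewrite (conn_in_change ac (@chart_at_atlas R n M p) cp (@chart_at_dom R n M p) sa sb).
by [].
Qed.

Lemma symbol_in_ms c a : @atlas R n M c -> smooth_form a ->
  msmooth (image_of c) (fun x => symbol_in c x (form_in c a x)).
Proof.
move=> ac sa; have oV := @image_of_open _ _ _ c.
have sA := smooth_form_ms ac sa; have sP := bivector_ms ac hP.
have sH : msmooth (image_of c) (cometric_in c) := cometric_ms ac hg.
have sdH l := msmooth_pdm oV l sH; have sdP l := msmooth_pdm oV l sP.
have sEH := msmooth_rows_of oV sA sdH; have sEP := msmooth_rows_of oV sA sdP.
apply: (msmooth_mul oV) (metric_ms ac hg).
apply: (msmooth_scale oV); first exact: smooth_on_cst.
apply: (msmooth_add oV); last exact: (msmooth_mul oV (msmooth_tr oV sEP) sH).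
apply: (msmooth_add oV); last first.
  exact: (msmooth_opp oV (msmooth_dir oV (msmooth_mul oV sA sH) sdP)).
apply: (msmooth_add oV); last exact: (msmooth_opp oV (msmooth_mul oV sH sEP)).
apply: (msmooth_add oV); last exact: (msmooth_mul oV (msmooth_tr oV sEH) sP).
apply: (msmooth_add oV); last exact: (msmooth_mul oV sP sEH).
exact: (msmooth_dir oV (msmooth_mul oV sA sP) sdH).
Qed.

Lemma smooth_connection a b : smooth_form a -> smooth_form b -> smooth_form (connection a b).
Proof.
move=> sa sb c ac i; have oV := @image_of_open _ _ _ c.
have sA := smooth_form_ms ac sa; have sB := smooth_form_ms ac sb.
have sP := bivector_ms ac hP.
have S : msmooth (image_of c) (conn_in c a b).
  apply: (msmooth_add oV).
    exact: (msmooth_mul oV (msmooth_mul oV sA sP) (msmooth_Dmx oV sB)).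
  exact: (msmooth_mul oV sB (symbol_in_ms ac sa)).
apply: smooth_on_ext (S ord0 i) => //.
by move=> _ [p cp <-]; rewrite form_in_connection.
Qed.

Lemma smooth_fun_diff c f p : @atlas R n M c -> dom c p -> smooth_fun_on [set: M] f ->
  differentiable (f \o point c) (coord c p).
Proof. by move=> ac cp sf; apply: (sf c ac [::]); exists p. Qed.

Lemma connectionE a b p : let c := chart_at p in let x := coord c p in
  connection a b p = a p *m bivec_in c P x *m Dmx (form_in c b) x + b p *m symbol_in c x (a p).
Proof. by rewrite /connection /conn_in !form_in_chart_at. Qed.

Section Pointwise.
Variable p : M.
Let c := chart_at p.
Let x := coord c p.
Let ac : @atlas R n M c := @chart_at_atlas R n M p.
Let cp : dom c p := @chart_at_dom R n M p.

Lemma Dmx_form_lin f b b' : smooth_fun_on [set: M] f -> smooth_form b -> smooth_form b' ->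
  Dmx (form_in c (fun q => f q *: b q + b' q)) x =
  f p *: Dmx (form_in c b) x + Dmx (form_in c b') x + (grad_in c f x)^T *m b p.
Proof.
move=> sf sb sb'.
rewrite (@Dmx_near_eq _ _ _ _ (fun y => (f \o point c) y *: form_in c b y + form_in c b' y)).
  rewrite (Dmx_scale_add (smooth_fun_diff ac cp sf) (form_mdiff ac cp sb) (form_mdiff ac cp sb')).
  by rewrite /= (coordK cp) form_in_chart_at.
by near=> y; rewrite /form_in mulmxDl -scalemxAl.
Unshelve. all: by end_near. Qed.

Lemma act_form_prod a b b' : smooth_form a -> smooth_form b -> smooth_form b' ->
  act (anchor P a) (form_prod g b b') p =
  form_prod g (connection a b) b' p + form_prod g b (connection a b') p.
Proof.
move=> sa sb sb'.
have [db db'] := (form_mdiff ac cp sb, form_mdiff ac cp sb').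
have dH := cometric_mdiff ac cp.
rewrite (act_in ac cp _ (diff_form_prod ac ug cp db db' dH)).
rewrite (grad_in_form_prod ac ug cp db db' dH) (vec_in_anchor ac cp).
rewrite (form_prod_in ac cp (connection a b) b' (ug p)).
rewrite (form_prod_in ac cp b (connection a b') (ug p)) !form_in_chart_at.
rewrite !connectionE -/c -/x; apply: pairing_derivative.
apply: symbol_metric; first exact: (metricK ac cp).
- exact: cometric_sym.
- exact: bivec_in_skew.
- exact: pdm_cometric_sym.
- exact: (pdm_bivec_skew ac cp).
Qed.

Lemma act_bivec_eval a b b' : smooth_form a -> smooth_form b -> smooth_form b' ->
  symbol_in c x (a p) *m bivec_in c P x + bivec_in c P x *m (symbol_in c x (a p))^T =
    dir (a p *m bivec_in c P x) (fun l => pdm l (bivec_in c P) x) ->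
  act (anchor P a) (bivec_eval P b b') p =
  bivec_eval P (connection a b) b' p + bivec_eval P b (connection a b') p.
Proof.
move=> sa sb sb' par.
have [db db'] := (form_mdiff ac cp sb, form_mdiff ac cp sb').
have dP := bivec_mdiff ac cp.
rewrite (act_in ac cp _ (diff_bivec_eval ac cp db db' dP)).
rewrite (grad_in_bivec_eval ac cp db db' dP) (vec_in_anchor ac cp).
rewrite (bivec_eval_in ac cp P (connection a b) b').
rewrite (bivec_eval_in ac cp P b (connection a b')) !form_in_chart_at.
rewrite !connectionE -/c -/x; exact: pairing_derivative.
Qed.
End Pointwise.

Lemma smooth_fun_cst (r : R) : smooth_fun_on [set: M] (fun=> r).
Proof. by move=> c ac; exact: smooth_on_cst. Qed.

Lemma smooth_form0 : @smooth_form R n M (fun=> 0).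
Proof.
move=> c ac i; apply: (@smooth_on_ext _ _ _ (fun=> 0)).
- exact: image_of_open.
- by move=> x _; rewrite /form_in mul0mx mxE.
- exact: smooth_on_cst.
Qed.

Lemma connection_leibniz f a b b' p : smooth_fun_on [set: M] f ->
  smooth_form a -> smooth_form b -> smooth_form b' ->
  connection a (fun q => f q *: b q + b' q) p =
  f p *: connection a b p + connection a b' p + act (anchor P a) f p *: b p.
Proof.
move=> sf sa sb sb'; rewrite !connectionE (Dmx_form_lin p sf sb sb').
have ac := @chart_at_atlas R n M p; have cp := @chart_at_dom R n M p.
rewrite (act_in ac cp _ (smooth_fun_diff ac cp sf)) (vec_in_anchor ac cp).
rewrite form_in_chart_at.
move: (a p *m _) (Dmx (form_in _ b) _) (Dmx (form_in _ b') _) (grad_in _ _ _) (symbol_in _ _ _).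
move=> X D1 D2 v N; rewrite -[_ ord0 ord0 *: b p]mul_scalar_mx -mx11_scalar.
rewrite !mulmxDr !mulmxDl -!scalemxAr -scalemxAl scalerDr !mulmxA.
move: (f p *: _) (f p *: _) (X *m D2) (X *m v^T *m b p) (b' p *m N) => A B C D E.
by apply/rowP => i; rewrite !mxE; ring.
Qed.

Lemma connection_linear f a a' b p :
  connection (fun q => f q *: a q + a' q) b p = f p *: connection a b p + connection a' b p.
Proof.
rewrite !connectionE [symbol_in _ _ _]symbol_linear.
rewrite !mulmxDl mulmxDr -!scalemxAl -!scalemxAr scalerDr.
by rewrite addrACA.
Qed.

Lemma connection_torsion a b : smooth_form a -> smooth_form b ->
  in_charts [set: M] (fun c x =>
    form_in c (fun q => connection a b q - connection b a q) x = koszul c P a b x).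
Proof.
move=> sa sb c ac p _ cp.
have -> : form_in c (fun q => connection a b q - connection b a q) (coord c p) =
  form_in c (connection a b) (coord c p) - form_in c (connection b a) (coord c p).
  by rewrite /form_in mulmxBl.
rewrite (form_in_connection ac cp sa sb) (form_in_connection ac cp sb sa).
rewrite (koszulE ac hP cp (form_mdiff ac cp sa) (form_mdiff ac cp sb) (bivec_mdiff ac cp)).
have T := symbol_torsion (bivec_in c P (coord c p)) (cometricK ac cp)
  (pdm_cometric_sym c p) (pdm_bivec_skew ac cp)
  (form_in c a (coord c p)) (form_in c b (coord c p)).
rewrite -T /conn_in -/(symbol_in _ _ _) -/(symbol_in _ _ _).
by rewrite opprD addrACA.
Qed.

Theorem connection_metric_contravariant : metric_contravariant_connection g P connection.
Proof.
split; first exact: smooth_connection.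
split; first by move=> f a a' b _ _ _ _ p; exact: connection_linear.
split.
  move=> r a b b' sa sb sb' p.
  rewrite (connection_leibniz p (smooth_fun_cst r) sa sb sb').
  suff -> : act (anchor P a) (fun=> r) p = 0 by rewrite scale0r addr0.
  rewrite /act (_ : differential _ p = 0) ?trmx0 ?mulmx0 ?mxE //.
  by apply/rowP => i; rewrite mxE [RHS]mxE partial_cst.
split.
  move=> f a b sf sa sb p.
  have := connection_leibniz p sf sa sb smooth_form0.
  have -> : (fun q => f q *: b q + 0) = (fun q => f q *: b q).
    by apply/funext => q; rewrite addr0.
  move=> ->; congr (_ + _).
  rewrite -[RHS]addr0; congr (_ + _).
  rewrite connectionE mul0mx addr0.
  rewrite (@Dmx_near_eq _ _ _ _ (fun=> 0)).
    by rewrite Dmx_cst mulmx0.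
  by near=> y; rewrite /form_in mul0mx.
split; first by move=> a b b' sa sb sb' p; exact: act_form_prod.
exact: connection_torsion.
Unshelve. all: by end_near. Qed.

Theorem connection_parallel :
  (forall p, let c := chart_at p in let x := coord c p in forall b : 'rV[R]_n,
    symbol_in c x b *m bivec_in c P x + bivec_in c P x *m (symbol_in c x b)^T =
    dir (b *m bivec_in c P x) (fun l => pdm l (bivec_in c P) x)) ->
  parallel P connection.
Proof. by move=> par a b b' sa sb sb' p; apply: act_bivec_eval => //; exact: par. Qed.
End Connection.

(** * The contraction of the volume form *)

(** Reduces an identity that is linear in a covector to the coordinate frame. *)
Lemma rV_linear_eq0 (R : realType) n (V : lmodType R) (f : 'rV[R]_n -> V) :
  (forall r u v, f (r *: u + v) = r *: f u + f v) -> (forall i, f 'e_i = 0) ->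
  forall b, f b = 0.
Proof.
move=> lin f0 b; have fD u v : f (u + v) = f u + f v.
  by rewrite -{1}[u]scale1r lin scale1r.
have z : f 0 = 0 by apply: (addIr (f 0)); rewrite -fD !add0r.
rewrite [b]row_sum_delta (big_morph f fD z) big1 // => i _.
by rewrite -[_ *: _]addr0 lin f0 z scaler0 addr0.
Qed.

Section DetDerivative.
Variables (R : realType) (n : nat).
Implicit Types x : 'rV[R]_n.

Lemma mdiff_hat (v : 'rV[R]_n -> 'rV[R]_3) x : mdiff v x -> mdiff (fun y => hat (v y)) x.
Proof.
move=> dv; have d0 (r : R) : differentiable (fun=> r : R) x by exact: differentiable_cst.
have dN k : differentiable (fun y => - v y ord0 k) x by apply: differentiableN; exact: dv.
apply: ord3P; apply: ord3P; (apply: differentiable_near_eq;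
  [near=> y; rewrite mxE /=; reflexivity|]);
  solve [exact: d0 | exact: dv | exact: dN].
Unshelve. all: by end_near. Qed.

Lemma pdm_hat l (v : 'rV[R]_n -> 'rV[R]_3) x : mdiff v x ->
  pdm l (fun y => hat (v y)) x = hat (pdm l v x).
Proof.
move=> dv; apply/matrixP; apply: ord3P; apply: ord3P; rewrite pdmE [RHS]mxE /= ?pdmE;
  (apply: etrans; [apply: partial_near_eq; near=> y; rewrite mxE /=; reflexivity|]);
  solve [by rewrite partial_cst | by [] | by rewrite partialN //; exact: dv].
Unshelve. all: by end_near. Qed.

(** [hat_conj] exhibits the determinant as a factor of a product of matrices, so the Leibniz
rule and [hat_trace] give its derivative without expanding it. *)
Lemma partial_det l (F : 'rV[R]_n -> 'M[R]_3) (H : 'M[R]_3) x : mdiff F x ->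
  differentiable (fun y => \det (F y)) x -> F x *m H = 1%:M ->
  partial l (fun y => \det (F y)) x = \det (F x) * \tr (pdm l F x *m H).
Proof.
move=> dF dd FH; (* any nonzero u would do: hat u only serves to read off the scalar factor *)
pose u : 'rV[R]_3 := 'e_o0.
have du : mdiff (fun=> u) x by move=> i j; exact: differentiable_cst.
have duF : mdiff (fun y => u *m F y) x by exact: mdiff_mul.
have E : pdm l (fun y => F y *m hat (u *m F y) *m (F y)^T) x =
         pdm l (fun y => \det (F y) *: hat u) x.
  by apply: pdm_near_eq; near=> y; exact: hat_conj.
move: E; rewrite pdm_mul; [|by apply: mdiff_mul => //; exact: mdiff_hat|exact: mdiff_tr].
rewrite pdm_mul //; last exact: mdiff_hat.
rewrite pdm_hat // pdm_mul // pdm_cst mul0mx add0r pdm_tr pdm_scale //.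
rewrite pdm_cst scaler0 addr0 => E.
have HF := mulmx1C FH.
pose N := pdm l F x *m H; have NF : pdm l F x = N *m F x by rewrite -mulmxA HF mulmx1.
have E2 : partial l (fun y => \det (F y)) x *: hat u = (\det (F x) * \tr N) *: hat u.
  rewrite -E NF; clearbody N; rewrite !mulmxDl trmx_mul -!mulmxA.
  have C1 : F x *m (hat (u *m F x) *m (F x)^T) = \det (F x) *: hat u by rewrite mulmxA hat_conj.
  have C2 : F x *m (hat (u *m (N *m F x)) *m (F x)^T) = \det (F x) *: hat (u *m N).
    by rewrite (mulmxA u) mulmxA hat_conj.
  have C3 : F x *m (hat (u *m F x) *m ((F x)^T *m N^T)) = \det (F x) *: (hat u *m N^T).
    by rewrite !mulmxA hat_conj scalemxAl.
  rewrite C1 C2 C3 -scalemxAr -!scalerDr -scalerA addrAC hat_trace.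
  by rewrite subrK.
by have /matrixP/(_ o1 o2) := E2; rewrite !mxE /= !mulr1.
Unshelve. all: by end_near. Qed.
End DetDerivative.

Section Volume.
Variables (R : realType) (M : smooth_manifold R 3) (oM : oriented M).
Variables (g P : M -> 'M[R]_3).
Hypotheses (hg : riemannian_metric g) (hP : bivector_field P).
Implicit Types (c : chart R 3 M).

Let a := contract_volume g P.
Let ug q : g q \in unitmx := metric_unitmx q hg.

Lemma contract_volumeE p : a p = Num.sqrt (\det (g p)) *: unhat (P p).
Proof.
apply/rowP => k; rewrite /a /contract_volume [LHS]mxE [RHS]mxE.
under eq_bigr do rewrite big_mkcond /=.
rewrite !sum3E /= /volume; move: (Num.sqrt _ : R) => r; rewrite !det3E !mxE /=.
by rewrite (skew_entries o0 o2 (hP.1 p)); elim/ord3P: k => /=; ring.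
Qed.

Definition density c x : R := Num.sqrt (\det (metric_in c g x)).

Section At.
Variables (c : chart R 3 M) (p : M).
Hypotheses (ac : @atlas R 3 M c) (cp : dom c p).
Let x := coord c p.

Lemma det_metric_gt0 : 0 < \det (metric_in c g x).
Proof.
apply: posdef_det_gt0; first exact: metric_in_sym.
exact: (metric_in_posdef ac hg cp).
Qed.

Lemma density_neq0 : density c x != 0.
Proof. by rewrite sqrtr_eq0 -ltNge det_metric_gt0. Qed.

Lemma density_sqr : density c x * density c x = \det (metric_in c g x).
Proof. by rewrite -expr2 sqr_sqrtr // ltW // det_metric_gt0. Qed.

(** [hat_conj] applied to the change of frame. As the atlas is oriented, its determinant is
positive and equals the quotient of the densities. *)
Lemma form_in_volume : form_in c a x = density c x *: unhat (bivec_in c P x).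
Proof.
have TF := jac_inv (@chart_at_atlas R 3 M p) ac (@chart_at_dom R 3 M p) cp.
have dF : 0 < \det (jac c (chart_at p) p).
  by rewrite jac.unlock; exact: (oM ac (@chart_at_atlas R 3 M p) cp (@chart_at_dom R 3 M p)).
rewrite /density (form_inE _ cp) (bivec_inE _ cp) (metric_inE _ cp) contract_volumeE.
move: (jac _ _ _) (jac _ _ _) TF dF => F T TF dF.
have E : unhat (T^T *m P p *m T) = \det T *: (unhat (P p) *m F^T).
  have {1}-> : P p = hat (unhat (P p) *m F^T *m T^T).
    by rewrite -mulmxA -trmx_mul TF trmx1 mulmx1 unhatK //; exact: (hP.1 p).
  by have := hat_conj T^T (unhat (P p) *m F^T); rewrite trmxK det_tr => ->; rewrite -hatZ hatK.
have TF1 : \det F * \det T = 1 by rewrite mulrC -det_mulmx TF det1.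
have -> : \det (F *m g p *m F^T) = \det F ^+ 2 * \det (g p).
  by rewrite !det_mulmx det_tr expr2 mulrAC.
rewrite E sqrtrM ?sqr_ge0 // sqrtr_sqr gtr0_norm // scalerA mulrAC TF1 mul1r.
by rewrite scalemxAl.
Qed.

Lemma density_bivec : density c x *: bivec_in c P x = hat (form_in c a x).
Proof. by rewrite form_in_volume hatZ unhatK //; exact: bivec_in_skew. Qed.

Lemma bivec_in_volume : bivec_in c P x = (density c x)^-1 *: hat (form_in c a x).
Proof.
by rewrite -density_bivec scalerA mulVf ?density_neq0 // scale1r.
Qed.
End At.

Lemma density_smooth c : @atlas R 3 M c -> smooth_on (image_of c) (density c).
Proof.
move=> ac; apply: smooth_on_sqrt; first exact: image_of_open.
  by move=> _ [p cp <-]; exact: det_metric_gt0.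
by apply: smooth_on_det; [exact: image_of_open|exact: metric_ms].
Qed.

Lemma smooth_volume : smooth_form a.
Proof.
move=> c ac; have oV := @image_of_open _ _ _ c.
have sP := bivector_ms ac hP; have sd := density_smooth ac.
have E k (Q : 'rV[R]_3 -> R) : (forall x, unhat (bivec_in c P x) ord0 k = Q x) ->
    smooth_on (image_of c) Q -> smooth_on (image_of c) (fun x => form_in c a x ord0 k).
  move=> EQ sQ; apply: smooth_on_ext (smooth_onM oV sd sQ) => // _ [p cp <-].
  by rewrite (form_in_volume ac cp) mxE EQ.
apply: ord3P.
- by apply: (E _ _ _ (sP o1 o2)) => x; rewrite mxE.
- by apply: (E _ _ _ (sP o2 o0)) => x; rewrite mxE.
- by apply: (E _ _ _ (sP o0 o1)) => x; rewrite mxE.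
Qed.

Section Local.
Variables (c : chart R 3 M) (p : M).
Hypotheses (ac : @atlas R 3 M c) (cp : dom c p).
Let x := coord c p.
Let Vx : image_of c x := image_of_coord cp.
Let s := density c x.
Let ds l := partial l (density c) x.
Let ax := form_in c a x.
Let Da := Dmx (form_in c a) x.
Let Px := bivec_in c P x.
Let dP l := pdm l (bivec_in c P) x.
Let G := metric_in c g x.
Let H := cometric_in g c x.
Let dH l := pdm l (cometric_in g c) x.
Let s0 : s != 0 := density_neq0 ac cp.
Let GH : G *m H = 1%:M := metricK hg ac cp.
Let HG : H *m G = 1%:M := cometricK hg ac cp.
Let symH : H^T = H := cometric_sym c x hg.
Let da : mdiff (form_in c a) x := form_mdiff ac cp smooth_volume.
Let dPx : mdiff (bivec_in c P) x := bivec_mdiff hP ac cp.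
Let dHx : mdiff (cometric_in g c) x := cometric_mdiff hg ac cp.
Let dGx : mdiff (metric_in c g) x := metric_mdiff hg ac cp.
Let skP : Px^T = - Px := bivec_in_skew c x hP.
Let skdP l : (dP l)^T = - dP l := pdm_bivec_skew hP ac cp l.

Lemma PxE : Px = s^-1 *: hat ax. Proof. exact: bivec_in_volume. Qed.

Lemma density_diff : differentiable (density c) x.
Proof. exact: (density_smooth ac [::] Vx). Qed.

Lemma density_derivative l : 2 * s * ds l = s * s * \tr (pdm l (metric_in c g) x *m H).
Proof.
have E : partial l (fun y => density c y * density c y) x =
    partial l (fun y => \det (metric_in c g y)) x.
  apply: partial_near_eq; apply: near_image cp _ => q cq; exact: density_sqr.
rewrite (density_sqr ac cp) -(partial_det l dGx _ GH) -?E; last first.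
  exact: (smooth_on_det (@image_of_open _ _ _ c) (metric_ms ac hg) [::] Vx).
rewrite (partialM l density_diff density_diff) -/(ds l) -/s; ring.
Qed.

(** From the derivative of s^2 = det G. *)
Lemma density_log l : s^-1 * ds l = 2^-1 * \tr (H *m pdm l (metric_in c g) x).
Proof.
have := density_derivative l; rewrite mxtrace_mulC; move: (\tr _) (ds l) => t d E.
apply: (mulfI s0); rewrite mulVKf //; apply: (mulfI s0).
have -> : s * d = 2^-1 * (2 * s * d) by field.
by rewrite E; ring.
Qed.

Lemma dPE l : dP l = s^-1 *: hat (row l Da) - (s^-1 * s^-1 * ds l) *: hat ax.
Proof.
have E : pdm l (fun y => density c y *: bivec_in c P y) x =
   pdm l (fun y => hat (form_in c a y)) x.
  apply: pdm_near_eq; apply: near_image cp _ => q cq.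
  exact: density_bivec.
move: E; rewrite (pdm_scale l density_diff dPx) (pdm_hat l da) -row_Dmx.
rewrite -/(ds l) -/(dP l) -/Px -/s -/Da PxE => E.
rewrite -E scalerDr !scalerA mulVf // scale1r.
by rewrite addrAC (mulrAC s^-1 (ds l)) subrr add0r.
Qed.

Lemma volume_log l : \tr (G *m dH l) = - (2 * s^-1 * ds l).
Proof.
have -> : dH l = - (H *m pdm l (metric_in c g) x *m H).
  apply: (pdm_inv l dGx dHx); apply: near_image cp _ => q cq.
  exact: metricK.
rewrite mulmxN linearN /= !mulmxA GH mul1mx mxtrace_mulC -mulrA density_log.
by field.
Qed.

Lemma christoffel_sym i k l : christoffel c g x i k l = christoffel c g x i l k.
Proof.
have symd m k' l' : partial m (fun y => metric_in c g y k' l') x =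
  partial m (fun y => metric_in c g y l' k') x.
  apply: partial_near_eq; near=> y.
  by have /matrixP/(_ k' l') := metric_in_sym c y hg; rewrite mxE.
rewrite /christoffel; congr (_ * _); apply: eq_bigr => m _.
by rewrite (symd m k l) [X in _ * (X - _)]addrC.
Unshelve. all: by end_near. Qed.

(** In the trace, two of the three derivatives of the metric cancel by symmetry of H. *)
Lemma christoffel_trace l : \sum_i christoffel c g x i i l = s^-1 * ds l.
Proof.
have symd m k' l' : pdm m (metric_in c g) x k' l' = pdm m (metric_in c g) x l' k'.
  rewrite !pdmE; apply: partial_near_eq; near=> y.
  by have /matrixP/(_ k' l') := metric_in_sym c y hg; rewrite mxE.
have sHe i j : H i j = H j i by have /matrixP/(_ i j) := symH; rewrite mxE => ->.
rewrite density_log /christoffel -mulr_sumr; congr (_ * _).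
rewrite /mxtrace; under eq_bigr do under eq_bigr do rewrite -!pdmE mulrBr mulrDr.
under eq_bigr do rewrite big_split big_split /= sumrN.
rewrite big_split big_split /= sumrN.
have -> : \sum_i \sum_m invmx (metric_in c g x) i m * pdm i (metric_in c g) x m l =
  \sum_i \sum_m invmx (metric_in c g x) i m * pdm m (metric_in c g) x i l.
  rewrite exchange_big /=; apply: eq_bigr => i _; apply: eq_bigr => m _.
  by rewrite -[invmx _]/H sHe.
rewrite addrAC subrr add0r; apply: eq_bigr => i _; rewrite [RHS]mxE.
by apply: eq_bigr => m _.
Unshelve. all: by end_near. Qed.

Lemma volume_anchor0 : ax *m Px = 0.
Proof. by rewrite PxE -scalemxAr mul_hat_self scaler0. Qed.

Lemma volume_anchor_derivative k : row k Da *m Px + ax *m dP k = 0.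
Proof.
rewrite row_Dmx -(pdm_mul k da dPx) -[RHS](pdm_cst k 0 x).
apply: pdm_near_eq; apply: near_image cp _ => q cq.
by rewrite (bivec_in_volume ac cq) -scalemxAr mul_hat_self scaler0.
Qed.

Lemma ext_d_skew : (ext_d c a x)^T = - ext_d c a x.
Proof. by rewrite ext_dE linearB /= trmxK opprB. Qed.

Lemma div_bivec_closed : div_bivec c g P x = 0 <-> ext_d c a x = 0.
Proof.
rewrite ext_dE -curl_eq0.
have E j : div_bivec c g P x ord0 j = s^-1 * \sum_i hat (row i Da) i j.
  rewrite mxE -(divergence_dual dPE christoffel_sym christoffel_trace).
  by apply: eq_bigr => i _; rewrite /nabla_bivec -/x /dP pdmE -/Px PxE.
split=> [D0 j|D0].
  have := E j; rewrite D0 mxE => /esym/eqP; rewrite mulf_eq0 invr_eq0 (negbTE s0).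
  by move/eqP.
by apply/rowP => j; rewrite E D0 mulr0 mxE.
Qed.

Lemma closed_schouten : ext_d c a x = 0 -> forall i j k, schouten c P P x i j k = 0.
Proof.
rewrite ext_dE => W0 i j k.
have := schouten_dual dPE W0 i j k; rewrite /= -PxE => E.
have T u v w : \sum_l bivec_in c P x u l * partial l (fun y => bivec_in c P y v w) x =
  \sum_l Px u l * dP l v w by apply: eq_bigr => l _; rewrite /dP pdmE.
by rewrite /schouten /= !T E addr0.
Qed.

Lemma divergence_of X : divergence c g X x = div_of s ds (vec_in c X x) (Dmx (vec_in c X) x).
Proof.
rewrite /divergence /nabla_vec /div_of big_split /=; congr (_ + _).
  by apply: eq_bigr => i _; rewrite DmxE.
rewrite exchange_big /= mulr_sumr; apply: eq_bigr => l _.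
by rewrite -mulr_suml christoffel_trace mulrC mulrCA mulrA.
Qed.

Lemma lie_bivec_volume X : lie_bivec c X P x =
  s^-1 *: hat (vec_in c X x *m Da + ax *m (Dmx (vec_in c X) x)^T - divergence c g X x *: ax).
Proof. by rewrite lie_bivecE divergence_of -(lie_of_dual dPE) -PxE. Qed.

Lemma lie_bivec_volume0 X : lie_bivec c X P x = 0 <->
  vec_in c X x *m Da + ax *m (Dmx (vec_in c X) x)^T - divergence c g X x *: ax = 0.
Proof.
rewrite lie_bivec_volume; split=> [E|->]; last by rewrite linear0 scaler0.
apply: hat_inj; rewrite linear0; apply/eqP; move/eqP: E.
by rewrite scaler_eq0 invr_eq0 (negbTE s0).
Qed.

(** If da = 0, the right-hand side is the Lie derivative of a along its metric dual. *)
Lemma grad_volume_norm : form_in c (differential (form_prod g a a)) x =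
  ax *m (Dmx (vec_in c (sharp g a)) x)^T + ax *m H *m Da^T.
Proof.
rewrite (form_in_differential ac cp (diff_form_prod ac ug cp da da dHx)).
rewrite (grad_in_form_prod ac ug cp da da dHx) (Dmx_sharp ac ug cp da dHx).
have trD (A B : 'M[R]_3) : (A + B)^T = A^T + B^T by exact: linearD.
by rewrite trD trmx_mul mulmxDr !mulmxA.
Qed.

Lemma closed_lie_bivec_sharp : ext_d c a x = 0 ->
  (form_in c (differential (form_prod g a a)) x + codiff c g a x *: ax = 0 <->
   lie_bivec c (sharp g a) P x = 0).
Proof.
rewrite ext_dE => /subr0_eq DaT; rewrite lie_bivec_volume0 grad_volume_norm.
rewrite /codiff scaleNr (vec_in_sharp ac cp a (ug p)) -/Da -DaT -/Da.
by rewrite [X in _ <-> X - _ = _]addrC.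
Qed.

Lemma norm_equation_at_zero : ax = 0 ->
  form_in c (differential (form_prod g a a)) x + codiff c g a x *: ax = 0.
Proof. by move=> a0; rewrite grad_volume_norm a0 !mul0mx scaler0 !addr0. Qed.

Section Frame.
Variable D : 'I_3 -> 'M[R]_3.
Hypothesis met : forall i, dir (row i Px) dH = D i *m H + H *m (D i)^T.
Hypothesis tor : forall i j k, D i j k - D j i k = dP k i j.

Let K := form_deriv Px Da D ax *m H.

Lemma frame_bivec_deriv i :
  dir (row i Px) dP - D i *m Px - Px *m (D i)^T = s^-1 *: hat (row i (form_deriv Px Da D ax)).
Proof.
have := bivec_deriv dPE GH symH; rewrite -PxE; apply; [exact: met|exact: volume_log].
Qed.

Lemma frame_sym : K + K^T = Px *m ext_d c a x *m H + (Px *m ext_d c a x *m H)^T.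
Proof.
rewrite ext_dE; exact: (frame_symmetric_part skP volume_anchor_derivative skdP
  volume_anchor0 tor symH met).
Qed.

Lemma frame_skew : K - K^T = - lie_bivec c (sharp g a) P x.
Proof.
rewrite lie_bivecE (vec_in_sharp ac cp a (ug p)) (Dmx_sharp ac ug cp da dHx).
rewrite (frame_skew_part Da ax skP tor symH met); congr (- lie_of _ _ _ _).
apply/row_matrixP => k; rewrite linearD /= row_mul rowK.
by apply/rowP => j; rewrite !mxE.
Qed.

(** Parallelism gives D a = 0 by [frame_bivec_deriv]; then both parts of K vanish. *)
Lemma frame_parallel_local :
  (forall i, dir (row i Px) dP = D i *m Px + Px *m (D i)^T) -> ax != 0 ->
  ext_d c a x = 0 /\ lie_bivec c (sharp g a) P x = 0.
Proof.
move=> par a0.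
have K0 : K = 0.
  rewrite /K [form_deriv _ _ _ _](_ : _ = 0) ?mul0mx //.
  apply/row_matrixP => i; rewrite row0; apply: hat_inj; rewrite linear0.
  apply/eqP; have /eqP := frame_bivec_deriv i.
  by rewrite par -addrA -opprD subrr eq_sym scaler_eq0 invr_eq0 (negbTE s0).
have := frame_sym; have := frame_skew; rewrite K0 trmx0 subrr addr0.
move=> /esym/eqP; rewrite oppr_eq0 => /eqP L0 /esym.
rewrite PxE => /(sym_contraction_eq0 symH GH) E; split => //.
by apply: E => //; [rewrite invr_eq0|exact: ext_d_skew].
Qed.

(** Both parts of K vanish, hence D a = 0, and [frame_bivec_deriv] applies. *)
Lemma frame_local_parallel : ext_d c a x = 0 -> lie_bivec c (sharp g a) P x = 0 ->
  forall i, dir (row i Px) dP = D i *m Px + Px *m (D i)^T.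
Proof.
move=> W0 L0 i; have := frame_sym; have := frame_skew.
rewrite W0 L0 oppr0 mulmx0 mul0mx trmx0 addr0 => /subr0_eq KT.
rewrite -KT => /eqP; rewrite -mulr2n -scaler_nat scaler_eq0 pnatr_eq0 /= => /eqP K0.
have D0 : form_deriv Px Da D ax = 0.
  by rewrite -[LHS]mulmx1 -HG mulmxA -/K K0 mul0mx.
have := frame_bivec_deriv i; rewrite D0 row0 linear0 scaler0.
by rewrite -addrA -opprD => /subr0_eq.
Qed.
End Frame.

Lemma symbol_parallel : ext_d c a x = 0 -> lie_bivec c (sharp g a) P x = 0 ->
  forall b, symbol_in g P c x b *m Px + Px *m (symbol_in g P c x b)^T = dir (b *m Px) dP.
Proof.
move=> W0 L0 b.
pose D i := symbol_in g P c x 'e_i.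
have met i : dir (row i Px) dH = D i *m H + H *m (D i)^T.
  rewrite rowE; symmetry; apply: symbol_metric => //; exact: pdm_cometric_sym.
have tor i j k : D i j k - D j i k = dP k i j.
  have := symbol_torsion Px HG (pdm_cometric_sym hg c p) skdP 'e_i 'e_j.
  move=> /(congr1 (fun v : 'rV[R]_3 => v ord0 k)); rewrite mul_rows_ofT.
  rewrite trmx_delta -colE [X in _ = X -> _]mxE -!rowE [X in _ = X -> _]mxE.
  by rewrite [X in X = _ -> _]mxE [X in _ + X]mxE ![row _ _ _ _]mxE.
have par := frame_local_parallel met tor W0 L0.
pose f v := symbol_in g P c x v *m Px + Px *m (symbol_in g P c x v)^T - dir (v *m Px) dP.
suff fE : f b = 0 by exact: subr0_eq fE.
apply: (@rV_linear_eq0 _ _ _ f) => [r u v|i].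
  have mL k (A B : 'M[R]_(k, 3)) : (r *: A + B) *m Px = r *: (A *m Px) + B *m Px.
    by rewrite mulmxDl -scalemxAl.
  have mR (A B : 'M[R]_3) : Px *m (r *: A + B) = r *: (Px *m A) + Px *m B.
    by rewrite mulmxDr -scalemxAr.
  have trL (A B : 'M[R]_3) : (r *: A + B)^T = r *: A^T + B^T by exact: linearP.
  rewrite /f [symbol_in g P c x _]symbol_linear !mL trL mR dir_linear.
  rewrite -/(symbol_in g P c x u) -/(symbol_in g P c x v).
  move: (_ *m Px) (_ *m Px) (Px *m _) (Px *m _) (dir _ _) (dir _ _) => A B C D' E F.
  by apply/matrixP => k l; rewrite !mxE; ring.
by rewrite /f -rowE par subrr.
Qed.
End Local.
End Volume.

(** * Casimir functions *)

Section LocalToGlobal.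
Variables (R : realType) (n : nat) (M : smooth_manifold R n).
Implicit Types (c d : chart R n M) (b : M -> 'rV[R]_n).

Lemma smooth_on_local (V : set 'rV[R]_n) f :
  (forall x, V x -> exists2 W : set 'rV[R]_n, W x & smooth_on W f) -> smooth_on V f.
Proof. by move=> loc s x /loc[W Wx sf]; exact: sf. Qed.

Lemma form_in_inj c b b' p : @atlas R n M c -> dom c p ->
  form_in c b (coord c p) = form_in c b' (coord c p) -> b p = b' p.
Proof.
move=> ac cp E; rewrite -(form_in_chart_at b p) -(form_in_chart_at b' p).
have at_a := @chart_at_atlas R n M p; have at_d := @chart_at_dom R n M p.
rewrite (form_in_change at_a ac at_d cp b) (form_in_change at_a ac at_d cp b').
by rewrite E.
Qed.

Lemma chart_domain_open c (W : set 'rV[R]_n) : open W ->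
  open (dom c `&` coord c @^-1` W).
Proof.
move=> oW; rewrite openE => q [cq Wq]; rewrite /interior.
have H1 : nbhs q (dom c) by apply: open_nbhs_nbhs; split => //; exact: dom_open.
have H2 : nbhs q (coord c @^-1` W).
  by apply: (coord_cont cq); apply: open_nbhs_nbhs.
by apply: filterI.
Qed.

Lemma smooth_fun_of_chart c (W : set 'rV[R]_n) f : @atlas R n M c -> open W ->
  smooth_on W f -> smooth_fun_on (dom c `&` coord c @^-1` W) (f \o coord c).
Proof.
move=> ac oW /smooth_onP sf d ad.
pose V := coord d @` ((dom c `&` coord c @^-1` W) `&` dom d).
have oV : open V by apply: coord_image_open; exact: chart_domain_open.
have Vo : V `<=` coord d @` (dom d `&` dom c).
  by move=> _ [q [[cq _] dq] <-]; exists q.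
apply/smooth_onP => k.
apply: (Ck_comp (tau := transition d c) (f := f) oV _ _ (sf k)).
  by move=> _ [q [[cq Wq] dq] <-]; rewrite (transition_coord c dq).
by move=> j; apply: Ck_sub Vo _; move/smooth_onP: (transition_smooth j ad ac); exact.
Qed.
End LocalToGlobal.

(** For X = h A with dh proportional to a, the terms in dh of L_X a and of (div X) a cancel. *)
Lemma lie_scaled_algebra (R : realType) (a A dh : 'rV[R]_3) (H Da DA : 'M[R]_3) (h : R)
    (s : R) (ds : 'I_3 -> R) :
  A = a *m H -> H^T = H -> dh^T *m a = a^T *m dh ->
  A *m Da + a *m DA^T - div_of s ds A DA *: a = 0 ->
  (h *: A) *m Da + a *m (h *: DA + dh^T *m A)^T
    - div_of s ds (h *: A) (h *: DA + dh^T *m A) *: a = 0.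
Proof.
move=> AE sH symd E.
have -> : div_of s ds (h *: A) (h *: DA + dh^T *m A) =
   h * div_of s ds A DA + (A *m dh^T) ord0 ord0.
  rewrite /div_of linearD linearZ /= (mxtrace_mulC dh^T) /mxtrace big_ord1.
  rewrite mulrDr addrAC; congr (_ + _ + _).
  rewrite mulrCA; congr (_ * _); rewrite mulr_sumr; apply: eq_bigr => l _.
  by rewrite mxE mulrA.
have T : a *m (dh^T *m A)^T = (A *m dh^T) ord0 ord0 *: a.
  rewrite -mul_scalar_mx -mx11_scalar trmx_mul trmxK mulmxA -mulmxA -mulmxA symd.
  rewrite mulmxA mulmxA; congr (_ *m _).
  by rewrite AE trmx_mul sH mulmxA.
have trD (B C : 'M[R]_3) : (B + C)^T = B^T + C^T by exact: linearD.
rewrite trD mulmxDr T linearZ /= -scalemxAr -scalemxAl scalerDl opprD.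
rewrite -scalerA addrACA addrA addrA.
rewrite -[RHS](scaler0 _ h) -[in RHS]E scalerBr scalerDr.
by rewrite addrK addrAC.
Qed.

Section Casimirs.
Variables (R : realType) (M : smooth_manifold R 3) (oM : oriented M).
Variables (g P : M -> 'M[R]_3).
Hypotheses (hg : riemannian_metric g) (hP : bivector_field P).
Variables (c : chart R 3 M).
Hypothesis ac : @atlas R 3 M c.

Let a := contract_volume g P.
Let ug q : g q \in unitmx := metric_unitmx q hg.
Let sa : smooth_form a := smooth_volume oM hg hP.
Hypothesis closed_a : forall q, dom c q -> ext_d c a (coord c q) = 0.

Lemma volume_anchor_zero q : anchor P a q = 0.
Proof.
rewrite /anchor /a contract_volumeE // -{2}(unhatK (hP.1 q)) -scalemxAl mul_hat_self.
by rewrite scaler0.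
Qed.

(** A local primitive of a is a Casimir function, since a is annihilated by P. *)
Lemma local_casimir p : dom c p ->
  exists U f, [/\ open U, U p, casimir_on P U f & forall q, U q -> differential f q = a q].
Proof.
move=> cp.
have [||W [f [oW Wx WV sf df]]] := @poincare R 3 (image_of c)
   (fun i x => form_in c a x ord0 i) (coord c p) (@image_of_open _ _ _ c)
   (image_of_coord cp).
- by move=> i; exact: (sa ac i).
- move=> _ i j [q cq <-]; apply/eqP; rewrite -subr_eq0; apply/eqP.
  by have /matrixP/(_ i j) := closed_a cq; rewrite !mxE.
pose U := dom c `&` coord c @^-1` W.
have E q : U q -> differential (f \o coord c) q = a q.
  move=> [cq Wq]; apply: (form_in_inj ac cq).
  have N : \forall y \near coord c q, (f \o coord c \o point c) y = f y.
    by apply: near_image cq _ => q' cq' /=; rewrite coordK.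
  rewrite (form_in_differential ac cq); last first.
    by apply: differentiable_near_eq (sf [::] _ Wq); apply: filterS N => y ->.
  apply/rowP => i; rewrite mxE -(df _ i Wq); exact: partial_near_eq.
exists U, (f \o coord c); split => //.
- exact: chart_domain_open.
- split; first exact: smooth_fun_of_chart.
  by move=> q Uq; rewrite /anchor E //; exact: volume_anchor_zero.
Qed.

Lemma lie_bivec_near_eq X Y p : dom c p ->
  (\forall y \near coord c p, vec_in c X y = vec_in c Y y) ->
  lie_bivec c X P (coord c p) = lie_bivec c Y P (coord c p).
Proof.
by move=> cp XY; rewrite !lie_bivecE (Dmx_near_eq XY) (nbhs_singleton XY).
Qed.

(** The condition on Casimir functions, for the local primitive of a. *)
Lemma killing_lie_sharp p : dom c p ->
  (forall (U : set M) (f : M -> R), open U -> casimir_on P U f ->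
        in_charts U (fun c x => lie_bivec c (gradient g f) P x = 0)) ->
  lie_bivec c (sharp g a) P (coord c p) = 0.
Proof.
move=> cp K; have [U [f [oU Up Cf df]]] := local_casimir cp.
rewrite -(K U f oU Cf c ac p Up cp); apply: lie_bivec_near_eq => //.
have := near_point cp (open_nbhs_nbhs (conj oU Up)).
by apply: filterS => y [_ _ _ Uy]; rewrite /vec_in /gradient /sharp df.
Qed.

Section CasimirLie.
Hypothesis lie_a : forall q, dom c q -> lie_bivec c (sharp g a) P (coord c q) = 0.
Variables (U : set M) (f : M -> R).
Hypotheses (oU : open U) (Cf : casimir_on P U f).
Let V : set 'rV[R]_3 := coord c @` (U `&` dom c).
Let oV : open V := coord_image_open oU.
Let b := grad_in c f.
Let X := gradient g f.

Lemma casimir_smooth : smooth_on V (f \o point c).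
Proof. exact: (Cf.1 c ac). Qed.

Lemma casimir_sub : V `<=` image_of c.
Proof. by move=> _ [q [_ cq] <-]; exists q. Qed.

Lemma casimir_grad_smooth : msmooth V b.
Proof.
move=> i j; apply: (@smooth_on_ext _ _ _ (partial j (f \o point c))) => //.
  by move=> x _; rewrite [RHS]mxE.
by apply: smooth_on_partial; exact: casimir_smooth.
Qed.

Lemma casimir_form q : U q -> dom c q -> form_in c (differential f) (coord c q) = b (coord c q).
Proof.
move=> Uq cq; apply: (form_in_differential ac cq).
by apply: (casimir_smooth [::]); exists q.
Qed.

Lemma casimir_vec y : V y -> vec_in c X y = b y *m cometric_in g c y.
Proof. by move=> [q [Uq cq] <-]; rewrite (vec_in_sharp ac cq _ (ug q)) casimir_form. Qed.

Lemma casimir_anchor y : V y -> b y *m bivec_in c P y = 0.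
Proof.
move=> [q [Uq cq] <-]; rewrite -casimir_form // -(vec_in_anchor ac cq).
by rewrite (vec_inE _ cq) (Cf.2 q Uq) mul0mx.
Qed.

Lemma sub_msmooth m k (F : 'rV[R]_3 -> 'M[R]_(m, k)) : msmooth (image_of c) F -> msmooth V F.
Proof. by move=> sF i j; apply: smooth_on_sub (sF i j); exact: casimir_sub. Qed.

Lemma casimir_vec_smooth : msmooth V (vec_in c X).
Proof.
apply: (msmooth_ext oV (F := fun y => b y *m cometric_in g c y)).
  by move=> y Vy; rewrite casimir_vec.
exact: (msmooth_mul oV casimir_grad_smooth (sub_msmooth (cometric_ms ac hg))).
Qed.

Lemma casimir_grad_parallel y i j : V y ->
  b y ord0 i * form_in c a y ord0 j = b y ord0 j * form_in c a y ord0 i.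
Proof.
move=> Vy; apply: mul_hat0; have := casimir_anchor Vy.
move: Vy => [q [Uq cq] <-]; rewrite (bivec_in_volume oM hg hP ac cq) -scalemxAr.
by move/eqP; rewrite scaler_eq0 invr_eq0 (negbTE (density_neq0 hg ac cq)) => /eqP.
Qed.

(** Near y the differential of f is h a, since hat a annihilates it. As df and a are closed,
dh is proportional to a, and [lie_scaled_algebra] reduces the claim to L_A P = 0. *)
Lemma casimir_lie_at y : V y -> form_in c a y != 0 -> lie_bivec c X P y = 0.
Proof.
move=> Vy /rV0Pn[i ai].
have [q [Uq cq] yE] := Vy.
have Iy : image_of c y := casimir_sub Vy.
have da : mdiff (form_in c a) y := msmooth_diff (smooth_form_ms ac sa) Iy.
have dH : mdiff (cometric_in g c) y := msmooth_diff (cometric_ms ac hg) Iy.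
have db : mdiff b y := msmooth_diff casimir_grad_smooth Vy.
(* the factor h of df = h a, read off at an index where a does not vanish *)
pose h z := b z ord0 i * (form_in c a z ord0 i)^-1.
have dh : differentiable h y.
  by apply: differentiableM; [exact: db|apply: differentiableV => //; exact: da].
have nV : \forall z \near y, V z by apply: open_nbhs_nbhs.
have bE : \forall z \near y, b z = h z *: form_in c a z + 0.
  have na : \forall z \near y, form_in c a z ord0 i != 0.
    exact: (near_neq0 (differentiable_continuous (da ord0 i)) ai).
  apply: filterS2 nV na => z Vz az; apply/rowP => j; rewrite addr0 [RHS]mxE /h mulrAC.
  by rewrite -(casimir_grad_parallel j i Vz) mulfK.
have Db : Dmx b y = h y *: Dmx (form_in c a) y + (\row_l partial l h y)^T *m form_in c a y.
  rewrite (Dmx_near_eq bE) (Dmx_scale_add dh da) ?addr0.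
    by rewrite Dmx_cst addr0.
  by move=> k l; exact: differentiable_cst.
have by0 : b y = h y *: form_in c a y by rewrite (nbhs_singleton bE) addr0.
have DaT : (Dmx (form_in c a) y)^T = Dmx (form_in c a) y.
  have := closed_a cq; rewrite -yE ext_dE => /subr0_eq <-; by [].
have DbT : (Dmx b y)^T = Dmx b y.
  apply/matrixP => k l; rewrite [LHS]mxE !DmxE.
  have E r m : partial r (fun z => b z ord0 m) y = partial r (partial m (f \o point c)) y.
    by apply: partial_near_eq; near=> z; rewrite mxE.
  by rewrite !E (smooth_partialC l k oV casimir_smooth Vy).
set dhy := \row_l _ in Db.
have symd : dhy^T *m form_in c a y = (form_in c a y)^T *m dhy.
  have := DbT; rewrite Db linearD linearZ /= trmx_mul trmxK DaT => /addrI ->; by [].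
have XE : vec_in c X y = h y *: (form_in c a y *m cometric_in g c y).
  by rewrite casimir_vec // by0 scalemxAl.
have vA : vec_in c (sharp g a) y = form_in c a y *m cometric_in g c y.
  by rewrite -yE (vec_in_sharp ac cq _ (ug q)).
have DA : Dmx (vec_in c (sharp g a)) y = Dmx (form_in c a) y *m cometric_in g c y
   + rows_of (form_in c a y) (fun l => pdm l (cometric_in g c) y).
  by move: da dH; rewrite -yE => da dH; exact: (Dmx_sharp ac ug cq da dH).
have DX : Dmx (vec_in c X) y = h y *: Dmx (vec_in c (sharp g a)) y
   + dhy^T *m (form_in c a y *m cometric_in g c y).
  rewrite (Dmx_near_eq (b' := fun z => b z *m cometric_in g c z)); last first.
    by apply: filterS nV => z; exact: casimir_vec.
  rewrite (Dmx_mul db dH) -/(rows_of _ _) Db by0 DA mulmxDl -scalemxAl.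
  have -> : rows_of (h y *: form_in c a y) (fun l => pdm l (cometric_in g c) y) =
     h y *: rows_of (form_in c a y) (fun l => pdm l (cometric_in g c) y).
    by apply/row_matrixP => l; rewrite linearZ /= !rowK -scalemxAl.
  by rewrite scalerDr -mulmxA addrAC.
have := lie_a cq; rewrite -yE.
move: XE vA DX symd; rewrite -yE => XE vA DX symd.
move=> /(lie_bivec_volume0 oM hg hP ac cq); rewrite (divergence_of hg ac cq) vA => L.
apply/(lie_bivec_volume0 oM hg hP ac cq); rewrite (divergence_of hg ac cq) XE DX.
exact: (lie_scaled_algebra _ erefl (cometric_sym c _ hg) symd L).
Unshelve. all: by end_near. Qed.

(** Where a is not zero this is [casimir_lie_at]; near the other points either a vanishes
identically, and so does P, or continuity applies. *)
Lemma casimir_lie p : U p -> dom c p -> lie_bivec c X P (coord c p) = 0.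
Proof.
move=> Up cp; have Vx : V (coord c p) by exists p.
have sP := sub_msmooth (bivector_ms ac hP).
have sX := casimir_vec_smooth.
have S : msmooth V (lie_bivec c X P).
  apply: (msmooth_ext oV (F := fun y => dir (vec_in c X y) (fun l => pdm l (bivec_in c P) y)
     + - ((Dmx (vec_in c X) y)^T *m bivec_in c P y) + - (bivec_in c P y *m Dmx (vec_in c X) y))).
    by move=> y _; rewrite lie_bivecE.
  apply: (msmooth_add oV); last exact: (msmooth_opp oV (msmooth_mul oV sP (msmooth_Dmx oV sX))).
  apply: (msmooth_add oV).
    by apply: (msmooth_dir oV sX) => l; exact: (msmooth_pdm oV).
  exact: (msmooth_opp oV (msmooth_mul oV (msmooth_tr oV (msmooth_Dmx oV sX)) sP)).
have nV : \forall z \near coord c p, V z by apply: open_nbhs_nbhs.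
apply/matrixP => k l; rewrite [RHS]mxE.
apply: (@vanish_by_density _ _ (fun y => lie_bivec c X P y k l) [set y | form_in c a y != 0]).
- by apply: differentiable_continuous; exact: (S k l [::] _ Vx).
- by apply: filterS nV => y Vy /= ay; rewrite casimir_lie_at // mxE.
- move=> Na.
  have Na0 : \forall y \near coord c p, form_in c a y = 0.
    by apply: filterS Na => y /negP; rewrite negbK => /eqP.
  rewrite (lie_bivec_volume oM hg hP ac cp) (nbhs_singleton Na0).
  by rewrite (Dmx_near_eq Na0) Dmx_cst mulmx0 mul0mx scaler0 addr0 subrr linear0 scaler0 mxE.
Qed.
End CasimirLie.
End Casimirs.

(** * Bump functions and bump forms *)

Lemma smooth_on_coord (R : realType) n (V : set 'rV[R]_n) j : open V ->
  smooth_on V (fun y => y ord0 j).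
Proof.
move=> oV; apply/smooth_onP; case=> [|k]; split=> //.
- by move=> x _; exact: differentiable_coord.
- by move=> x _; exact: differentiable_coord.
- move=> i; apply: (@Ck_ext _ _ _ _ (fun=> 1%:M i j)) => //; last exact: Ck_cst.
  by move=> x _; rewrite partial_coord.
Qed.

(** The function [flat 0] of r^2 - |y - x|^2, normalized at x. The differential of the
squared distance vanishes at x, hence so does that of phi. *)
Lemma bump_exists (R : realType) n (V : set 'rV[R]_n) (x : 'rV[R]_n) : open V -> V x ->
  exists (phi : 'rV[R]_n -> R) (K : set 'rV[R]_n),
    [/\ compact K, K `<=` V, smooth_on setT phi, forall y, ~ K y -> phi y = 0 &
        phi x = 1 /\ forall l, partial l phi x = 0].
Proof.
move=> oV Vx.
have /nbhs_ballP[e /= e0 eV] := open_nbhs_nbhs (conj oV Vx).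
pose r := e / 2; have r0 : 0 < r by rewrite divr_gt0.
pose K := [set y : 'rV[R]_n | forall i, `[x ord0 i - r, x ord0 i + r]%classic (y ord0 i)].
pose sq (y : 'rV[R]_n) := \sum_i (y ord0 i - x ord0 i) * (y ord0 i - x ord0 i).
pose h y := r * r + - sq y.
pose k := (@flat R 0 (r * r))^-1.
have rr0 : 0 < r * r by exact: mulr_gt0.
have f0 : @flat R 0 (r * r) != 0.
  by rewrite /flat rr0 expr0 mul1r gt_eqF // expR_gt0.
have oT : open (@setT 'rV[R]_n) by exact: openT.
have sdiff i : smooth_on setT (fun y : 'rV[R]_n => y ord0 i + - x ord0 i).
  by apply: smooth_onD => //; [exact: smooth_on_coord|exact: smooth_on_cst].
have sh : smooth_on setT h.
  apply: smooth_onD => //; first exact: smooth_on_cst.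
  apply: smooth_onN => //; apply: smooth_on_sum => // i _.
  by apply: smooth_onM => //; exact: sdiff.
have sqx : sq x = 0 by rewrite /sq big1 // => i _; rewrite subrr mul0r.
exists (fun y => k * (@flat R 0 \o h) y), K; split.
- exact: (@rV_compact R n (fun i => `[x ord0 i - r, x ord0 i + r]%classic)
    (fun i => @segment_compact R _ _)).
- move=> y Ky; apply: eV; split=> // i j; rewrite (ord1 i).
  have := Ky j; rewrite /= in_itv /= => /andP[y1 y2].
  rewrite /ball /= -/(ball _ _ _); rewrite ltr_distl.
  by rewrite /r in y1 y2; apply/andP; split; lra.
- apply: smooth_onM => //; first exact: smooth_on_cst.
  move/smooth_onP: sh => sh; apply/smooth_onP => m; exact: Ck_flat.
- move=> y nK; rewrite /= /flat; case: ifPn; last by rewrite mulr0.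
  rewrite /h subr_gt0 => sqy; exfalso; apply: nK => i.
  have le_sq : (y ord0 i - x ord0 i) * (y ord0 i - x ord0 i) < r * r.
    apply: le_lt_trans sqy; rewrite /sq (bigD1 i) //= lerDl.
    by apply: sumr_ge0 => j _; rewrite -expr2 sqr_ge0.
  rewrite /= in_itv /=; apply/andP; split; nra.
- rewrite /= /h sqx subr0 /k mulVf //; split => // l.
  have dh : differentiable h x by exact: (sh [::]).
  have [df pf] := partial_comp1 l dh (is_derive_flat 0 (h x)).
  apply: etrans (partialM l (differentiable_cst k x) df) _.
  rewrite partial_cst mul0r add0r pf.
  suff -> : partial l h x = 0 by rewrite !mulr0.
  have dd i : differentiable (fun y : 'rV[R]_n => y ord0 i + - x ord0 i) x.
    exact: (sdiff i [::]).
  have ds i : differentiable (fun y : 'rV[R]_n =>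
      (y ord0 i - x ord0 i) * (y ord0 i - x ord0 i)) x by exact: differentiableM.
  have dsq : differentiable sq x by apply: differentiable_bigsum => i _; exact: ds.
  have dN : differentiable (fun y => - sq y) x by exact: differentiableN.
  apply: etrans (partialD l (differentiable_cst (r * r) x) dN) _.
  rewrite partial_cst add0r (partialN l dsq) /sq partial_sum; last by move=> i _; exact: ds.
  rewrite big1 ?oppr0 // => i _; rewrite (partialM l (dd i) (dd i)) subrr.
  by rewrite !(mulr0, mul0r) addr0.
Qed.

Section BumpForm.
Variables (R : realType) (n : nat) (M : smooth_manifold R n).
Variables (c : chart R n M) (phi : 'rV[R]_n -> R) (K : set 'rV[R]_n).
Hypotheses (ac : @atlas R n M c) (cK : compact K) (KV : K `<=` image_of c)
  (sphi : smooth_on setT phi) (phi0 : forall y, ~ K y -> phi y = 0).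

(** In the chart c its components are phi times the constant row v; the Jacobian converts
them to the frame of [chart_at q]. *)
Definition bump_form (v : 'rV[R]_n) : M -> 'rV[R]_n := fun q =>
  if `[< dom c q >] then phi (coord c q) *: (v *m (jac (chart_at q) c q)^T) else 0.

Lemma form_in_bump v q : dom c q ->
  form_in c (bump_form v) (coord c q) = phi (coord c q) *: v.
Proof.
move=> cq; rewrite (form_inE _ cq) /bump_form asboolT // -scalemxAl.
have J := jac_inv ac (@chart_at_atlas R n M q) cq (@chart_at_dom R n M q).
by rewrite -mulmxA -trmx_mul J trmx1 mulmx1.
Qed.

(** The Hausdorff property makes the compact support closed, so that the extension by zero
is smooth outside of the domain of c as well. *)
Lemma bump_support_closed : closed (point c @` K).
Proof.
apply: compact_closed; first exact: carrier_hausdorff.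
apply: continuous_compact cK.
apply: continuous_in_subspaceT => y /set_mem /KV [q cq <-]; exact: point_cont.
Qed.

Lemma smooth_bump_form v : smooth_form (bump_form v).
Proof.
move=> d ad j; apply: smooth_on_local => _ [q dq <-].
have [cq|ncq] := pselect (dom c q).
  exists (coord d @` (dom d `&` dom c)); first by exists q.
  have oW := @overlap_open _ _ _ d c.
  pose W := coord d @` (dom d `&` dom c).
  apply: (@smooth_on_ext _ _ _ (fun y => \sum_i (phi \o transition d c) y * v ord0 i *
      partial j (fun z => transition d c z ord0 i) y)) => //.
    move=> _ [q' [dq' cq'] <-].
    rewrite (form_in_change ad ac dq' cq') form_in_bump // [RHS]mxE.
    apply: eq_bigr => i _; rewrite [_^T _ _]mxE (jac_entry j i ad ac dq' cq').
    by rewrite /= (transition_coord c dq') [X in _ = X * _]mxE.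
  apply: smooth_on_sum => // i _; apply: smooth_onM => //.
    apply: smooth_onM => //; last exact: smooth_on_cst.
    move/smooth_onP: sphi => sphi'; apply/smooth_onP => k.
    apply: (Ck_comp (W := setT)) => // i'.
    by move/smooth_onP: (transition_smooth i' ad ac); exact.
  apply: smooth_on_partial; exact: transition_smooth.
pose N := ~` (point c @` K).
have oN : open N by rewrite openC; exact: bump_support_closed.
exists (coord d @` (N `&` dom d)).
  by exists q => //; split => // -[y /KV [q' cq' <-]]; rewrite coordK // => E; apply: ncq; rewrite -E.
apply: (@smooth_on_ext _ _ _ (fun=> 0)); last exact: smooth_on_cst.
  exact: coord_image_open.
move=> _ [q' [Nq' dq'] <-]; rewrite (form_inE _ dq') /bump_form.
case: ifPn => [/asboolP cq'|_]; last by rewrite mul0mx mxE.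
rewrite phi0 ?scale0r ?mul0mx ?mxE // => Kq'; apply: Nq'.
by exists (coord c q') => //; rewrite coordK.
Qed.

Lemma Dmx_bump v q : dom c q -> phi (coord c q) = 1 ->
  (forall l, partial l phi (coord c q) = 0) -> Dmx (form_in c (bump_form v)) (coord c q) = 0.
Proof.
move=> cq p1 dp; rewrite (Dmx_near_eq (b' := fun y => phi y *: v + 0)); last first.
  by apply: near_image cq _ => q' cq'; rewrite form_in_bump // addr0.
have cst (w : 'rV[R]_n) : mdiff (fun=> w) (coord c q) by move=> i j; exact: differentiable_cst.
rewrite (Dmx_scale_add (sphi [::] I) (cst v) (cst 0)) !Dmx_cst scaler0 !add0r.
rewrite [\row_l _](_ : _ = 0) ?trmx0 ?mul0mx //.
by apply/rowP => l; rewrite mxE dp mxE.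
Qed.
End BumpForm.

Lemma frame_pairing (R : realType) n (F D : 'M[R]_n) (X : 'rV[R]_n) (dF : 'I_n -> 'M[R]_n)
    (j k : 'I_n) :
  let ej : 'rV[R]_n := 'e_j in let ek : 'rV[R]_n := 'e_k in let Z : 'M[R]_n := 0 in
  (X *m (ek *m F^T *m Z^T + ek *m (rows_of ej dF)^T + ej *m F *m Z^T)^T) ord0 ord0
  = (row j D *m F *m ek^T) ord0 ord0 + (ej *m F *m (row k D)^T) ord0 ord0 ->
  dir X dF j k = (D *m F + F *m D^T) j k.
Proof.
move=> ej ek Z.
rewrite trmx0 !mulmx0 add0r addr0 trmx_mul trmxK mulmxA mul_rows_of.
have E (N : 'M[R]_n) : (ej *m N *m ek^T) ord0 ord0 = N j k.
  by rewrite trmx_delta -colE mxE -rowE mxE.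
rewrite E => ->; rewrite [RHS]mxE -!E rowE -/ej rowE -/ek trmx_mul.
by rewrite !mulmxA.
Qed.

(** * From a parallel connection to the equations of the 1-form *)

Section ParallelFrame.
Variables (R : realType) (M : smooth_manifold R 3) (oM : oriented M).
Variables (g P : M -> 'M[R]_3).
Hypotheses (hg : riemannian_metric g) (hP : bivector_field P).
Variable D : (M -> 'rV[R]_3) -> (M -> 'rV[R]_3) -> (M -> 'rV[R]_3).
Hypotheses (hD : metric_contravariant_connection g P D) (pD : parallel P D).
Let a := contract_volume g P.
Let ug q : g q \in unitmx := metric_unitmx q hg.

(** The bump forms agree at x with the coordinate frame to first order, so the values
of D on them satisfy the hypotheses of [frame_parallel_local]. *)
Lemma parallel_local c p : @atlas R 3 M c -> dom c p -> form_in c a (coord c p) != 0 ->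
  ext_d c a (coord c p) = 0 /\ lie_bivec c (sharp g a) P (coord c p) = 0.
Proof.
move=> ac cp a0; set x := coord c p.
have [phi [K [cK KV sphi phi0 [phi1 dphi]]]] :=
  bump_exists (@image_of_open _ _ _ c) (image_of_coord cp).
pose e i := @bump_form R 3 M c phi 'e_i.
have se i : smooth_form (e i) := smooth_bump_form ac cK KV sphi phi0 'e_i.
have ex i : form_in c (e i) x = 'e_i.
  by rewrite (form_in_bump phi ac 'e_i cp) phi1 scale1r.
have De i : Dmx (form_in c (e i)) x = 0 := Dmx_bump ac sphi 'e_i cp phi1 dphi.
have de i : mdiff (form_in c (e i)) x := form_mdiff ac cp (se i).
have dP : mdiff (bivec_in c P) x := bivec_mdiff hP ac cp.
have dH : mdiff (cometric_in g c) x := cometric_mdiff hg ac cp.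
pose F i : 'M[R]_3 := \matrix_j form_in c (D (e i) (e j)) x.
have rF i j : row j (F i) = form_in c (D (e i) (e j)) x by rewrite rowK.
have [_ [_ [_ [_ [metD torD]]]]] := hD.
apply: (@frame_parallel_local _ _ oM _ _ hg hP c p ac cp F) => // [i|i j k|i].
- apply/matrixP => j k; apply: frame_pairing; rewrite !rF.
  have := metD (e i) (e j) (e k) (se i) (se j) (se k) p.
  rewrite (act_in ac cp _ (diff_form_prod ac ug cp (de j) (de k) dH)).
  rewrite (grad_in_form_prod ac ug cp (de j) (de k) dH) (vec_in_anchor ac cp).
  rewrite (form_prod_in ac cp (D (e i) (e j)) (e k) (ug p)).
  rewrite (form_prod_in ac cp (e j) (D (e i) (e k)) (ug p)) -/x !ex !De rowE.
  by [].
- have := torD (e i) (e j) (se i) (se j) c ac p I cp.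
  rewrite (koszulE ac hP cp (de i) (de j) dP) -/x !ex !De !mulmx0 subrr add0r.
  have -> : form_in c (fun q => D (e i) (e j) q - D (e j) (e i) q) x =
     row j (F i) - row i (F j) by rewrite !rF /form_in mulmxBl.
  move=> /(congr1 (fun v : 'rV[R]_3 => v ord0 k)); rewrite mul_rows_ofT.
  rewrite trmx_delta -colE [X in _ = X -> _]mxE -!rowE [X in _ = X -> _]mxE.
  by rewrite [X in X = _ -> _]mxE [X in _ + X]mxE ![row _ _ _ _]mxE.
- apply/matrixP => j k; apply: frame_pairing; rewrite !rF.
  have := pD (se i) (se j) (se k) p.
  rewrite (act_in ac cp _ (diff_bivec_eval ac cp (de j) (de k) dP)).
  rewrite (grad_in_bivec_eval ac cp (de j) (de k) dP) (vec_in_anchor ac cp).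
  rewrite (bivec_eval_in ac cp P (D (e i) (e j)) (e k)).
  rewrite (bivec_eval_in ac cp P (e j) (D (e i) (e k))) -/x !ex !De rowE.
  by [].
Qed.

(** Where a is not zero this is [parallel_local]; the other points follow by continuity. *)
Lemma parallel_closed c p : @atlas R 3 M c -> dom c p -> ext_d c a (coord c p) = 0.
Proof.
move=> ac cp; have sa := smooth_volume oM hg hP.
have oV := @image_of_open _ _ _ c; have Vx := image_of_coord cp.
have sA := smooth_form_ms ac sa.
have S : msmooth (image_of c) (ext_d c a).
  apply: (msmooth_ext oV (F := fun y => Dmx (form_in c a) y + - (Dmx (form_in c a) y)^T)).
    by move=> y _; rewrite ext_dE.
  apply: (msmooth_add oV); first exact: (msmooth_Dmx oV sA).
  exact: (msmooth_opp oV (msmooth_tr oV (msmooth_Dmx oV sA))).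
apply/matrixP => i j; rewrite [RHS]mxE.
apply: (@vanish_by_density _ _ (fun y => ext_d c a y i j) [set y | form_in c a y != 0]).
- by apply: differentiable_continuous; exact: (S i j [::] _ Vx).
- apply: near_image cp _ => q cq /= aq.
  by have [-> _] := parallel_local ac cq aq; rewrite mxE.
- move=> Na.
  have Na0 : \forall y \near coord c p, form_in c a y = 0.
    by apply: filterS Na => y /negP; rewrite negbK => /eqP.
  by rewrite ext_dE (Dmx_near_eq Na0) Dmx_cst trmx0 subrr mxE.
Qed.

Lemma parallel_norm_equation c p : @atlas R 3 M c -> dom c p ->
  form_in c (differential (form_prod g a a)) (coord c p)
  + codiff c g a (coord c p) *: form_in c a (coord c p) = 0.
Proof.
move=> ac cp; have [a0|a0] := eqVneq (form_in c a (coord c p)) 0.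
  exact: (norm_equation_at_zero oM hg hP ac cp).
apply/(closed_lie_bivec_sharp oM hg hP ac cp (parallel_closed ac cp)).
by have [] := parallel_local ac cp a0.
Qed.
End ParallelFrame.

(** * The equivalence *)

Theorem theorem5p1 (R : realType) (M : smooth_manifold R 3) (oM : oriented M)
    (g : M -> 'M[R]_3) (hg : riemannian_metric g)
    (P : M -> 'M[R]_3) (hP : bivector_field P) :
  let assertion1 := killing_poisson g P in
  let assertion2 := poisson_tensor P /\
    (exists D, metric_contravariant_connection g P D /\ parallel P D) in
  let assertion3 :=
    let a := contract_volume g P in
    in_charts [set: M] (fun c x => ext_d c a x = 0) /\
    in_charts [set: M] (fun c x =>
      form_in c (differential (form_prod g a a)) x
      + codiff c g a x *: form_in c a x = 0) in
  (assertion1 <-> assertion2) /\ (assertion2 <-> assertion3).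
Proof.
move=> A1 A2 A3.
have H13 : A1 -> A3.
  move=> [_ div0 lie0]; split=> c ac p _ cp.
    by apply/(div_bivec_closed oM hg hP ac cp); exact: div0.
  have cl q : dom c q -> ext_d c (contract_volume g P) (coord c q) = 0.
    by move=> cq; apply/(div_bivec_closed oM hg hP ac cq); exact: div0.
  apply/(closed_lie_bivec_sharp oM hg hP ac cp (cl p cp)).
  exact: (killing_lie_sharp oM hg hP ac cl cp lie0).
have loc : A3 -> forall c, @atlas R 3 M c -> forall q, dom c q ->
    lie_bivec c (sharp g (contract_volume g P)) P (coord c q) = 0.
  move=> [cl eqn] c ac q cq.
  by apply/(closed_lie_bivec_sharp oM hg hP ac cq (cl c ac q I cq)); exact: eqn.
have poi : A3 -> poisson_tensor P.
  move=> [cl _]; split=> // c ac p _ cp.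
  exact: (closed_schouten oM hg hP ac cp (cl c ac p I cp)).
have H31 : A3 -> A1.
  move=> H3; have [cl _] := H3; split; first exact: poi.
    by move=> c ac p _ cp; apply/(div_bivec_closed oM hg hP ac cp); exact: cl.
  move=> U f oU Cf c ac p Up cp.
  apply: (casimir_lie oM hg hP ac _ _ oU Cf Up cp); last exact: loc.
  by move=> q cq; exact: cl.
have H23 : A2 -> A3.
  move=> [_ [D [hD pD]]]; split=> c ac p _ cp.
    exact: (parallel_closed oM hg hP hD pD ac cp).
  exact: (parallel_norm_equation oM hg hP hD pD ac cp).
have H32 : A3 -> A2.
  move=> H3; have [cl _] := H3; split; first exact: poi.
  exists (connection g P); split; first exact: connection_metric_contravariant.
  apply: connection_parallel => // p c x b.
  have ac := @chart_at_atlas R 3 M p; have cp := @chart_at_dom R 3 M p.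
  apply: (symbol_parallel oM hg hP ac cp); last exact: loc.
  exact: cl.
by split; split=> H; [exact/H32/H13|exact/H31/H23|exact: H23|exact: H32].
Qed.
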